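(* Let $A=\varinjlim (A_k,\alpha_k)$ be the limit of a direct system of digraph algebras with regular star-extendible embeddings, let $C=\varinjlim(C_k,\alpha_k)$ be the associated regular canonical masa, and suppose that $A$ is a TAF algebra, i.e. $A\cap A^*=C$. Then $$G(A;C)=C(R(A),\mathbb{Z}),$$ that is, the dimension distribution group $G(A;C)$ is identified, as an abelian group, with the group of continuous integer-valued functions vanishing at infinity on the spectrum $R(A)=R(A;C)$.
   Context: A digraph algebra is a subalgebra of some $M_n(\mathbb{C})$ containing a maximal abelian self-adjoint subalgebra (masa) of $M_n(\mathbb{C})$. A homomorphism between operator algebras $A,A'$ is star-extendible if it is the restriction of a $C^*$-algebra homomorphism $C^*(A)\to C^*(A')$. Limit algebras and masas. Let $(A_k,\alpha_k)$ be a direct system of digraph algebras with star-extendible embeddings that are regular, i.e. direct sums of multiplicity one embeddings. Then there are matrix unit systems $\{e^k_{ij}\}$ for the finite-dimensional $C^*$-algebras $B_k=C^*(A_k)$ such that $A_k$ is spanned by some of these matrix units, including all the diagonal ones, and $\alpha_k$ maps each matrix unit in $\{e^k_{ij}\}$ to a sum of matrix units in $\{e^{k+1}_{ij}\}$. Let $C_k=\mathrm{span}\{e^k_{ii}\}$. With $\tilde\alpha_k$ the unique star extension of $\alpha_k$, put $B=C^*(A)=\varinjlim(B_k,\tilde\alpha_k)$, $A=\varinjlim(A_k,\alpha_k)$, $C=\varinjlim(C_k,\alpha_k)$ (operator algebra limits), so $C\subseteq A\subseteq B$; $C$ is called the regular canonical masa. Dimension distribution group $G(A;C)$. $M_\infty(A)$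 is the stable algebra (the union of the $M_n(A)$). An element $v$ of a star algebra normalises a subalgebra $E$ if $vEv^*\subseteq E$ and $v^*Ev\subseteq E$. Let $Pi(A;C)$ be the set of partial isometries $v\in M_\infty(A)$ with $v^*v,vv^*\in M_\infty(A)$ which normalise $M_\infty(C)$. For $v,w\in Pi(A;C)$ write $v\sim w$ if $zvy=w$ for some unitaries $z,y$, in some sufficiently large matrix algebra $M_N(A)$ containing $v$ and $w$, which normalise $M_N(C)$ (if $A$ is nonunital, a unit is adjoined). $Pi(A;C)/\sim$ is an abelian monoid under $[v]+[w]=[v\oplus w]$, and $G(A;C)$ is its Grothendieck group. Spectrum. Let $X$ be the Gelfand space of $C$. Each matrix unit $e=e^k_{ij}$ induces a partial homeomorphism $\alpha$ of $X$, with domain the set of characters $y$ with $y(e^*e)=1$, such that $\alpha(y)(ece^* )=y(c)$ for $c\in C$. Its graph is $E^k_{ij}=\{(x,y): y\in \mathrm{dom}(\alpha),\ x=\alpha(y)\}\subseteq X\times X$. The spectrum (fundamental relation) is $R(A;C)=\bigcup\{E^k_{ij}: e^k_{ij}\in A_k,\ \text{all } i,j,k\}$, with the smallest topology for which each such $E^k_{ij}$ is both closed and open; it is locally compact. For triangular $A$ one writes $R(A)=R(A;C)$.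
   Formalization: Pi(A;C) is not closed under direct sums (for A=T_2, e12⊕e22 does not normalise M_2(C)), so G(A;C) is taken as the abelian group generated by Pi(A;C) with [v]=[w] for v~w, and [v]+[w]=[v⊕w] whenever v, w and v⊕w all lie in Pi(A;C). *)

(* Defs.v *)
(* [K] stands for the complex numbers; the theorem takes [K := R[i]] for
   [R : realType]. *)
From HB Require Import structures.
From mathcomp Require Import all_boot all_order all_algebra complex.
From mathcomp Require Import all_classical all_reals topology normedtype.
From mathcomp Require Import freeg.

Set Implicit Arguments.
Unset Strict Implicit.
Unset Printing Implicit Defensive.

Import Order.TTheory GRing.Theory Num.Theory numFieldNormedType.Exports.

Local Open Scope classical_set_scope.
Local Open Scope ring_scope.
Local Open Scope sesquilinear_scope.

HB.mixin Record hasStar (K : numClosedFieldType) T of GRing.Algebra K T := {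
  star : T -> T;
  starK : involutive star;
  starD : {morph star : a b / a + b};
  starM : forall a b, star (a * b) = star b * star a;
  starZ : forall (c : K) a, star (c *: a) = c^* *: star a
}.

#[short(type="starAlgType")]
HB.structure Definition StarAlgebra (K : numClosedFieldType) :=
  {T of hasStar K T & GRing.Algebra K T}.

(* The norm is a separate operation: Hierarchy Builder has no join of the
   (noncommutative) rings and the normed modules. *)
HB.mixin Record isCStar (K : numClosedFieldType) T of StarAlgebra K T := {
  cnorm : T -> K;
  cnorm_eq0 : forall a, cnorm a = 0 -> a = 0;
  cnormD_le : forall a b, cnorm (a + b) <= cnorm a + cnorm b;
  cnormZ : forall (c : K) a, cnorm (c *: a) = `|c| * cnorm a;
  cnormM_le : forall a b, cnorm (a * b) <= cnorm a * cnorm b;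
  cnorm_starM : forall a, cnorm (star a * a) = cnorm a ^+ 2;
  cnorm_complete : forall u : nat -> T,
    (forall eps : K, 0 < eps -> exists N, forall m n, (N <= m)%N -> (N <= n)%N ->
       cnorm (u m - u n) < eps) ->
    exists l, forall eps : K, 0 < eps -> exists N, forall n, (N <= n)%N ->
       cnorm (u n - l) < eps
}.

(* Unital C*-algebras. *)
#[short(type="cstarAlgType")]
HB.structure Definition CStarAlgebra (K : numClosedFieldType) :=
  {T of StarAlgebra K T & isCStar K T}.

Definition norm_closure (K : numClosedFieldType) (U : cstarAlgType K)
    (E : set U) : set U :=
  [set x | forall eps : K, 0 < eps -> exists2 y, E y & cnorm (x - y) < eps].

Section MatrixStar.
Variables (K : numClosedFieldType) (n : nat).
Local Notation M := 'M[K]_n.+1.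

Definition mx_adjoint (A : M) : M := A ^t*.

Lemma mx_adjointK : involutive mx_adjoint.
Proof. exact: trmxCK. Qed.

Lemma mx_adjointD : {morph mx_adjoint : a b / a + b}.
Proof. by move=> a b; rewrite /mx_adjoint linearD map_mxD. Qed.

Lemma mx_adjointM (a b : M) :
  mx_adjoint (a * b) = mx_adjoint b * mx_adjoint a.
Proof. by rewrite /mx_adjoint trmx_mul map_mxM. Qed.

Lemma mx_adjointZ (c : K) (a : M) :
  mx_adjoint (c *: a) = c^* *: mx_adjoint a.
Proof. by rewrite /mx_adjoint linearZ map_mxZ. Qed.

HB.instance Definition _ := hasStar.Build K M
  mx_adjointK mx_adjointD mx_adjointM mx_adjointZ.
End MatrixStar.

Section Subalgebras.
Variables (K : numClosedFieldType) (T : starAlgType K).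
Implicit Types S : set T.

Definition subspace_of S : Prop :=
  [/\ S 0, forall a b, S a -> S b -> S (a + b) &
      forall (c : K) a, S a -> S (c *: a)].

Definition lin_span : set T -> set T := smallest subspace_of.

Definition subalgebra S : Prop :=
  subspace_of S /\ forall a b, S a -> S b -> S (a * b).

Definition star_subalgebra S : Prop :=
  subalgebra S /\ forall a, S a -> S (star a).

(* The C*-algebra generated by a subset of a finite-dimensional C*-algebra:
   there, star subalgebras are automatically closed. *)
Definition cstar_gen : set T -> set T := smallest star_subalgebra.

Definition abelian_set S : Prop := forall a b, S a -> S b -> a * b = b * a.

Definition masa S : Prop :=
  [/\ star_subalgebra S, abelian_set S &
      forall S', star_subalgebra S' -> abelian_set S' -> S `<=` S' -> S' = S].

Definition projection (p : T) : Prop := p * p = p /\ star p = p.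

Definition minimal_projection S (p : T) : Prop :=
  [/\ S p, projection p, p != 0 &
      forall q, S q -> projection q -> q * p = q -> q = 0 \/ q = p].

(* Off-block indices are encoded by [e i j = 0], so that a system of type
   [M_(n1) + ... + M_(nr)] is indexed by all pairs in ['I_(n1 + ... + nr)]. *)
Definition matrix_units n S (e : 'I_n -> 'I_n -> T) : Prop :=
  [/\ forall i, e i i != 0,
      forall i j, star (e i j) = e j i,
      forall i j k l, j != k -> e i j * e k l = 0,
      forall i j l, e i j != 0 -> e j l != 0 -> e i j * e j l = e i l &
      lin_span [set e p.1 p.2 | p in [set: 'I_n * 'I_n]] = S].

End Subalgebras.

Section StarHoms.
Variables (K : numClosedFieldType) (T T' : starAlgType K).

(* Partially defined maps are encoded as total functions, whose values outside
   the domain [S] are irrelevant. *)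
Definition star_hom_on (S : set T) (S' : set T') (f : T -> T') : Prop :=
  [/\ forall a, S a -> S' (f a),
      forall a b, S a -> S b -> f (a + b) = f a + f b,
      forall (c : K) a, S a -> f (c *: a) = c *: f a,
      forall a b, S a -> S b -> f (a * b) = f a * f b &
      forall a, S a -> f (star a) = star (f a)].

Definition inj_on (S : set T) (f : T -> T') : Prop :=
  forall a b, S a -> S b -> f a = f b -> a = b.

(* [f] is the star extension, C*(A) -> C*(A'), of [h : A -> A']. *)
Definition star_extension (A : set T) (A' : set T') (h f : T -> T') : Prop :=
  [/\ star_hom_on (cstar_gen A) (cstar_gen A') f,
      forall a, A a -> A' (h a) &
      forall a, A a -> f a = h a].

(* A summand vanishes on the blocks of C*(A) that it does not embed. *)
Definition multiplicity_one (A : set T) (A' : set T') (f : T -> T') : Prop :=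
  star_extension A A' f f /\
  forall p, minimal_projection (cstar_gen A) p ->
    f p = 0 \/ minimal_projection (cstar_gen A') (f p).

Definition regular_hom (A : set T) (A' : set T') (h : T -> T') : Prop :=
  exists (r : nat) (f : 'I_r -> T -> T'),
    [/\ forall t, multiplicity_one A A' (f t),
        forall s t a b, s != t -> cstar_gen A a -> cstar_gen A b ->
          f s a * f t b = 0 &
        forall a, A a -> h a = \sum_(t < r) f t a].

End StarHoms.

Definition digraph_algebra (K : numClosedFieldType) (n : nat)
    (A : set 'M[K]_n.+1) : Prop :=
  subalgebra A /\ exists2 D, masa D & D `<=` A.

(* [dalg k] is A_k, a subalgebra of M_n with n = [(ddim k).+1]; [dhom k] is
   alpha_k, [dext k] its star extension, and [dunit k] the system of matrix
   units of B_k = C*(A_k).  Since A_k contains a masa of M_n, the number of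
   diagonal matrix units of B_k is n. *)
Record digraph_system (K : numClosedFieldType) := DigraphSystem {
  ddim : nat -> nat;
  dalg : forall k, set 'M[K]_((ddim k).+1);
  dhom : forall k, 'M[K]_((ddim k).+1) -> 'M[K]_((ddim k.+1).+1);
  dext : forall k, 'M[K]_((ddim k).+1) -> 'M[K]_((ddim k.+1).+1);
  dunit : forall k,
    'I_((ddim k).+1) -> 'I_((ddim k).+1) -> 'M[K]_((ddim k).+1) }.

Arguments dalg {K} d k _.
Arguments dhom {K} d k _.
Arguments dext {K} d k _.
Arguments dunit {K} d k _ _.

Section System.
Variables (K : numClosedFieldType) (S : digraph_system K).

Definition dcstar k : set 'M[K]_((ddim S k).+1) := cstar_gen (dalg S k).
Arguments dcstar k _ : clear implicits.

Definition ddiag k : set 'M[K]_((ddim S k).+1) :=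
  lin_span [set dunit S k i i | i in [set: 'I_((ddim S k).+1)]].
Arguments ddiag k _ : clear implicits.

Definition regular_system : Prop := forall k,
  [/\ digraph_algebra (dalg S k),
      star_extension (dalg S k) (dalg S k.+1) (dhom S k) (dext S k),
      inj_on (dalg S k) (dhom S k) &
      regular_hom (dalg S k) (dalg S k.+1) (dhom S k)].

Definition adapted_units : Prop := forall k,
  [/\ matrix_units (dcstar k) (dunit S k),
      forall i, dalg S k (dunit S k i i),
      lin_span [set a | dalg S k a /\ exists i j, a = dunit S k i j]
        = dalg S k &
      forall i j, exists Q : {set 'I_((ddim S k.+1).+1) * 'I_((ddim S k.+1).+1)},
        dext S k (dunit S k i j) = \sum_(p in Q) dunit S k.+1 p.1 p.2].

End System.

Arguments dcstar {K} S k _.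
Arguments ddiag {K} S k _.

(* Everything about the limit takes place in a unital C*-algebra [U]: the limit
   B itself if B is unital, and B with a unit adjoined otherwise. *)
Section Limit.
Variables (K : numClosedFieldType) (S : digraph_system K) (U : cstarAlgType K).
Variable iota : forall k : nat, 'M[K]_((ddim S k).+1) -> U.

Definition limit_set (F : forall k, set 'M[K]_((ddim S k).+1)) : set U :=
  norm_closure (\bigcup_k (@iota k @` F k)).

Definition limB : set U := limit_set (dcstar S).
Definition limA : set U := limit_set (dalg S).
Definition limC : set U := limit_set (ddiag S).

Definition is_limit : Prop :=
  (forall k, [/\ star_hom_on (dcstar S k) setT (@iota k),
                 inj_on (dcstar S k) (@iota k) &
                 forall a, dcstar S k a ->
                   @iota k.+1 (dext S k a) = @iota k a]) /\
  (limB = setT \/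
   (~ exists2 u, limB u & forall b, limB b -> u * b = b /\ b * u = b) /\
   (forall x, exists2 b, limB b & exists c : K, x = b + c *: 1)).

Definition TAF : Prop := limA `&` [set a | limA (star a)] = limC.

End Limit.

Section DimensionDistributionGroup.
Variables (K : numClosedFieldType) (U : cstarAlgType K) (A C : set U).

Definition Mset (E : set U) n : set 'M[U]_n := [set v | forall i j, E (v i j)].

Definition mxstar n (v : 'M[U]_n) : 'M[U]_n := (map_mx star v)^T.

Definition normalises n (v : 'M[U]_n) (E : set 'M[U]_n) : Prop :=
  forall c, E c -> E (v *m c *m mxstar v) /\ E (mxstar v *m c *m v).

Definition normalising_pisometry n (v : 'M[U]_n) : Prop :=
  [/\ Mset A v, v *m mxstar v *m v = v,
      Mset A (mxstar v *m v), Mset A (v *m mxstar v) &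
      normalises v (Mset C (n := n))].

(* This is [A] itself when [A] contains the unit. *)
Definition with_unit : set U :=
  [set x | exists2 a, A a & exists c : K, x = a + c *: 1].

Definition normalising_unitary n (z : 'M[U]_n) : Prop :=
  [/\ Mset with_unit z, z *m mxstar z = 1%:M, mxstar z *m z = 1%:M &
      normalises z (Mset C (n := n))].

(* The image of [v] in M_N under the corner inclusion M_n -> M_N, n <= N. *)
Definition corner n N (v : 'M[U]_n) : 'M[U]_N :=
  \matrix_(i, j)
    if (insub (val i) : option 'I_n, insub (val j) : option 'I_n)
      is (Some i', Some j') then v i' j' else 0.

Definition pi_equiv n m (v : 'M[U]_n) (w : 'M[U]_m) : Prop :=
  exists N, [/\ (n <= N)%N, (m <= N)%N &
    exists z y : 'M[U]_N,
      [/\ normalising_unitary z, normalising_unitary y &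
          z *m corner N v *m y = corner N w]].

(* An element of the union of the M_n(A) is given by some M_n(A) containing it;
   two representatives of the same element are related by [pi_equiv]. *)
Definition Pi : Type :=
  {v : {n : nat & 'M[U]_n} | `[< normalising_pisometry (projT2 v) >]}.
HB.instance Definition _ := Choice.on Pi.

Definition pi_size (v : Pi) : nat := projT1 (val v).
Definition pi_mx (v : Pi) : 'M[U]_(pi_size v) := projT2 (val v).

(* [s] represents the direct sum of [v] and [w].  No [s] needs to exist: with
   M_n(C) the full matrix algebra over C, the direct sum of two elements of Pi
   need not normalise. *)
Definition pi_dsum (v w s : Pi) : Prop :=
  val s = existT _ (pi_size v + pi_size w)%N
            (block_mx (pi_mx v) 0 0 (pi_mx w)).

Definition pi_relator (x : {freeg Pi / int}) : Prop :=
  (exists v w : Pi, pi_equiv (pi_mx v) (pi_mx w) /\ x = <<v>> - <<w>>) \/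
  (exists v w s : Pi, pi_dsum v w s /\ x = <<v>> + <<w>> - <<s>>).

Definition pi_relations : {pred {freeg Pi / int}} :=
  fun x => `[< smallest (fun H : set {freeg Pi / int} =>
                           zmod_closed (fun x => `[< H x >]))
                        pi_relator x >].

Lemma pi_relations_closed : zmod_closed pi_relations.
Proof.
split=> [|x y].
  by apply/asboolP => H [[/asboolP H0 _] _].
rewrite unfold_in => /asboolP Nx; rewrite unfold_in => /asboolP Ny.
apply/asboolP => H HP; have [[_ HB] _] := HP.
by apply/asboolP/HB; apply/asboolP; [exact: Nx|exact: Ny].
Qed.
HB.instance Definition _ :=
  GRing.isZmodClosed.Build {freeg Pi / int} pi_relations pi_relations_closed.

(* The Grothendieck group of Pi/~, presented by generators and relations. *)
Definition dim_group : Type := Quotient.quot pi_relations.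
HB.instance Definition _ := GRing.Zmodule.on dim_group.

End DimensionDistributionGroup.

Section Spectrum.
Variables (K : numClosedFieldType) (S : digraph_system K) (U : cstarAlgType K).
Variable iota : forall k, 'M[K]_((ddim S k).+1) -> U.
Local Notation C := (limC iota).

(* Characters are extended by 0 outside C, so that two of them are equal as
   soon as they agree on C. *)
Definition gelfand_space : set (U -> K) :=
  [set y | [/\ forall a b, C a -> C b -> y (a + b) = y a + y b,
               forall (c : K) a, C a -> y (c *: a) = c * y a,
               forall a b, C a -> C b -> y (a * b) = y a * y b,
               exists2 a, C a & y a != 0 &
               forall a, ~ C a -> y a = 0]].

Definition unit_graph (e : U) : set ((U -> K) * (U -> K)) :=
  [set p | [/\ gelfand_space p.1, gelfand_space p.2,
               p.2 (star e * e) = 1 &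
               forall c, C c -> p.1 (e * c * star e) = p.2 c]].

Definition spectrum_graphs : set (set ((U -> K) * (U -> K))) :=
  [set E | exists k i j,
     dalg S k (dunit S k i j) /\ E = unit_graph (@iota k (dunit S k i j))].

Definition spectrum : Type := set_type (\bigcup_(E in spectrum_graphs) E).
HB.instance Definition _ := Choice.on spectrum.

Definition spectrum_subbase : set (set spectrum) :=
  [set V | exists2 E, spectrum_graphs E &
     V = [set p | E (val p)] \/ V = ~` [set p | E (val p)]].

HB.instance Definition _ :=
  isSubBaseTopological.Build spectrum spectrum_subbase id.

End Spectrum.

Section IntegerFunctions.
Variable X : topologicalType.

Definition C0Z_pred : {pred X -> int} := fun f =>
  `[< continuous (f : X -> discrete_topology int) /\
      forall eps : rat, 0 < eps ->
        exists2 F : set X, compact F &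
          forall x, ~ F x -> `|f x|%:~R < eps >].

Lemma C0Z_closed : zmod_closed C0Z_pred.
Proof.
split=> [|f g].
  apply/asboolP; split=> [x|eps eps0]; first exact: cst_continuous.
  by exists set0 => [|x _]; [exact: compact0|rewrite normr0].
rewrite unfold_in => /asboolP[fc f0]; rewrite unfold_in => /asboolP[gc g0].
apply/asboolP; split=> [x|eps eps0].
  have fx : \forall y \near x, f y = f x.
    exact: (fc x [set f x] (discrete_set1 (f x : discrete_topology int))).
  have gx : \forall y \near x, g y = g x.
    exact: (gc x [set g x] (discrete_set1 (g x : discrete_topology int))).
  move=> V /nbhs_singleton Vx.
  apply: filterS2 fx gx => y fy gy; move: Vx.
  by rewrite /= !fctE fy gy.
have e2 : 0 < eps / 2 by rewrite divr_gt0.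
have [F cF fF] := f0 _ e2; have [G cG gG] := g0 _ e2.
exists (F `|` G) => [|x /not_orP[/fF fx /gG gx]]; first exact: compactU.
rewrite [eps]splitr; apply: le_lt_trans (ltrD fx gx).
by rewrite -intrD ler_int; exact: ler_normB.
Qed.
HB.instance Definition _ :=
  GRing.isZmodClosed.Build (X -> int) C0Z_pred C0Z_closed.

(* Continuous integer-valued functions vanishing at infinity. *)
Definition C0Z : Type := {f : X -> int | f \in C0Z_pred}.
HB.instance Definition _ := SubChoice.on C0Z.
HB.instance Definition _ := [SubChoice_isSubZmodule of C0Z by <:].

End IntegerFunctions.

(* Main.v *)
Require Import Defs.
From HB Require Import structures.
From mathcomp Require Import all_boot all_order all_algebra complex.
From mathcomp Require Import all_classical all_reals topology normedtype.
From mathcomp Require Import freeg.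
From mathcomp Require Import sequences.
From mathcomp Require Import finmap.
From mathcomp Require Import ring lra.

Set Implicit Arguments.
Unset Strict Implicit.
Unset Printing Implicit Defensive.

Import Order.TTheory GRing.Theory Num.Theory numFieldNormedType.Exports.

Local Open Scope classical_set_scope.
Local Open Scope ring_scope.

(* A normalising partial isometry v in M_n(A) has, at each point (x, y) of the
   spectrum, a complex n x n coefficient matrix v(x, y): compress v by the diagonal
   matrix units through which x and y pass and let the level tend to infinity.
   By the TAF condition a unitary normalising M_N(C) lies in M_N(C) (up to the
   unit), so its coefficient matrices live on the diagonal x = y and are
   invertible there.  Hence rank v(x, y) only depends on the class [v], and
   taking ranks is an additive map from G(A; C) to functions on R(A).

   Conversely, at a high enough level L the compressions e_ii v e_jj are again
   normalising partial isometries, v is equivalent to their direct sum, and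
   each of them is close to, hence equal up to equivalence to, r_ij copies of
   e_ij.  So [v] is the sum of the r_ij [e_ij], whose rank function is the sum
   of the r_ij times the indicator of the graph E_ij.  The graphs at level L are
   disjoint, which gives injectivity; they are compact and open and generate
   the topology, so their indicators span C_0(R(A), Z). *)

(** * Norms *)

Section Norm.
Variables (R : realType).
Local Notation K := R[i].

(** Why a normalising unitary has entries in [C] up to the unit: its adjoint is its inverse, and at
    a finite level an inverse is a polynomial in the element. Approximating the unitary by finite
    levels therefore keeps its adjoint over [A] as well, and [A] meets its adjoint only in [C].

    Approximate statements become exact because a partial isometry or an idempotent of norm less
    than 1 is zero. The copies of e_ij arise in this way: a projection over [C] near a constant
    matrix is equivalent to a constant projection, by a polar decomposition whose inverse square
    root is built by an iteration that never leaves the matrices over [C].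

    Two obstacles shape the argument. M_n(C) is the full matrix algebra over [C], so a direct sum of
    normalising partial isometries need not normalise; each additive relation needs a proof that the
    cross terms vanish, which for cuts by projections of [C] follows from commutativity and
    normalisation. And [A] may be nonunital, so complements such as 1 - e live only in
    [with_unit C], and facts about [C] need companions there. *)

Definition nc (c : K) : R := complex.Re `|c|.

Lemma ncE (c : K) : `|c| = (nc c)%:C%C.
Proof. by rewrite /nc normc_def. Qed.

Lemma nc_ge0 c : 0 <= nc c.
Proof. by rewrite -ler0c -ncE normr_ge0. Qed.

Lemma nc0 : nc 0 = 0.
Proof. by rewrite /nc normr0. Qed.

Lemma nc1 : nc 1 = 1.
Proof. by rewrite /nc normr1. Qed.

Lemma nc_eq0 c : nc c = 0 -> c = 0.
Proof. by move=> h; apply: normr0_eq0; rewrite ncE h. Qed.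

Lemma ncN c : nc (- c) = nc c.
Proof. by rewrite /nc normrN. Qed.

Lemma ncM c d : nc (c * d) = nc c * nc d.
Proof.
by apply: (@complexI R); rewrite rmorphM /= -!ncE normrM.
Qed.

Lemma ncD c d : nc (c + d) <= nc c + nc d.
Proof. by rewrite -lecR rmorphD /= -!ncE ler_normD. Qed.

Lemma nc_distC c d : nc (c - d) = nc (d - c).
Proof. by rewrite -ncN opprB. Qed.

Lemma nc_real (r : R) : nc (r%:C%C) = `|r|.
Proof. by rewrite /nc normc_def /= expr0n addr0 sqrtr_sqr. Qed.

Lemma gt0_complex (e : K) : 0 < e -> exists2 r : R, 0 < r & e = r%:C%C.
Proof.
move=> e0; exists (complex.Re e); last by rewrite RRe_real// gtr0_real.
by move: e0; rewrite ltcE /= => /andP[_].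
Qed.

Variable U : cstarAlgType K.
(** Taken in [R], where the order is total and arithmetic tactics apply, rather than in the complex
    numbers. *)
Definition nrm (a : U) : R := complex.Re (cnorm a).

Lemma cnorm0 : cnorm (0 : U) = 0.
Proof. by rewrite -(scale0r (0 : U)) cnormZ normr0 mul0r. Qed.

Lemma cnormN (a : U) : cnorm (- a) = cnorm a.
Proof. by rewrite -scaleN1r cnormZ normrN normr1 mul1r. Qed.

Lemma cnorm_ge0 (a : U) : 0 <= cnorm a.
Proof.
have := cnormD_le a (- a); rewrite subrr cnorm0 cnormN -mulr2n.
by rewrite pmulrn_lge0.
Qed.

Lemma nrmE a : cnorm a = (nrm a)%:C%C.
Proof. by rewrite /nrm RRe_real// ger0_real// cnorm_ge0. Qed.

Lemma nrm_ge0 a : 0 <= nrm a.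
Proof. by rewrite -ler0c -nrmE cnorm_ge0. Qed.

Lemma nrm_eq0 a : nrm a = 0 -> a = 0.
Proof. by move=> h; apply: cnorm_eq0; rewrite nrmE h. Qed.

Lemma nrm0 : nrm 0 = 0.
Proof. by rewrite /nrm cnorm0. Qed.

Lemma nrmN a : nrm (- a) = nrm a.
Proof. by rewrite /nrm cnormN. Qed.

Lemma nrmD a b : nrm (a + b) <= nrm a + nrm b.
Proof. by rewrite -lecR rmorphD /= -!nrmE cnormD_le. Qed.

Lemma nrmB a b : nrm (a - b) <= nrm a + nrm b.
Proof. by rewrite -(nrmN b) nrmD. Qed.

Lemma nrm_distC a b : nrm (a - b) = nrm (b - a).
Proof. by rewrite -nrmN opprB. Qed.

Lemma nrm_dist a b c : nrm (a - c) <= nrm (a - b) + nrm (b - c).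
Proof. by apply: le_trans (nrmD _ _); rewrite addrA subrK. Qed.

Lemma nrmZ c a : nrm (c *: a) = nc c * nrm a.
Proof.
by apply: (@complexI R); rewrite rmorphM /= -!nrmE -ncE cnormZ.
Qed.

Lemma nrmM a b : nrm (a * b) <= nrm a * nrm b.
Proof. by rewrite -lecR rmorphM /= -!nrmE cnormM_le. Qed.

Lemma nrm_starM a : nrm (star a * a) = nrm a ^+ 2.
Proof.
by apply: (@complexI R); rewrite rmorphXn /= -!nrmE cnorm_starM.
Qed.

(** The C*-identity and submultiplicativity bound the square of [nrm b] by [nrm (star b) * nrm b];
    the converse follows by exchanging b and its adjoint. *)
Lemma nrm_star a : nrm (star a) = nrm a.
Proof.
have le (b : U) : nrm b <= nrm (star b).
  have [/eqP->|b0] := boolP (nrm b == 0); first exact: nrm_ge0.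
  have := nrmM (star b) b; rewrite nrm_starM expr2 ler_pM2r//.
  by rewrite lt_neqAle eq_sym b0 nrm_ge0.
by apply/eqP; rewrite eq_le le andbT -{2}(starK a) le.
Qed.

Lemma nrm_gt0 a : a != 0 -> 0 < nrm a.
Proof.
move=> a0; rewrite lt_neqAle nrm_ge0 andbT eq_sym.
by apply: contra a0 => /eqP/nrm_eq0 ->.
Qed.

Lemma star1 : star (1 : U) = 1.
Proof.
have h : star (1 : U) * 1 = 1.
  by rewrite -[X in _ * X](starK (1 : U)) -starM mulr1 starK.
by rewrite mulr1 in h.
Qed.

Lemma nrm1_le : nrm 1 <= 1.
Proof.
have := nrm_starM 1; rewrite star1 mulr1 => h.
have := nrm_ge0 1; nra.
Qed.

Lemma nrm_proj (p : U) : p * p = p -> star p = p -> nrm p <= 1.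
Proof.
move=> pp sp; have := nrm_starM p; rewrite sp pp => h.
have := nrm_ge0 p; nra.
Qed.

Lemma nrm_small a : (forall e : R, 0 < e -> nrm a <= e) -> a = 0.
Proof.
move=> h; apply: nrm_eq0; apply/eqP; rewrite eq_le nrm_ge0 andbT.
by apply/ler_addgt0Pl => e e0; rewrite addr0 h.
Qed.

Lemma star0 : star (0 : U) = 0.
Proof. by apply: (@addIr U (star 0)); rewrite -starD !add0r. Qed.

Lemma starN (a : U) : star (- a) = - star a.
Proof. by apply/eqP; rewrite -addr_eq0 -starD addNr star0. Qed.

Lemma starB (a b : U) : star (a - b) = star a - star b.
Proof. by rewrite starD starN. Qed.

Lemma star_sum I (r : seq I) P (F : I -> U) :
  star (\sum_(i <- r | P i) F i) = \sum_(i <- r | P i) star (F i).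
Proof. exact: (big_morph _ (@starD _ _) star0). Qed.

Lemma nrm_sum I (r : seq I) P (F : I -> U) :
  nrm (\sum_(i <- r | P i) F i) <= \sum_(i <- r | P i) nrm (F i).
Proof.
elim/big_rec2: _ => [|i x y _ h]; first by rewrite nrm0.
by apply: le_trans (nrmD _ _) _; rewrite lerD2l.
Qed.

Lemma nrm_complete (u : nat -> U) :
  (forall e : R, 0 < e -> exists N, forall m n, (N <= m)%N -> (N <= n)%N ->
     nrm (u m - u n) < e) ->
  exists l, forall e : R, 0 < e -> exists N, forall n, (N <= n)%N ->
     nrm (u n - l) < e.
Proof.
move=> h; case: (@cnorm_complete _ _ u) => [e /gt0_complex[r r0 ->]|l hl].
  have [N hN] := h r r0; exists N => m n Nm Nn.
  by rewrite nrmE ltcR hN.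
exists l => e e0; have [|N hN] := hl e%:C%C; first by rewrite ltcR.
by exists N => n Nn; rewrite -ltcR -nrmE hN.
Qed.

Lemma norm_closureP (E : set U) x :
  norm_closure E x <-> (forall e : R, 0 < e -> exists2 y, E y & nrm (x - y) < e).
Proof.
split=> h e => [e0|/gt0_complex[r r0 ->]].
  have [|y Ey] := h e%:C%C; first by rewrite ltcR.
  by rewrite nrmE ltcR; exists y.
by have [y Ey] := h r r0; exists y => //; rewrite nrmE ltcR.
Qed.

End Norm.

Section CompleteC.
Variable R : realType.

Lemma nc_complete (u : nat -> R[i]) :
  (forall e : R, 0 < e -> exists N, forall m n, (N <= m)%N -> (N <= n)%N ->
     nc (u m - u n) < e) ->
  exists l, forall e : R, 0 < e -> exists N, forall n, (N <= n)%N ->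
     nc (u n - l) < e.
Proof.
move=> h.
have part (f : R[i] -> R) : (forall a b, `|f a - f b| <= nc (a - b)) ->
  exists l : R, forall e : R, 0 < e -> exists N, forall n, (N <= n)%N ->
     `|f (u n) - l| < e.
  move=> fle.
  have : cvg ((f \o u) @ \oo).
    apply: cauchy_cvg; apply/cauchyP => e e0; have [N hN] := h e e0.
    exists (f (u N)); exists N => // n /= Nn; apply: le_lt_trans (fle _ _) _.
    exact: hN.
  move=> /cvg_ex[l /= /cvgrPdist_lt hl]; exists l => e e0.
  have [N _ hN] := hl e e0; exists N => n Nn; rewrite distrC.
  exact: (hN n).
have ncRe (a : R[i]) : `|complex.Re a| <= nc a.
  by rewrite /nc normc_def /= -sqrtr_sqr ler_wsqrtr// lerDl sqr_ge0.
have ncIm (a : R[i]) : `|complex.Im a| <= nc a.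
  by rewrite /nc normc_def /= -sqrtr_sqr ler_wsqrtr// lerDr sqr_ge0.
have [a|x hx] := part (@complex.Re R).
  by move=> b; apply: le_trans (ncRe _); case: a b => ? ? [? ?].
have [a|y hy] := part (@complex.Im R).
  by move=> b; apply: le_trans (ncIm _); case: a b => ? ? [? ?].
exists (x +i* y)%C => e e0.
have e2 : 0 < e / 2 by lra.
have [N hN] := hx _ e2; have [M hM] := hy _ e2.
exists (maxn N M) => n; rewrite geq_max => /andP[/hN h1 /hM h2].
set a := u n in h1 h2 *.
have -> : a - (x +i* y)%C =
    (complex.Re a - x)%:C%C + (0 +i* 1)%C * (complex.Im a - y)%:C%C.
  case: (a) => p q; simpc; congr (_ +i* _)%C; ring.
apply: le_lt_trans (ncD _ _) _; rewrite ncM !nc_real.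
have -> : nc (0 +i* 1 : R[i])%C = 1.
  by rewrite /nc normc_def /= expr0n add0r expr1n sqrtr1.
lra.
Qed.
End CompleteC.

(** * Norms and adjoints of matrices over a C*-algebra *)

Section MatrixNorm.
Variables (R : realType) (U : cstarAlgType R[i]).

(** This entrywise norm is not the C*-norm of the matrix algebra. It is submultiplicative and
    invariant under the adjoint, which is enough since each estimate concerns a fixed matrix
    size. *)
Definition mn m n (v : 'M[U]_(m, n)) : R := \sum_i \sum_j nrm (v i j).

Lemma mn_ge0 m n (v : 'M[U]_(m, n)) : 0 <= mn v.
Proof. by apply: sumr_ge0 => i _; apply: sumr_ge0 => j _; exact: nrm_ge0. Qed.

Lemma le_mn m n (v : 'M[U]_(m, n)) i j : nrm (v i j) <= mn v.
Proof.
rewrite /mn (bigD1 i)//= (bigD1 j)//= -addrA lerDl addr_ge0//.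
  by apply: sumr_ge0 => ? _; exact: nrm_ge0.
by apply: sumr_ge0 => ? _; apply: sumr_ge0 => ? _; exact: nrm_ge0.
Qed.

Lemma mn_eq0 m n (v : 'M[U]_(m, n)) : mn v <= 0 -> v = 0.
Proof.
move=> h; apply/matrixP => i j; rewrite mxE; apply: nrm_eq0.
by apply/eqP; rewrite eq_le nrm_ge0 andbT (le_trans (le_mn _ _ _)).
Qed.

Lemma mn_leC m n (v : 'M[U]_(m, n)) c :
  (forall i j, nrm (v i j) <= c) -> mn v <= (m * n)%:R * c.
Proof.
move=> h; apply: (@le_trans _ _ (\sum_(i < m) \sum_(j < n) c)).
  by apply: ler_sum => i _; apply: ler_sum => j _.
by rewrite !sumr_const !card_ord -mulrnA mulnC mulr_natl.
Qed.

Lemma mn0 m n : mn (0 : 'M[U]_(m, n)) = 0.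
Proof. by rewrite /mn big1// => i _; rewrite big1// => j _; rewrite mxE nrm0. Qed.

Lemma mnD m n (v w : 'M[U]_(m, n)) : mn (v + w) <= mn v + mn w.
Proof.
rewrite /mn -big_split; apply: ler_sum => i _.
by rewrite -big_split; apply: ler_sum => j _; rewrite mxE nrmD.
Qed.

Lemma mnN m n (v : 'M[U]_(m, n)) : mn (- v) = mn v.
Proof. by apply: eq_bigr => i _; apply: eq_bigr => j _; rewrite mxE nrmN. Qed.

Lemma mnB m n (v w : 'M[U]_(m, n)) : mn (v - w) <= mn v + mn w.
Proof. by rewrite -(mnN w) mnD. Qed.

Lemma mn_distC m n (v w : 'M[U]_(m, n)) : mn (v - w) = mn (w - v).
Proof. by rewrite -mnN opprB. Qed.

Lemma mn_dist m n (v w z : 'M[U]_(m, n)) : mn (v - z) <= mn (v - w) + mn (w - z).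
Proof. by apply: le_trans (mnD _ _); rewrite addrA subrK. Qed.

Lemma mnM m n p (v : 'M[U]_(m, n)) (w : 'M[U]_(n, p)) :
  mn (v *m w) <= mn v * mn w.
Proof.
have h i j : nrm ((v *m w) i j) <= \sum_k nrm (v i k) * nrm (w k j).
  rewrite mxE; apply: le_trans (nrm_sum _ _ _) _.
  by apply: ler_sum => k _; exact: nrmM.
apply: (@le_trans _ _ (\sum_i \sum_k nrm (v i k) * \sum_j nrm (w k j))).
  apply: ler_sum => i _; under [X in _ <= X]eq_bigr do rewrite mulr_sumr.
  by rewrite exchange_big; apply: ler_sum => j _.
rewrite {1}/mn mulr_suml; apply: ler_sum => i _.
rewrite mulr_suml; apply: ler_sum => k _; apply: ler_wpM2l; first exact: nrm_ge0.
rewrite {1}/mn (bigD1 k)//= lerDl.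
by apply: sumr_ge0 => ? _; apply: sumr_ge0 => ? _; exact: nrm_ge0.
Qed.

Lemma mxstarE n (v : 'M[U]_n) i j : mxstar v i j = star (v j i).
Proof. by rewrite !mxE. Qed.

Lemma mxstarK n : involutive (@mxstar _ U n).
Proof. by move=> v; apply/matrixP => i j; rewrite !mxstarE starK. Qed.

Lemma mxstarD n (v w : 'M[U]_n) : mxstar (v + w) = mxstar v + mxstar w.
Proof. by apply/matrixP => i j; rewrite !mxE starD. Qed.

Lemma mxstarN n (v : 'M[U]_n) : mxstar (- v) = - mxstar v.
Proof. by apply/matrixP => i j; rewrite !mxE starN. Qed.

Lemma mxstarB n (v w : 'M[U]_n) : mxstar (v - w) = mxstar v - mxstar w.
Proof. by rewrite mxstarD mxstarN. Qed.

Lemma mxstar0 n : mxstar (0 : 'M[U]_n) = 0.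
Proof. by apply/matrixP => i j; rewrite !mxE star0. Qed.

Lemma mxstar1 n : mxstar (1%:M : 'M[U]_n) = 1%:M.
Proof.
apply/matrixP => i j; rewrite !mxE eq_sym; case: eqP => _; first exact: star1.
exact: star0.
Qed.

Lemma mxstarM n (v w : 'M[U]_n) : mxstar (v *m w) = mxstar w *m mxstar v.
Proof.
apply/matrixP => i j; rewrite mxstarE !mxE star_sum; apply: eq_bigr => k _.
by rewrite starM !mxstarE.
Qed.

Lemma mxstar_scalar n (a : U) : mxstar (a%:M : 'M[U]_n) = (star a)%:M.
Proof.
apply/matrixP => i j; rewrite !mxE eq_sym; case: eqP => _ //=.
by rewrite !mulr0n star0.
Qed.

Lemma mn_star n (v : 'M[U]_n) : mn (mxstar v) = mn v.
Proof.
rewrite /mn exchange_big; apply: eq_bigr => i _; apply: eq_bigr => j _.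
by rewrite mxstarE nrm_star.
Qed.

Lemma mxstar_block m n (a : 'M[U]_m) b c (d : 'M[U]_n) :
  mxstar (block_mx a b c d) =
  block_mx (mxstar a) (map_mx star c)^T (map_mx star b)^T (mxstar d).
Proof. by rewrite /mxstar map_block_mx tr_block_mx. Qed.

(** The norm of an idempotent is at most its own square, so no value strictly between 0 and 1 is
    possible. *)
Lemma idem_small n (p : 'M[U]_n) : p *m p = p -> mn p < 1 -> p = 0.
Proof.
move=> pp p1; apply: mn_eq0; have := mnM p p; rewrite pp => h.
have := mn_ge0 p; nra.
Qed.

(** The norm is at most its own cube, because the adjoint has the same norm. *)
Lemma pisom_small n (v : 'M[U]_n) : v *m mxstar v *m v = v -> mn v < 1 -> v = 0.
Proof.
move=> vv v1; apply: mn_eq0; have h0 := mn_ge0 v.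
have h1 : mn (v *m mxstar v) <= mn v * mn v.
  by apply: le_trans (mnM _ _) _; rewrite mn_star.
have h2 := le_trans (mnM (v *m mxstar v) v) (ler_wpM2r h0 h1).
rewrite vv in h2; nra.
Qed.

Lemma scalarMl m n (a : U) (v : 'M[U]_(m, n)) i j : (a%:M *m v) i j = a * v i j.
Proof. by rewrite mul_scalar_mx mxE. Qed.

Lemma scalarMr m n (a : U) (v : 'M[U]_(m, n)) i j : (v *m a%:M) i j = v i j * a.
Proof.
rewrite mxE (bigD1 j)//= mxE eqxx mulr1n big1 ?addr0// => k kj.
by rewrite mxE (negbTE kj) mulr0n mulr0.
Qed.

Lemma mn_scalarMl m n (a : U) (v : 'M[U]_(m, n)) : mn (a%:M *m v) <= nrm a * mn v.
Proof.
rewrite /mn mulr_sumr; apply: ler_sum => i _.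
by rewrite mulr_sumr; apply: ler_sum => j _; rewrite scalarMl nrmM.
Qed.

Lemma mn_scalarMr m n (a : U) (v : 'M[U]_(m, n)) : mn (v *m a%:M) <= mn v * nrm a.
Proof.
rewrite /mn mulr_suml; apply: ler_sum => i _.
by rewrite mulr_suml; apply: ler_sum => j _; rewrite scalarMr nrmM.
Qed.

Lemma mn_scalarMl1 m n (a : U) (v : 'M[U]_(m, n)) : nrm a <= 1 -> mn (a%:M *m v) <= mn v.
Proof.
move=> a1; apply: le_trans (mn_scalarMl _ _) _.
by rewrite -[leRHS]mul1r ler_wpM2r// mn_ge0.
Qed.

Lemma mn_scalarMr1 m n (a : U) (v : 'M[U]_(m, n)) : nrm a <= 1 -> mn (v *m a%:M) <= mn v.
Proof.
move=> a1; apply: le_trans (mn_scalarMr _ _) _.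
by rewrite -[leRHS]mulr1 ler_wpM2l// mn_ge0.
Qed.

Lemma mn_small m n (v : 'M[U]_(m, n)) : (forall e, 0 < e -> mn v <= e) -> v = 0.
Proof.
by move=> h; apply: mn_eq0; apply/ler_addgt0Pl => e e0; rewrite addr0 h.
Qed.

(** The elementary tensor of a complex matrix with an element of the algebra. *)
Definition amp m n (b : 'M[R[i]]_(m, n)) (a : U) : 'M[U]_(m, n) :=
  \matrix_(i, j) (b i j *: a).

Lemma ampE m n (b : 'M[R[i]]_(m, n)) a i j : amp b a i j = b i j *: a.
Proof. by rewrite mxE. Qed.

Lemma ampM m n p (b : 'M_(m, n)) (b' : 'M_(n, p)) a a' :
  amp b a *m amp b' a' = amp (b *m b') (a * a').
Proof.
apply/matrixP => i j; rewrite !mxE scaler_suml; apply: eq_bigr => k _.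
by rewrite !mxE -scalerAl -scalerAr scalerA.
Qed.

Lemma amp_scalar n (a : U) : amp (1%:M : 'M_n) a = a%:M.
Proof.
apply/matrixP => i j; rewrite !mxE; case: eqP => _; last by rewrite scale0r.
by rewrite scale1r.
Qed.

Lemma mxstar_amp n (b : 'M_n) a : mxstar (amp b a) = amp (b ^t*)%sesqui (star a).
Proof. by apply/matrixP => i j; rewrite !mxE starZ. Qed.

End MatrixNorm.

(** * Matrix units of the limit algebra *)

Section Units.
Variables (R : realType) (S : digraph_system R[i]) (U : cstarAlgType R[i]).
Variable iota : forall k, 'M[R[i]]_((ddim S k).+1) -> U.
Hypotheses (Sreg : regular_system S) (Sunits : adapted_units S).
Hypothesis Ulim : is_limit iota.
Local Notation K := R[i].
Local Notation I k := 'I_((ddim S k).+1).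

Definition munit k (i j : I k) : U := iota (dunit S k i j).
(** This also holds for off-block pairs, whose unit is 0; hence the separate assumptions
    [E i j != 0] below. *)
Definition mtri k (i j : I k) : bool := `[< dalg S k (dunit S k i j) >].
Local Notation E := munit.
Local Notation T := mtri.

Lemma lin_span_sub (W : starAlgType K) (G F : set W) :
  subspace_of F -> G `<=` F -> lin_span G `<=` F.
Proof. by move=> sF GF; apply: smallest_sub. Qed.

Lemma dalg_sub k : dalg S k `<=` dcstar S k.
Proof. exact: sub_gen_smallest. Qed.

Lemma dcstar_star_subalgebra k : star_subalgebra (dcstar S k).
Proof.
split; first split; first split.
- by move=> F [[[[? _ _] _] _] _].
- by move=> a b Fa Fb F HF; have [[[[_ h _] _] _] _] := HF; apply: h; [exact: Fa|exact: Fb].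
- by move=> c a Fa F HF; have [[[[_ _ h] _] _] _] := HF; apply: h; exact: Fa.
- by move=> a b Fa Fb F HF; have [[[_ h] _] _] := HF; apply: h; [exact: Fa|exact: Fb].
- by move=> a Fa F HF; have [[_ h] _] := HF; apply: h; exact: Fa.
Qed.

Lemma dcstar0 k : dcstar S k 0.
Proof. by have [[[? _ _] _] _] := dcstar_star_subalgebra k. Qed.
Lemma dcstarD k a b : dcstar S k a -> dcstar S k b -> dcstar S k (a + b).
Proof. by have [[[_ h _] _] _] := dcstar_star_subalgebra k; exact: h. Qed.
Lemma dcstarZ k c a : dcstar S k a -> dcstar S k (c *: a).
Proof. by have [[[_ _ h] _] _] := dcstar_star_subalgebra k; exact: h. Qed.
Lemma dcstar_sum k J (r : seq J) (P : pred J) F :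
  (forall i, P i -> dcstar S k (F i)) -> dcstar S k (\sum_(i <- r | P i) F i).
Proof. by move=> h; elim/big_ind: _ => //; [exact: dcstar0|exact: dcstarD]. Qed.

Lemma dalg_subalgebra k : subalgebra (dalg S k).
Proof. by have [[]] := Sreg k. Qed.

Lemma dunit_in k i j : dcstar S k (dunit S k i j).
Proof.
have [[_ _ _ _ <-] _ _ _] := Sunits k.
by apply: sub_gen_smallest; exists (i, j).
Qed.

Lemma iotaD k a b : dcstar S k a -> dcstar S k b -> iota (a + b) = iota a + iota b.
Proof. by have [[_ h _ _ _] _ _] := Ulim.1 k; exact: h. Qed.
Lemma iotaZ k c a : dcstar S k a -> iota (c *: a) = c *: iota a.
Proof. by have [[_ _ h _ _] _ _] := Ulim.1 k; exact: h. Qed.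
Lemma iotaM k a b : dcstar S k a -> dcstar S k b -> iota (a * b) = iota a * iota b.
Proof. by have [[_ _ _ h _] _ _] := Ulim.1 k; exact: h. Qed.
Lemma iota_star k a : dcstar S k a -> iota (star a) = star (iota a).
Proof. by have [[_ _ _ _ h] _ _] := Ulim.1 k; exact: h. Qed.
Lemma iota0 k : iota (0 : 'M_((ddim S k).+1)) = 0.
Proof. by rewrite -(scale0r 0) iotaZ ?scale0r//; exact: dcstar0. Qed.
Lemma iota_inj k a b : dcstar S k a -> dcstar S k b -> iota a = iota b -> a = b.
Proof. by have [_ h _] := Ulim.1 k; exact: h. Qed.
Lemma iota_sum k J (r : seq J) (P : pred J) F :
  (forall i, P i -> dcstar S k (F i)) ->
  iota (\sum_(i <- r | P i) F i) = \sum_(i <- r | P i) iota (F i).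
Proof.
move=> h; elim: r => [|j r IH]; first by rewrite !big_nil iota0.
rewrite !big_cons; case: ifP => // Pj.
by rewrite iotaD ?IH//; [exact: h|exact: dcstar_sum].
Qed.

Lemma munit_neq0 k (i j : I k) : (E i j != 0) = (dunit S k i j != 0).
Proof.
rewrite /E; congr (~~ _); apply/eqP/eqP => [|->]; last exact: iota0.
rewrite -(iota0 k); apply: iota_inj; [exact: dunit_in|exact: dcstar0].
Qed.

Lemma munit_star k (i j : I k) : star (E i j) = E j i.
Proof.
rewrite -iota_star; last exact: dunit_in.
by have [[_ -> _ _ _] _ _ _] := Sunits k.
Qed.

Lemma munit_diag k (i : I k) : E i i != 0.
Proof. by rewrite munit_neq0; have [[h _ _ _ _] _ _ _] := Sunits k. Qed.

Lemma munit_mul0 k (i j l m : I k) : j != l -> E i j * E l m = 0.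
Proof.
move=> jl; rewrite -iotaM; [|exact: dunit_in..].
by have [[_ _ h _ _] _ _ _] := Sunits k; rewrite h// iota0.
Qed.

Lemma munit_mul k (i j l : I k) : E i j != 0 -> E j l != 0 -> E i j * E j l = E i l.
Proof.
rewrite !munit_neq0 => h1 h2; rewrite -iotaM; [|exact: dunit_in..].
by have [[_ _ _ h _] _ _ _] := Sunits k; rewrite h.
Qed.

Lemma munit_idl k (i j : I k) : E i i * E i j = E i j.
Proof.
have [->|e] := eqVneq (E i j) 0; first by rewrite mulr0.
by rewrite munit_mul// munit_diag.
Qed.

Lemma munit_idr k (i j : I k) : E i j * E j j = E i j.
Proof.
have [->|e] := eqVneq (E i j) 0; first by rewrite mul0r.
by rewrite munit_mul// munit_diag.
Qed.

Lemma munit_sym k (i j : I k) : (E i j != 0) = (E j i != 0).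
Proof.
congr (~~ _); apply/eqP/eqP => h; rewrite -munit_star h; exact: star0.
Qed.

Lemma munit_starl k (i j : I k) : E i j != 0 -> E i j * E j i = E i i.
Proof. by move=> h; rewrite munit_mul// munit_sym. Qed.

Lemma munit_diagM k (i j : I k) : E i i * E j j = if i == j then E i i else 0.
Proof. by case: eqVneq => [->|ij]; [rewrite munit_idl|rewrite munit_mul0]. Qed.

Lemma nrm_munit k (i j : I k) : nrm (E i j) <= 1.
Proof.
have := nrm_starM (E i j); rewrite munit_star.
have [->|e] := eqVneq (E i j) 0; first by rewrite nrm0 ler01.
rewrite munit_starl  1?munit_sym// => h.
have : nrm (E j j) <= 1 by apply: nrm_proj; rewrite ?munit_idl ?munit_star.
have := nrm_ge0 (E i j); nra.
Qed.

Lemma nrm_munit1 k (i j : I k) : E i j != 0 -> nrm (E i j) = 1.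
Proof.
move=> e; have e0 := nrm_gt0 e; apply/eqP; rewrite eq_le nrm_munit /=.
have := nrmM (E i i) (E i j); rewrite munit_idl => h.
have h1 : 1 <= nrm (E i i) by nra.
have := nrm_starM (E j i); rewrite munit_star munit_starl// => h2.
have := nrm_star (E i j); rewrite munit_star => h3.
rewrite h3 in h2; nra.
Qed.

Lemma mtri_diag k (i : I k) : T i i.
Proof. by apply/asboolP; have [_ h _ _] := Sunits k. Qed.

Lemma mtri_trans k (i j l : I k) : E i j != 0 -> E j l != 0 -> T i j -> T j l -> T i l.
Proof.
rewrite !munit_neq0 => h1 h2 /asboolP t1 /asboolP t2; apply/asboolP.
have [[_ _ _ h _] _ _ _] := Sunits k; rewrite -(h i j l)//.
by case: (dalg_subalgebra k) => _; exact.
Qed.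

(** * Spans of matrix units at one level *)

Definition full_rel k : rel (I k) := fun _ _ => true.
Definition diag_rel k : rel (I k) := fun i j => i == j.

(** With [full_rel], [mtri] and [diag_rel] this is the image of B_k, A_k and C_k, so the three
    limits can be treated together. The coefficients at vanishing units are not determined. *)
Definition mspan k (P : rel (I k)) : set U := [set x | exists l : I k -> I k -> K,
  (forall i j, ~~ P i j -> l i j = 0) /\ x = \sum_i \sum_j l i j *: E i j].

Lemma mspan0 k (P : rel (I k)) : mspan P 0.
Proof.
exists (fun _ _ => 0); split=> //; rewrite big1// => i _; rewrite big1// => j _.
by rewrite scale0r.
Qed.

Lemma mspanD k (P : rel (I k)) x y : mspan P x -> mspan P y -> mspan P (x + y).
Proof.
move=> [l [lP ->]] [m [mP ->]]; exists (fun i j => l i j + m i j); split.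
  by move=> i j h; rewrite lP// mP// addr0.
rewrite -big_split; apply: eq_bigr => i _; rewrite -big_split; apply: eq_bigr => j _.
by rewrite scalerDl.
Qed.

Lemma mspanZ k (P : rel (I k)) c x : mspan P x -> mspan P (c *: x).
Proof.
move=> [l [lP ->]]; exists (fun i j => c * l i j); split.
  by move=> i j h; rewrite lP// mulr0.
rewrite scaler_sumr; apply: eq_bigr => i _; rewrite scaler_sumr.
by apply: eq_bigr => j _; rewrite scalerA.
Qed.

Lemma mspan_sum k (P : rel (I k)) J (r : seq J) (Q : pred J) F :
  (forall i, Q i -> mspan P (F i)) -> mspan P (\sum_(i <- r | Q i) F i).
Proof. by move=> h; elim/big_ind: _ => //; [exact: mspan0|exact: mspanD]. Qed.

Lemma mspan_unit k (P : rel (I k)) i j : P i j -> mspan P (E i j).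
Proof.
move=> Pij; exists (fun a b => ((a == i) && (b == j))%:R); split.
  by move=> a b; case: eqP => //= ->; case: eqP => // ->; rewrite Pij.
rewrite (bigD1 i)//= (bigD1 j)//= !eqxx scale1r big1 ?big1 ?addr0// => [a ai|b bj].
  by rewrite big1// => b _; rewrite (negbTE ai) scale0r.
by rewrite (negbTE bj) andbF scale0r.
Qed.

Lemma mspan_sub k (P Q : rel (I k)) x : (forall i j, P i j -> Q i j) -> mspan P x -> mspan Q x.
Proof.
move=> PQ [l [lP ->]]; exists l; split=> // i j nQ; apply: lP.
by apply: contra nQ; exact: PQ.
Qed.

Lemma mspan_ind k (P : rel (I k)) (F : U -> Prop) :
  F 0 -> (forall x y, F x -> F y -> F (x + y)) ->
  (forall c i j, P i j -> F (c *: E i j)) -> forall x, mspan P x -> F x.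
Proof.
move=> F0 FD FZ x [l [lP ->]]; elim/big_ind: _ => // i _.
elim/big_ind: _ => // j _; have [Pij|/lP ->] := boolP (P i j); first exact: FZ.
by rewrite scale0r.
Qed.

Lemma mspan_dcstar k x : mspan (@full_rel k) x -> exists2 a, dcstar S k a & iota a = x.
Proof.
move: x; apply: mspan_ind => [|x y [a Ha <-] [b Hb <-]|c i j _].
- by exists 0; [exact: dcstar0|exact: iota0].
- by exists (a + b); [exact: dcstarD|rewrite iotaD].
- exists (c *: dunit S k i j); first by apply: dcstarZ; exact: dunit_in.
  by rewrite iotaZ//; exact: dunit_in.
Qed.

Lemma image_dcstar k : @iota k @` dcstar S k = mspan (@full_rel k).
Proof.
apply/seteqP; split=> [_ [a Ha <-]|x /mspan_dcstar[a]]; last by exists a.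
suff [] : (dcstar S k `&` [set a | mspan (@full_rel k) (iota a)]) a by [].
move: a Ha; have [[_ _ _ _ {1}<-] _ _ _] := Sunits k; apply: lin_span_sub.
  split=> [|a b [Ha ha] [Hb hb]|c a [Ha ha]]; split=> /=.
  - exact: dcstar0.
  - by rewrite iota0; exact: mspan0.
  - exact: dcstarD.
  - by rewrite iotaD//; exact: mspanD.
  - exact: dcstarZ.
  - by rewrite iotaZ//; exact: mspanZ.
by move=> _ [[i j] _ <-]; split; [exact: dunit_in|exact: mspan_unit].
Qed.

Lemma image_dalg k : @iota k @` dalg S k = mspan (@T k).
Proof.
have [[A0 AD AZ] _] := dalg_subalgebra k.
apply/seteqP; split=> [_ [a Ha <-]|x].
  suff [] : (dalg S k `&` [set a | mspan (@T k) (iota a)]) a by [].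
  move: a Ha; have [_ _ {1}<- _] := Sunits k; apply: lin_span_sub.
    split=> [|a b [Ha ha] [Hb hb]|c a [Ha ha]]; split=> //=.
    - by rewrite iota0; exact: mspan0.
    - exact: AD.
    - by rewrite iotaD//; [exact: mspanD|exact: dalg_sub..].
    - exact: AZ.
    - by rewrite iotaZ//; [exact: mspanZ|exact: dalg_sub].
  by move=> a [Aa [i [j aE]]]; subst a; split=> //; apply: mspan_unit; exact/asboolP.
move: x; apply: mspan_ind => [|x y [a Ha <-] [b Hb <-]|c i j /asboolP h].
- by exists 0; rewrite ?iota0.
- by exists (a + b); [exact: AD|rewrite iotaD//; exact: dalg_sub].
- by exists (c *: dunit S k i j); [exact: AZ|rewrite iotaZ//; exact: dunit_in].
Qed.

Lemma ddiag_subspace k : subspace_of (ddiag S k).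
Proof.
split.
- by move=> F [[? _ _] _].
- by move=> a b Fa Fb F HF; have [[_ h _] _] := HF; apply: h; [exact: Fa|exact: Fb].
- by move=> c a Fa F HF; have [[_ _ h] _] := HF; apply: h; exact: Fa.
Qed.

Lemma ddiag_sub k : ddiag S k `<=` dcstar S k.
Proof.
apply: lin_span_sub; first by have [[]] := dcstar_star_subalgebra k.
by move=> _ [i _ <-]; exact: dunit_in.
Qed.

Lemma image_ddiag k : @iota k @` ddiag S k = mspan (@diag_rel k).
Proof.
have [A0 AD AZ] := ddiag_subspace k.
apply/seteqP; split=> [_ [a Ha <-]|x].
  suff [] : (ddiag S k `&` [set a | mspan (@diag_rel k) (iota a)]) a by [].
  move: a Ha; apply: lin_span_sub.
    split=> [|a b [Ha ha] [Hb hb]|c a [Ha ha]]; split=> //=.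
    - by rewrite iota0; exact: mspan0.
    - exact: AD.
    - by rewrite iotaD//; [exact: mspanD|exact: ddiag_sub..].
    - exact: AZ.
    - by rewrite iotaZ//; [exact: mspanZ|exact: ddiag_sub].
  move=> _ [i _ <-]; split; last by apply: mspan_unit; rewrite /diag_rel eqxx.
  by apply: sub_gen_smallest; exists i.
move: x; apply: mspan_ind => [|x y [a Ha <-] [b Hb <-]|c i j /eqP <-].
- by exists 0; rewrite ?iota0.
- by exists (a + b); [exact: AD|rewrite iotaD//; exact: ddiag_sub].
- exists (c *: dunit S k i i); last by rewrite iotaZ//; exact: dunit_in.
  by apply: AZ; apply: sub_gen_smallest; exists i.
Qed.

(** The image of the unit of B_k. It need not be 1, nor equal to the one of the next level: the
    embeddings may be nonunital. *)
Definition munit1 k : U := \sum_(i : I k) E i i.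

Lemma munit1l k i (j : I k) : munit1 k * E i j = E i j.
Proof.
rewrite mulr_suml (bigD1 i)//= munit_idl big1 ?addr0// => a ai.
by rewrite munit_mul0.
Qed.

Lemma munit1r k i (j : I k) : E i j * munit1 k = E i j.
Proof.
rewrite mulr_sumr (bigD1 j)//= munit_idr big1 ?addr0// => a ai.
by rewrite munit_mul0// eq_sym.
Qed.

Lemma munit1_star k : star (munit1 k) = munit1 k.
Proof. by rewrite star_sum; apply: eq_bigr => i _; rewrite munit_star. Qed.

Lemma munit1_span k (P : rel (I k)) x : mspan P x -> munit1 k * x = x /\ x * munit1 k = x.
Proof.
move: x; apply: mspan_ind => [|x y [h1 h2] [h3 h4]|c i j _].
- by rewrite mulr0 mul0r.
- by rewrite mulrDr mulrDl h1 h2 h3 h4.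
- by rewrite -scalerAr -scalerAl munit1l munit1r.
Qed.

(** * Refinement of matrix units between levels *)

Lemma munit_refine k (i j : I k) : exists Q : {set I k.+1 * I k.+1},
  E i j = \sum_(p in Q) E p.1 p.2 /\ (forall p, p \in Q -> E p.1 p.2 != 0).
Proof.
have [_ _ _ /(_ i j)[Q hQ]] := Sunits k.
have [_ _ h] := Ulim.1 k.
exists (Q :&: [set p | E p.1 p.2 != 0])%SET; split; last first.
  by move=> p; rewrite !inE => /andP[].
rewrite /E -h ?hQ; last exact: dunit_in.
rewrite iota_sum; last by move=> p _; exact: dunit_in.
rewrite [LHS](bigID (fun p => E p.1 p.2 != 0)) /= [X in _ + X]big1 ?addr0.
  by apply: eq_bigl => p; rewrite !inE.
by move=> p /andP[_ /negPn/eqP].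
Qed.

(* A 0-1 matrix P such that P P^t or P^t P is again a diagonal 0-1 matrix is a
   partial permutation; P^t P = P for the image of a diagonal unit. *)
Lemma munit_refine1 k (i j : I k) (b : I k.+1) :
  E i j * E b b = 0 \/ exists2 a, E a b != 0 & E i j * E b b = E a b.
Proof.
suff main : forall i j : I k, (exists c : nat, (c <= 1)%N /\
    E b b * (star (E i j) * E i j) * E b b = c%:R *: E b b) ->
    E i j * E b b = 0 \/ exists2 a, E a b != 0 & E i j * E b b = E a b.
  have [Q [EQ Qn]] := munit_refine j j.
  have Ed : exists c : nat, (c <= 1)%N /\ E b b * E j j * E b b = c%:R *: E b b.
    exists ((b, b) \in Q); split; first by case: (_ \in _).
    rewrite EQ mulr_sumr mulr_suml.
    case: (boolP (_ \in Q)) => bQ.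
      rewrite (bigD1 (b, b))//= !munit_idl scale1r big1 ?addr0// => -[c d] /andP[_ cd].
      move: cd; rewrite xpair_eqE negb_and /= => /orP[h|h].
        by rewrite munit_mul0 1?eq_sym// mul0r.
      by rewrite -mulrA munit_mul0// mulr0.
    rewrite scale0r big1// => -[c d] cQ /=.
    have [cb|cb] := eqVneq b c; last by rewrite munit_mul0// mul0r.
    have [db|db] := eqVneq d b; last by rewrite -mulrA munit_mul0// mulr0.
    by subst c d; rewrite cQ in bQ.
  apply: main; have [c [c1 cE]] := Ed; rewrite munit_star.
  have [e0|e0] := eqVneq (E i j) 0.
    by exists 0%N; rewrite e0 mulr0 mulr0 mul0r scale0r.
  by exists c; rewrite munit_starl  1?munit_sym.
move=> {}i {}j [c [c1 cE]].
have [Q [EQ Qn]] := munit_refine i j.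
(* [A] is the column b of the 0-1 matrix [Q]. Compressing [star (E i j) * E i j] by [E b b]
   multiplies [E b b] by the number of its entries, so that number is c. *)
pose A := [set a | (a, b) \in Q]%SET.
have EA : E i j * E b b = \sum_(a in A) E a b.
  rewrite EQ mulr_suml (bigID (fun p => p.2 == b)) /= [X in _ + X]big1 ?addr0.
    rewrite (reindex_onto (fun a => (a, b)) (fun p => p.1)) /=.
      apply: eq_big => [a|a _]; first by rewrite inE !eqxx !andbT.
      by rewrite munit_idr.
    by case=> x y /andP[_ /eqP/= ->].
  by move=> p /andP[_ h]; rewrite munit_mul0.
have cA : c = #|A|.
  have : E b b * (star (E i j) * E i j) * E b b = #|A|%:R *: E b b.
    have -> : E b b * (star (E i j) * E i j) * E b b =
        star (E i j * E b b) * (E i j * E b b).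
      by rewrite starM (munit_star b b) !mulrA.
    rewrite EA star_sum mulr_suml -sum1_card natr_sum scaler_suml.
    apply: eq_bigr => a aA; rewrite munit_star mulr_sumr (bigD1 a)//= scale1r.
    rewrite big1 ?addr0.
      by rewrite munit_starl// -munit_sym; apply: (Qn (a, b)); rewrite inE in aA.
    by move=> a' /andP[_ aa']; rewrite munit_mul0// eq_sym.
  rewrite cE => /eqP; rewrite -subr_eq0 -scalerBl => /eqP/(congr1 (@nrm R U)).
  rewrite nrmZ nrm0 nrm_munit1 ?munit_diag// mulr1 => /nc_eq0/eqP.
  by rewrite subr_eq0 eqr_nat => /eqP.
rewrite cA in c1; move: c1; rewrite leq_eqVlt ltnS leqn0 cards_eq0 => /orP[/cards1P[a Aa]|/eqP A0].
  right; exists a; last by rewrite EA Aa big_set1.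
  by apply: (Qn (a, b)); have := set11 a; rewrite -Aa inE.
by left; rewrite EA A0 big_set0.
Qed.

Lemma mspan_coef k (l : I k -> I k -> K) x a b :
  x = \sum_i \sum_j l i j *: E i j -> E a a * x * E b b = l a b *: E a b.
Proof.
move=> ->; rewrite mulr_sumr mulr_suml (bigD1 a)//= [X in _ + X]big1 ?addr0.
  rewrite mulr_sumr mulr_suml (bigD1 b)//= [X in _ + X]big1 ?addr0.
    by rewrite -scalerAr -scalerAl munit_idl munit_idr.
  by move=> j jb; rewrite -scalerAr -scalerAl -mulrA (munit_mul0 _ _ jb) mulr0 scaler0.
move=> i ia; rewrite mulr_sumr mulr_suml big1// => j _.
by rewrite -scalerAr -scalerAl munit_mul0 1?eq_sym// mul0r scaler0.
Qed.

(** If the product were an off-diagonal unit [E a b], its adjoint times itself would be [E b b] by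
    the unit relations, but also [E b b * E a b], which is 0. *)
Lemma munit_diag1 k (i : I k) (b : I k.+1) : E i i * E b b = 0 \/ E i i * E b b = E b b.
Proof.
case: (munit_refine1 i i b) => [->|[a ab h]]; [by left|right].
have [ab'|ab'] := eqVneq a b; first by rewrite h ab'.
have : star (E i i * E b b) * (E i i * E b b) = 0.
  by rewrite {1}starM !munit_star -mulrA (mulrA (E i i)) munit_idl h munit_mul0 1?eq_sym.
rewrite h munit_star munit_starl 1?munit_sym// => h0.
by have := munit_diag b; rewrite h0 eqxx.
Qed.

Lemma mspan_le (P : forall k, rel (I k)) :
  (forall k i j, P k i j -> mspan (P k.+1) (E i j)) ->
  forall k l, (k <= l)%N -> forall x, mspan (P k) x -> mspan (P l) x.
Proof.
move=> PS k l /subnK <-; elim: (l - k)%N => [//|m IH] x /IH{IH}.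
rewrite addSn; move: x; apply: mspan_ind => [|x y|c i j Pij].
- exact: mspan0.
- exact: mspanD.
- exact/mspanZ/PS.
Qed.

Lemma mspan_full_le k l : (k <= l)%N -> forall x, mspan (@full_rel k) x -> mspan (@full_rel l) x.
Proof.
apply: mspan_le => {}k i j _; have [Q [-> _]] := munit_refine i j.
by apply: mspan_sum => p _; exact: mspan_unit.
Qed.

Lemma mspan_tri_le k l : (k <= l)%N -> forall x, mspan (@T k) x -> mspan (@T l) x.
Proof.
apply: mspan_le => {}k i j /asboolP Tij; rewrite -image_dalg.
have [_ [_ h1 h2] _ _] := Sreg k; have [_ _ h] := Ulim.1 k.
exists (dext S k (dunit S k i j)); first by rewrite h2//; exact: h1.
by rewrite h//; exact: dunit_in.
Qed.

Lemma munit_diag_le k l (kl : (k <= l)%N) (i : I k) (b : I l) :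
  E i i * E b b = 0 \/ E i i * E b b = E b b.
Proof.
move: kl b; elim: l => [|l IH]; rewrite leq_eqVlt => /orP[/eqP kl|].
- by subst k => b; rewrite munit_diagM; case: eqP => [->|]; [right|left].
- by [].
- by subst k => b; rewrite munit_diagM; case: eqP => [->|]; [right|left].
rewrite ltnS => kl b.
have {}IH := IH kl.
have [|e1 _] := @munit1_span l (@full_rel l) (E i i).
  by apply: (mspan_full_le kl); exact: mspan_unit.
have [h|h] := pselect (exists c : I l, E c c * E b b = E b b).
  have [c hc] := h; rewrite -hc mulrA; case: (IH c) => ->; last by rewrite hc; right.
  by rewrite mul0r; left.
left; rewrite -e1.
have -> : E i i = E i i * munit1 l.
  by have [] // := @munit1_span l (@full_rel l) (E i i); apply: (mspan_full_le kl); exact: mspan_unit.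
rewrite -!mulrA [munit1 l * E b b]mulr_suml big1 ?mulr0// => c _.
by case: (munit_diag1 c b) => // hc; case: h; exists c.
Qed.

Lemma munit_diagC k l (kl : (k <= l)%N) (i : I k) (b : I l) : E i i * E b b = E b b * E i i.
Proof.
have -> : E b b * E i i = star (E i i * E b b) by rewrite starM !munit_star.
by case: (munit_diag_le kl i b) => ->; rewrite ?star0 ?munit_star.
Qed.

Lemma mspan_diag_le k l : (k <= l)%N -> forall x, mspan (@diag_rel k) x -> mspan (@diag_rel l) x.
Proof.
apply: mspan_le => {}k i j /eqP <-.
have [|_ <-] := @munit1_span k.+1 (@full_rel k.+1) (E i i).
  by apply: (mspan_full_le (leqnSn k)); exact: mspan_unit.
rewrite mulr_sumr; apply: mspan_sum => b _; case: (munit_diag1 i b) => ->; first exact: mspan0.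
by apply: mspan_unit; rewrite /diag_rel.
Qed.

Lemma munit1_le k l (kl : (k <= l)%N) (i j : I k) :
  munit1 l * E i j = E i j /\ E i j * munit1 l = E i j.
Proof.
apply: (@munit1_span l (@full_rel l)); apply: (mspan_full_le kl); exact: mspan_unit.
Qed.

(** The second case is that of a unit orthogonal to the whole image of level k, which occurs for
    nonunital embeddings. *)
Lemma munit_below k l (kl : (k <= l)%N) (i : I l) :
  (exists c : I k, E c c * E i i = E i i) \/ (forall c d : I k, E c d * E i i = 0).
Proof.
have [h|h] := pselect (exists c : I k, E c c * E i i = E i i); [by left|right].
move=> c d; rewrite -(munit_idr c d) -mulrA.
by case: (munit_diag_le kl d i) => [->|hd]; [rewrite mulr0|case: h; exists d].
Qed.

Lemma munit_refine_le k l (kl : (k <= l)%N) (i j : I k) (b : I l) :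
  E i j * E b b = 0 \/ exists2 a, E a b != 0 & E i j * E b b = E a b.
Proof.
move: kl b; elim: l => [|l IH]; rewrite leq_eqVlt => /orP[/eqP kl|].
- subst k => b; have [<-|jb] := eqVneq j b; last by left; rewrite munit_mul0.
  rewrite munit_idr; have [->|e] := eqVneq (E i j) 0; first by left.
  by right; exists i.
- by [].
- subst k => b; have [<-|jb] := eqVneq j b; last by left; rewrite munit_mul0.
  rewrite munit_idr; have [->|e] := eqVneq (E i j) 0; first by left.
  by right; exists i.
rewrite ltnS => kl b.
case: (munit_below (leqnSn l) b) => [[c hc]|h]; last first.
  left; have [_ <-] := munit1_le kl i j; rewrite -mulrA.
  by rewrite [munit1 l * E b b]mulr_suml big1 ?mulr0.
rewrite -{1 2}hc mulrA; case: (IH kl c) => [->|[a _ ->]]; first by left; rewrite mul0r.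
exact: munit_refine1.
Qed.

(** The coefficient of [E i j] at [E a b] is nonzero, and an element of A_l has nonzero coefficients
    only at units of A_l. *)
Lemma munit_refine_tri k l (kl : (k <= l)%N) (i j : I k) (a b : I l) :
  T i j -> E a b != 0 -> E i j * E b b = E a b -> T a b.
Proof.
move=> Tij ab h.
have [m [mT mE]] := mspan_tri_le kl (mspan_unit Tij).
have := mspan_coef a b mE; rewrite -mulrA h munit_idl => h1.
apply: contraT => /mT m0; move: h1 ab; rewrite m0 scale0r => ->.
by rewrite eqxx.
Qed.

Lemma munit_refine_lel k l (kl : (k <= l)%N) (i j : I k) (a : I l) :
  E a a * E i j = 0 \/ exists2 b, E a b != 0 & E a a * E i j = E a b.
Proof.
have -> : E a a * E i j = star (E j i * E a a) by rewrite starM !munit_star.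
case: (munit_refine_le kl j i a) => [->|[b ab ->]]; first by left; rewrite star0.
by right; exists b; rewrite ?munit_star// munit_sym.
Qed.

Lemma mspanM k (P : rel (I k)) x y :
  (forall i j l, E i j != 0 -> E j l != 0 -> P i j -> P j l -> P i l) ->
  mspan P x -> mspan P y -> mspan P (x * y).
Proof.
move=> Pt Px Py; move: x Px; apply: mspan_ind => [|u v hu hv|c i j Pij].
- by rewrite mul0r; exact: mspan0.
- by rewrite mulrDl; exact: mspanD.
rewrite -scalerAl; apply: mspanZ.
move: y Py; apply: mspan_ind => [|u v hu hv|d m n Pmn].
- by rewrite mulr0; exact: mspan0.
- by rewrite mulrDr; exact: mspanD.
rewrite -scalerAr; apply: mspanZ.
have [jm|jm] := eqVneq j m; last by rewrite munit_mul0//; exact: mspan0.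
subst m; have [->|e1] := eqVneq (E i j) 0; first by rewrite mul0r; exact: mspan0.
have [->|e2] := eqVneq (E j n) 0; first by rewrite mulr0; exact: mspan0.
by rewrite munit_mul//; apply: mspan_unit; exact: (Pt i j n).
Qed.

Lemma mspan_star k (P : rel (I k)) x :
  symmetric P -> mspan P x -> mspan P (star x).
Proof.
move=> Ps; move: x; apply: mspan_ind => [|u v|c i j Pij].
- by rewrite star0; exact: mspan0.
- by rewrite starD; exact: mspanD.
by rewrite starZ munit_star; apply: mspanZ; apply: mspan_unit; rewrite Ps.
Qed.

(** * Closures of spans of matrix units *)

(** Approximants are required beyond any given level L, so that two elements can be approximated at
    levels that are comparable with each other or with a fixed unit. *)
Definition mclos (P : forall k, rel (I k)) : set U := [set x | forall e, 0 < e ->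
  forall L, exists k y, [/\ (L <= k)%N, mspan (P k) y & nrm (x - y) < e]].

Lemma mclosE (P : forall k, rel (I k)) (F : forall k, set 'M[K]_((ddim S k).+1)) :
  (forall k l, (k <= l)%N -> forall x, mspan (P k) x -> mspan (P l) x) ->
  (forall k, @iota k @` F k = mspan (P k)) -> limit_set iota F = mclos P.
Proof.
move=> Ple FP; apply/seteqP; split=> x.
  move=> /norm_closureP h e e0 L; have [y [k _ Fy] xy] := h e e0.
  rewrite FP in Fy; exists (maxn L k), y; split=> //; first exact: leq_maxl.
  by apply: (Ple k) => //; exact: leq_maxr.
move=> h; apply/norm_closureP => e e0; have [k [y [_ Py xy]]] := h e e0 0%N.
by exists y => //; exists k => //; rewrite FP.
Qed.

Lemma limAE : limA iota = mclos T.
Proof. by apply: mclosE; [exact: mspan_tri_le|exact: image_dalg]. Qed.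
Lemma limBE : Defs.limB iota = mclos full_rel.
Proof. by apply: mclosE; [exact: mspan_full_le|exact: image_dcstar]. Qed.
Lemma limCE : limC iota = mclos diag_rel.
Proof. by apply: mclosE; [exact: mspan_diag_le|exact: image_ddiag]. Qed.

Section Mclos.
Variable P : forall k, rel (I k).
Hypothesis Ple : forall k l, (k <= l)%N -> forall x, mspan (@P k) x -> mspan (@P l) x.

Lemma mspan_clos k x : mspan (@P k) x -> mclos P x.
Proof.
move=> Px e e0 L; exists (maxn L k), x; split; first exact: leq_maxl.
  by apply: (Ple _ Px); exact: leq_maxr.
by rewrite subrr nrm0.
Qed.

Lemma mclos0 : mclos P 0.
Proof. exact/(@mspan_clos 0)/mspan0. Qed.

Lemma mclosD x y : mclos P x -> mclos P y -> mclos P (x + y).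
Proof.
move=> hx hy e e0 L; have e2 : 0 < e / 2 by lra.
have [k [a [Lk Pa xa]]] := hx _ e2 L; have [l [b [kl Pb yb]]] := hy _ e2 k.
exists l, (a + b); split; first exact: leq_trans kl.
  by apply: mspanD => //; exact: Ple Pa.
rewrite opprD addrACA; apply: le_lt_trans (nrmD _ _) _; lra.
Qed.

Lemma mclosZ c x : mclos P x -> mclos P (c *: x).
Proof.
move=> hx e e0 L; have n0 : 0 < 1 + nc c by rewrite ltr_wpDr// nc_ge0.
have [k [a [Lk Pa xa]]] := hx _ (divr_gt0 e0 n0) L.
exists k, (c *: a); split=> //; first exact: mspanZ.
rewrite -scalerBr nrmZ; have := nrm_ge0 (x - a); have := nc_ge0 c.
rewrite ltr_pdivlMr// in xa; nra.
Qed.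

Lemma mclosN x : mclos P x -> mclos P (- x).
Proof. by rewrite -scaleN1r; exact: mclosZ. Qed.

Lemma mclos_closed x : (forall e, 0 < e -> exists2 y, mclos P y & nrm (x - y) < e) -> mclos P x.
Proof.
move=> h e e0 L; have e2 : 0 < e / 2 by lra.
have [y hy xy] := h _ e2; have [k [a [Lk Pa ya]]] := hy _ e2 L.
exists k, a; split=> //; apply: le_lt_trans (nrm_dist _ y _) _; lra.
Qed.

Lemma mclosM x y :
  (forall k (i j l : I k), E i j != 0 -> E j l != 0 -> P i j -> P j l -> P i l) ->
  mclos P x -> mclos P y -> mclos P (x * y).
Proof.
move=> Pt hx hy e e0 L.
have nx := nrm_ge0 x; have ny := nrm_ge0 y.
pose d := Num.min 1 (e / (nrm x + nrm y + 1)).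
have s0 : 0 < nrm x + nrm y + 1 by lra.
have d0 : 0 < d by rewrite lt_min ltr01 divr_gt0.
have d1 : d <= 1 by rewrite ge_min lexx.
have d2 : d * (nrm x + nrm y + 1) <= e by rewrite -ler_pdivlMr// ge_min lexx orbT.
have [k [a [Lk Pa xa]]] := hx _ d0 L; have [l [b [kl Pb yb]]] := hy _ d0 k.
exists l, (a * b); split; first exact: leq_trans kl.
  by apply: (mspanM (@Pt l)) => //; exact: Ple Pa.
have -> : x * y - a * b = (x - a) * y + a * (y - b).
  by rewrite mulrBl mulrBr addrA subrK.
apply: le_lt_trans (nrmD _ _) _.
have h2 := nrmM (x - a) y; have h3 := nrmM a (y - b).
have h1 : nrm a <= nrm x + nrm (x - a).
  by rewrite -{1}(subKr x a) nrmB.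
have := nrm_ge0 (x - a); have := nrm_ge0 (y - b); nra.
Qed.

Lemma mclos_star x : (forall k, symmetric (@P k)) -> mclos P x -> mclos P (star x).
Proof.
move=> Ps hx e e0 L; have [k [a [Lk Pa xa]]] := hx _ e0 L.
by exists k, (star a); split=> //; [exact: mspan_star|rewrite -starB nrm_star].
Qed.
End Mclos.

Local Notation A := (limA iota).
Local Notation B := (Defs.limB iota).
Local Notation C := (limC iota).

Lemma limA0 : A 0. Proof. by rewrite limAE; exact: (mclos0 mspan_tri_le). Qed.
Lemma limAD x y : A x -> A y -> A (x + y).
Proof. by rewrite limAE; exact: (mclosD mspan_tri_le). Qed.
Lemma limAZ c x : A x -> A (c *: x).
Proof. by rewrite limAE; exact: mclosZ. Qed.
Lemma limAM x y : A x -> A y -> A (x * y).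
Proof. by rewrite limAE; exact: (mclosM mspan_tri_le mtri_trans). Qed.

Lemma limBD x y : B x -> B y -> B (x + y).
Proof. by rewrite limBE; exact: (mclosD mspan_full_le). Qed.
Lemma limBZ c x : B x -> B (c *: x).
Proof. by rewrite limBE; exact: mclosZ. Qed.
Lemma limBN x : B x -> B (- x).
Proof. by rewrite limBE; exact: mclosN. Qed.
Lemma limBM x y : B x -> B y -> B (x * y).
Proof. by rewrite limBE; exact: (mclosM mspan_full_le). Qed.
Lemma limB_star x : B x -> B (star x).
Proof. by rewrite limBE; exact: mclos_star. Qed.

Lemma limC0 : C 0. Proof. by rewrite limCE; exact: (mclos0 mspan_diag_le). Qed.
Lemma limCD x y : C x -> C y -> C (x + y).
Proof. by rewrite limCE; exact: (mclosD mspan_diag_le). Qed.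
Lemma limCZ c x : C x -> C (c *: x).
Proof. by rewrite limCE; exact: mclosZ. Qed.
Lemma limCN x : C x -> C (- x).
Proof. by rewrite limCE; exact: mclosN. Qed.
Lemma limCM x y : C x -> C y -> C (x * y).
Proof.
rewrite limCE; apply: (mclosM mspan_diag_le) => k i j l _ _ /eqP-> /eqP->.
exact: eqxx.
Qed.
Lemma limC_star x : C x -> C (star x).
Proof. by rewrite limCE; apply: mclos_star => k i j; exact: eq_sym. Qed.

Lemma mclos_sub (P Q : forall k, rel (I k)) : (forall k i j, P k i j -> Q k i j) ->
  mclos P `<=` mclos Q.
Proof.
move=> PQ x h e e0 L; have [k [y [Lk Py xy]]] := h e e0 L.
by exists k, y; split=> //; exact: (mspan_sub (@PQ k) Py).
Qed.

Lemma limCA : C `<=` A.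
Proof.
by rewrite limAE limCE; apply: mclos_sub => k i j /eqP ->; exact: mtri_diag.
Qed.
Lemma limAB : A `<=` B.
Proof. by rewrite limAE limBE; apply: mclos_sub. Qed.
Lemma limCB : C `<=` B.
Proof. by move=> x /limCA/limAB. Qed.

Lemma munitC k (i : I k) : C (E i i).
Proof.
by rewrite limCE; apply: (mspan_clos mspan_diag_le); apply: mspan_unit; exact: eqxx.
Qed.
Lemma munitA k (i j : I k) : T i j -> A (E i j).
Proof. by move=> ?; rewrite limAE; apply: (mspan_clos mspan_tri_le); exact: mspan_unit. Qed.
Lemma munitB k (i j : I k) : B (E i j).
Proof. by rewrite limBE; apply: (mspan_clos mspan_full_le); exact: mspan_unit. Qed.
Lemma munit1C k : C (munit1 k).
Proof. by rewrite /munit1; elim/big_ind: _ => [||i _]; [exact: limC0|exact: limCD|exact: munitC]. Qed.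

Lemma mspan_diagC k (x y : U) : mspan (@diag_rel k) x -> mspan (@diag_rel k) y -> x * y = y * x.
Proof.
move=> hx hy; move: x hx; apply: mspan_ind => [|u v hu hv|c i j /eqP <-].
- by rewrite mul0r mulr0.
- by rewrite mulrDl mulrDr hu hv.
move: y hy; apply: mspan_ind => [|u v hu hv|d a b /eqP <-].
- by rewrite mul0r mulr0.
- by rewrite mulrDl mulrDr hu hv.
rewrite -!scalerAl -!scalerAr !scalerA mulrC !munit_diagM eq_sym.
by case: eqP => // ->.
Qed.

Lemma limC_comm x y : C x -> C y -> x * y = y * x.
Proof.
suff half z k w : mspan (@diag_rel k) w -> C z -> z * w = w * z.
  move=> hx hy; apply/eqP; rewrite -subr_eq0; apply/eqP; apply: nrm_small => e e0.
  have hy' := hy; rewrite limCE in hy'; have nx := nrm_ge0 x.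
  have s0 : 0 < 2 * nrm x + 1 by lra.
  have [k [w [_ hw yw]]] := hy' _ (divr_gt0 e0 s0) 0%N.
  rewrite ltr_pdivlMr// in yw.
  have -> : x * y - y * x = x * (y - w) - (y - w) * x.
    by rewrite mulrBr mulrBl (half x k w)// opprB addrA subrK.
  apply: le_trans (nrmB _ _) _; have := nrmM x (y - w); have := nrmM (y - w) x.
  have := nrm_ge0 (y - w); nra.
move=> hw hz; apply/eqP; rewrite -subr_eq0; apply/eqP; apply: nrm_small => e e0.
rewrite limCE in hz; have nw := nrm_ge0 w.
have s0 : 0 < 2 * nrm w + 1 by lra.
have [l [u [kl hu zu]]] := hz _ (divr_gt0 e0 s0) k.
rewrite ltr_pdivlMr// in zu.
have -> : z * w - w * z = (z - u) * w - w * (z - u).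
  rewrite mulrBr mulrBl (@mspan_diagC l u w)//; last exact: mspan_diag_le hw.
  by rewrite opprB addrA subrK.
apply: le_trans (nrmB _ _) _; have := nrmM w (z - u); have := nrmM (z - u) w.
have := nrm_ge0 (z - u); nra.
Qed.

Lemma munit_conj_le k l (kl : (k <= l)%N) (i j : I k) (b : I l) :
  E i j * E b b * E j i = 0 \/ exists2 a, E a b != 0 /\ E i j * E b b = E a b &
     E i j * E b b * E j i = E a a.
Proof.
case: (munit_refine_le kl i j b) => [->|[a ab h]]; first by rewrite mul0r; left.
right; exists a => //.
have h2 : E b b * E j i = E b a by rewrite -[RHS]munit_star -h starM !munit_star.
by rewrite -(munit_idl b b) mulrA -mulrA h h2 munit_starl.
Qed.

(** Conjugation by a matrix unit sends each deeper diagonal unit to a diagonal unit or to 0, and it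
    does not increase the norm. *)
Lemma limC_conj k (i j : I k) c : C c -> C (E i j * c * E j i).
Proof.
rewrite limCE => hc e e0 L.
have [l [y [Ll Py cy]]] := hc _ e0 (maxn L k).
move: Ll; rewrite geq_max => /andP[Ll kl].
exists l, (E i j * y * E j i); split=> //.
  move: y Py {cy}; apply: mspan_ind => [|u v hu hv|d a b /eqP <-].
  - by rewrite mulr0 mul0r; exact: mspan0.
  - by rewrite mulrDr mulrDl; exact: mspanD.
  - rewrite -scalerAr -scalerAl; apply: mspanZ.
    case: (munit_conj_le kl i j a) => [->|[a' _ ->]]; first exact: mspan0.
    by apply: mspan_unit; exact: eqxx.
rewrite -mulrBl -mulrBr; apply: le_lt_trans (nrmM _ _) _.
apply: le_lt_trans cy; have := nrmM (E i j) (c - y).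
have := nrm_munit i j; have := nrm_munit j i; have := nrm_ge0 (E i j).
have := nrm_ge0 (E j i); have := nrm_ge0 (c - y); have := nrm_ge0 (E i j * (c - y)).
nra.
Qed.

(** An approximant y of 1 from level k satisfies [munit1 k * y = y], hence
    [1 - munit1 k = (1 - munit1 k) * (1 - y)]. With y within 1/2 of 1 this forces [1 = munit1 k]. *)
Lemma limB_unit : B 1 -> C 1.
Proof.
rewrite limBE => h1; have e2 : 0 < 1 / 2 :> R by lra.
have [k [y [_ hy y1]]] := h1 _ e2 0%N.
have [hy1 _] := munit1_span hy.
suff -> : 1 = munit1 k by exact: munit1C.
apply/eqP; rewrite -subr_eq0; apply/eqP; apply: nrm_eq0.
have h : 1 - munit1 k = (1 - munit1 k) * (1 - y).
  by rewrite [RHS]mulrBr mulr1 [(1 - munit1 k) * y]mulrBl mul1r hy1 subrr subr0.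
have := nrmM (1 - munit1 k) (1 - y); rewrite -h => h2.
have := nrm_ge0 (1 - munit1 k); nra.
Qed.

(** * Adjunction of the unit *)

Hypothesis Utaf : TAF iota.

Local Notation Cu := (with_unit C).
Local Notation Au := (with_unit A).

Lemma limA_starC x : A x -> A (star x) -> C x.
Proof. by move=> h1 h2; rewrite -Utaf. Qed.

Lemma sub_with_unit (F : set U) : F `<=` with_unit F.
Proof. by move=> x Fx; exists x => //; exists 0; rewrite scale0r addr0. Qed.

Lemma with_unit1 (F : set U) : F 0 -> with_unit F 1.
Proof. by exists 0 => //; exists 1; rewrite add0r scale1r. Qed.

Lemma limCu0 : Cu 0. Proof. exact/sub_with_unit/limC0. Qed.
Lemma limCu1 : Cu 1. Proof. exact/with_unit1/limC0. Qed.

Lemma limCuD x y : Cu x -> Cu y -> Cu (x + y).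
Proof.
move=> [a Ca [c ->]] [b Cb [d ->]]; exists (a + b); first exact: limCD.
by exists (c + d); rewrite scalerDl addrACA.
Qed.
Lemma limCuZ c x : Cu x -> Cu (c *: x).
Proof.
move=> [a Ca [d ->]]; exists (c *: a); first exact: limCZ.
by exists (c * d); rewrite scalerDr scalerA.
Qed.
Lemma limCuN x : Cu x -> Cu (- x).
Proof. by rewrite -scaleN1r; exact: limCuZ. Qed.
Lemma limCu_star x : Cu x -> Cu (star x).
Proof.
move=> [a Ca [c ->]]; exists (star a); first exact: limC_star.
by exists c^*; rewrite starD starZ star1.
Qed.

Lemma limCuC x y : Cu x -> C y -> C (x * y).
Proof.
move=> [a Ca [c ->]] Cy; rewrite mulrDl -scalerAl mul1r.
by apply: limCD; [exact: limCM|exact: limCZ].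
Qed.
Lemma limCCu x y : C x -> Cu y -> C (x * y).
Proof.
move=> Cx [a Ca [c ->]]; rewrite mulrDr -scalerAr mulr1.
by apply: limCD; [exact: limCM|exact: limCZ].
Qed.
Lemma limCuA x y : Cu x -> A y -> A (x * y).
Proof.
move=> [a Ca [c ->]] Cy; rewrite mulrDl -scalerAl mul1r.
by apply: limAD; [apply: limAM => //; exact: limCA|exact: limAZ].
Qed.
Lemma limACu x y : A x -> Cu y -> A (x * y).
Proof.
move=> Cx [a Ca [c ->]]; rewrite mulrDr -scalerAr mulr1.
by apply: limAD; [apply: limAM => //; exact: limCA|exact: limAZ].
Qed.
Lemma limCu_comm x y : Cu x -> C y -> x * y = y * x.
Proof.
move=> [a Ca [c ->]] Cy; rewrite mulrDl mulrDr (limC_comm Ca Cy).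
by rewrite -scalerAl -scalerAr mul1r mulr1.
Qed.
Lemma limCu_sub_Au : Cu `<=` Au.
Proof. by move=> _ [a Ca [c ->]]; exists a; [exact: limCA|exists c]. Qed.

(** When 1 is not in B, the scalar part of an element of B + K1 is unique. Comparing the two
    expressions for [star x] gives [star a = b], so the TAF condition applies to the part a. When 1
    is in B it already lies in [C], and nothing is adjoined. *)
Lemma with_unitA_starC x : Au x -> Au (star x) -> Cu x.
Proof.
move=> [a Aa [c xE]] [b Ab [d sE]].
have [B1|nB] := pselect (B 1).
  have C1 := limB_unit B1.
  apply: sub_with_unit; apply: limA_starC.
    by rewrite xE; apply: limAD => //; apply: limAZ; exact: limCA.
  by rewrite sE; apply: limAD => //; apply: limAZ; exact: limCA.
exists a; last by exists c.
apply: limA_starC => //.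
have h : star a + c^* *: 1 = b + d *: 1 by rewrite -sE xE starD starZ star1.
have h2 : star a - b = (d - c^*) *: 1.
  by apply: (addIr (c^* *: 1)); rewrite addrAC h scalerBl subrK addrAC subrr add0r.
have [dc|dc] := eqVneq (d - c^*) 0.
  by move: h2; rewrite dc scale0r => /eqP; rewrite subr_eq0 => /eqP ->.
case: nB; have -> : 1 = (d - c^*)^-1 *: (star a - b).
  by rewrite h2 scalerA mulVf// scale1r.
apply: limBZ; apply: limBD; first by apply: limB_star; exact: limAB.
by apply: limBN; exact: limAB.
Qed.

Section MsetLemmas.
Variable n : nat.
Implicit Types v w : 'M[U]_n.

Lemma MsetM (F G H : set U) v w : H 0 -> (forall x y, H x -> H y -> H (x + y)) ->
  (forall x y, F x -> G y -> H (x * y)) -> Mset F v -> Mset G w -> Mset H (v *m w).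
Proof.
move=> H0 HD FGH hv hw i j; rewrite mxE; elim/big_ind: _ => // k _; exact: FGH.
Qed.

Lemma MsetC0 : Mset C (0 : 'M_n). Proof. by move=> i j; rewrite mxE; exact: limC0. Qed.
Lemma MsetCD v w : Mset C v -> Mset C w -> Mset C (v + w).
Proof. by move=> hv hw i j; rewrite mxE; exact: limCD. Qed.
Lemma MsetCN v : Mset C v -> Mset C (- v).
Proof. by move=> hv i j; rewrite mxE; exact: limCN. Qed.
Lemma MsetCB v w : Mset C v -> Mset C w -> Mset C (v - w).
Proof. by move=> hv hw; apply: MsetCD => //; exact: MsetCN. Qed.
Lemma MsetCM v w : Mset C v -> Mset C w -> Mset C (v *m w).
Proof. exact: (MsetM limC0 limCD limCM). Qed.
Lemma MsetC_star v : Mset C v -> Mset C (mxstar v).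
Proof. by move=> hv i j; rewrite mxstarE; exact: limC_star. Qed.
Lemma MsetCuC v w : Mset Cu v -> Mset C w -> Mset C (v *m w).
Proof. exact: (MsetM limC0 limCD limCuC). Qed.
Lemma MsetCCu v w : Mset C v -> Mset Cu w -> Mset C (v *m w).
Proof. exact: (MsetM limC0 limCD limCCu). Qed.
Lemma MsetCu_star v : Mset Cu v -> Mset Cu (mxstar v).
Proof. by move=> hv i j; rewrite mxstarE; exact: limCu_star. Qed.
Lemma MsetCuD v w : Mset Cu v -> Mset Cu w -> Mset Cu (v + w).
Proof. by move=> hv hw i j; rewrite mxE; exact: limCuD. Qed.
Lemma MsetCuB v w : Mset Cu v -> Mset Cu w -> Mset Cu (v - w).
Proof. by move=> hv hw; apply: MsetCuD => // i j; rewrite mxE; exact: limCuN. Qed.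
Lemma MsetCu1 : Mset Cu (1%:M : 'M_n).
Proof. by move=> i j; rewrite mxE; case: (i == j); [exact: limCu1|exact: limCu0]. Qed.
Lemma MsetC_Cu v : Mset C v -> Mset Cu v.
Proof. by move=> hv i j; exact/sub_with_unit. Qed.
Lemma MsetCA v : Mset C v -> Mset A v.
Proof. by move=> hv i j; exact: limCA. Qed.
Lemma MsetCuA v w : Mset Cu v -> Mset A w -> Mset A (v *m w).
Proof. exact: (MsetM limA0 limAD limCuA). Qed.
Lemma MsetACu v w : Mset A v -> Mset Cu w -> Mset A (v *m w).
Proof. exact: (MsetM limA0 limAD limACu). Qed.
Lemma Mset_scalarCu a : Cu a -> Mset Cu (a%:M : 'M_n).
Proof. by move=> Ca i j; rewrite mxE; case: (i == j); [|exact: limCu0]. Qed.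
Lemma Mset_ampC b a : C a -> Mset C (amp b a : 'M_n).
Proof. by move=> Ca i j; rewrite mxE; exact: limCZ. Qed.
Lemma scalar_comm a v : Cu a -> Mset C v -> a%:M *m v = v *m a%:M.
Proof.
by move=> Ca Cv; apply/matrixP => i j; rewrite scalarMl scalarMr limCu_comm.
Qed.

Lemma Mset_approx (P : forall k, rel (I k)) v :
  (forall k l, (k <= l)%N -> forall x, mspan (P k) x -> mspan (P l) x) ->
  Mset (mclos P) v -> forall e, 0 < e -> forall L, exists k (w : 'M[U]_n),
    [/\ (L <= k)%N, Mset (mspan (P k)) w & mn (v - w) < e].
Proof.
move=> Ple hv e e0 L.
have s0 : 0 < (n * n)%:R + 1 :> R by rewrite ltr_wpDl.
have [f hf] := choice (fun p : 'I_n * 'I_n => hv p.1 p.2 _ (divr_gt0 e0 s0) L).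
have [g hg] := choice hf.
pose k := maxn L (\max_p f p); exists k, (\matrix_(i, j) g (i, j)); split.
- exact: leq_maxl.
- move=> i j; rewrite mxE; have [_ h _] := hg (i, j); apply: Ple h.
  by apply: (@leq_trans (\max_p f p)); [exact: leq_bigmax|exact: leq_maxr].
- apply: (@le_lt_trans _ _ ((n * n)%:R * (e / ((n * n)%:R + 1)))).
    by apply: mn_leC => i j; rewrite !mxE; have [_ _ /ltW] := hg (i, j).
  rewrite mulrA ltr_pdivrMr// mulrC ltr_pM2l//; lra.
Qed.

Lemma Mset_closed (P : forall k, rel (I k)) v :
  (forall e, 0 < e -> exists2 w, Mset (mclos P) w & mn (v - w) < e) -> Mset (mclos P) v.
Proof.
move=> h i j; apply: mclos_closed => e e0; have [w hw vw] := h e e0.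
exists (w i j) => //; apply: le_lt_trans vw.
by have := le_mn (v - w) i j; rewrite !mxE.
Qed.

End MsetLemmas.

(** * Inverses at finite levels and unitaries over the limit *)

Section KScale.
Variable n : nat.
Implicit Types v w : 'M[U]_n.

Definition mxkscale (c : K) v : 'M[U]_n := \matrix_(i, j) (c *: v i j).
Local Notation ks := mxkscale.

Lemma mxkscale1 v : ks 1 v = v.
Proof. by apply/matrixP => i j; rewrite mxE scale1r. Qed.
Lemma mxkscale0 v : ks 0 v = 0.
Proof. by apply/matrixP => i j; rewrite !mxE scale0r. Qed.
Lemma mxkscaleA c d v : ks c (ks d v) = ks (c * d) v.
Proof. by apply/matrixP => i j; rewrite !mxE scalerA. Qed.
Lemma mxkscaleN c v : ks (- c) v = - ks c v.
Proof. by apply/matrixP => i j; rewrite !mxE scaleNr. Qed.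
Lemma mxkscaleMr c v w : v *m ks c w = ks c (v *m w).
Proof.
apply/matrixP => i j; rewrite !mxE scaler_sumr; apply: eq_bigr => k _.
by rewrite mxE scalerAr.
Qed.
End KScale.

(* A polynomial relation lets one express the inverse of h through its powers. *)
Lemma poly_inverse n (F : set 'M[U]_n) (h : 'M[U]_n) :
  F 0 -> F 1%:M -> (forall v w, F v -> F w -> F (v + w)) ->
  (forall c v, F v -> F (mxkscale c v)) -> (forall v, F v -> F (h *m v)) ->
  (forall x : 'M[U]_n, h *m x = 0 -> x = 0) ->
  forall D (c : nat -> K), (exists2 m, (m < D)%N & c m != 0) ->
  \sum_(m < D) mxkscale (c m) (h ^+ m) = 0 -> exists2 h', F h' & h *m h' = 1%:M.
Proof.
move=> F0 F1 FD FZ Fh hinj; elim=> [|D IH] c; first by case.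
move=> [m mD cm]; rewrite big_ord_recl expr0 /=.
pose g := \sum_(i < D) mxkscale (c i.+1) (h ^+ i).
have -> : \sum_(i < D) mxkscale (c (bump 0 i)) (h ^+ bump 0 i) = h *m g.
  rewrite mulmx_sumr; apply: eq_bigr => i _.
  by rewrite mxkscaleMr /bump leq0n add1n exprS.
have Fg : F g.
  apply: (big_ind F) => // i _; apply: FZ; elim: (nat_of_ord i) => [|p IHp]; first by rewrite expr0.
  by rewrite exprS; exact: Fh.
have [c0|c0] := eqVneq (c 0%N) 0.
  rewrite c0 mxkscale0 add0r => /hinj g0; apply: (IH (fun i => c i.+1)) => //; case: m mD cm => [|m mD cm].
    by rewrite c0 eqxx.
  by exists m.
move=> hg; exists (mxkscale (- (c 0%N)^-1) g); first exact: FZ.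
rewrite mxkscaleMr; have -> : h *m g = - mxkscale (c 0%N) 1.
  by apply/eqP; rewrite -addr_eq0 addrC hg.
rewrite -mxkscaleN mxkscaleA mulrNN mulVf// mxkscale1.
by [].
Qed.

Lemma kernel_row (m : nat) (M : 'M[K]_(m.+1, m)) : exists2 c : 'rV_(m.+1), c != 0 & c *m M = 0.
Proof.
have : kermx M != 0.
  rewrite -mxrank_eq0 mxrank_ker subn_eq0 -ltnNge ltnS; exact: rank_leq_col.
move=> /rowV0Pn[c /sub_kermxP h c0]; by exists c.
Qed.

Section UnitLevel.
Variable k : nat.
Local Notation Tu := (with_unit (mspan (@T k))).

Lemma tri_level0 : Tu 0. Proof. exact/sub_with_unit/mspan0. Qed.
Lemma tri_level1 : Tu 1. Proof. exact/with_unit1/mspan0. Qed.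
Lemma tri_levelD x y : Tu x -> Tu y -> Tu (x + y).
Proof.
move=> [a Ca [c ->]] [b Cb [d ->]]; exists (a + b); first exact: mspanD.
by exists (c + d); rewrite scalerDl addrACA.
Qed.
Lemma tri_levelZ c x : Tu x -> Tu (c *: x).
Proof.
move=> [a Ca [d ->]]; exists (c *: a); first exact: mspanZ.
by exists (c * d); rewrite scalerDr scalerA.
Qed.
Lemma tri_levelM x y : Tu x -> Tu y -> Tu (x * y).
Proof.
move=> [a Ca [c ->]] [b Cb [d ->]]; exists (a * b + d *: a + c *: b).
  by do 2?apply: mspanD; [apply: mspanM => //; exact: mtri_trans|exact: mspanZ..].
exists (c * d); rewrite mulrDl !mulrDr -!scalerAr -!scalerAl !mulr1 !mul1r !scalerA.
by rewrite addrA (mulrC d).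
Qed.

Definition unit_gen (p : option (I k * I k)) : U := if p is Some q then E q.1 q.2 else 1.

Lemma tri_level_gen x : Tu x -> exists f : option (I k * I k) -> K,
  x = \sum_p f p *: unit_gen p.
Proof.
move=> [_ [l [_ ->]] [c ->]].
exists (fun p => if p is Some q then l q.1 q.2 else c).
rewrite (bigD1 None)//= addrC pair_bigA; congr (_ + _).
rewrite (reindex_omap Some id) /=; last by case.
by apply: eq_bigl => p; rewrite eqxx.
Qed.

(** The n by n matrices over [Tu] are spanned by finitely many elements, indexed by [J]; hence
    [#|J| + 1] powers of h are linearly dependent. The index [None] stands for the adjoined unit. *)
Lemma tri_level_dep n (h : 'M[U]_n) : Mset Tu h -> exists D (c : nat -> K),
  (exists2 m, (m < D)%N & c m != 0) /\ \sum_(m < D) mxkscale (c m) (h ^+ m) = 0.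
Proof.
move=> hT.
have hp m : Mset Tu (h ^+ m).
  elim: m => [|m IH].
    by move=> i j; rewrite expr0 mxE; case: (i == j); [exact: tri_level1|exact: tri_level0].
  by rewrite exprS; exact: (MsetM tri_level0 tri_levelD tri_levelM hT IH).
pose J := ('I_n * 'I_n * option (I k * I k))%type.
have hc m : exists f : J -> K,
    forall i j, (h ^+ m) i j = \sum_p f (i, j, p) *: unit_gen p.
  have [f hf] := choice (fun q : 'I_n * 'I_n => tri_level_gen (hp m q.1 q.2)).
  by exists (fun q => f q.1 q.2) => i j; rewrite (hf (i, j)).
have [f hf] := choice hc.
pose M : 'M[K]_(#|{: J}|.+1, #|{: J}|) := \matrix_(m, j) f m (enum_val j).
have [c c0 cM] := kernel_row M.
exists #|{: J}|.+1, (fun m => c 0 (inord m)); split.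
  have [m cm] : exists m, c 0 m != 0.
    apply: contra_notP (negP c0) => hn; apply/eqP/rowP => m; rewrite mxE.
    by apply/eqP; apply: contra_notT hn => ?; exists m.
  by exists m; rewrite ?inord_val.
apply/matrixP => i j; rewrite summxE mxE.
under eq_bigr => m _ do rewrite mxE hf inord_val scaler_sumr.
rewrite exchange_big big1// => p _.
under eq_bigr => m _ do rewrite scalerA.
rewrite -scaler_suml.
rewrite -[RHS](scale0r (unit_gen p)); congr (_ *: _).
have := congr1 (fun A : 'rV_ _ => A 0 (enum_rank ((i, j, p) : J))) cM.
rewrite !mxE => h0; apply: etrans h0; apply: eq_bigr => m _.
by rewrite mxE enum_rankK.
Qed.

End UnitLevel.

(** If 1 is not in the closed set B, its distance d from B is positive, and d times the modulus of a
    scalar part is at most the norm. Thus convergence in B + K1 implies convergence of the parts in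
    B, and [A] is closed. *)
Lemma limAu_closed x : (exists2 b, B b & exists c : K, x = b + c *: 1) ->
  (forall e, 0 < e -> exists2 y, Au y & nrm (x - y) < e) -> Au x.
Proof.
move=> [b Bb [c xE]] hx.
have [B1|nB] := pselect (B 1).
  apply: sub_with_unit; rewrite limAE; apply: mclos_closed => e e0.
  have [y [a Aa [d ->]] xy] := hx _ e0; exists (a + d *: 1) => //.
  rewrite -limAE; apply: limAD => //; apply: limAZ; apply: limCA; exact: limB_unit.
have [d d0 hd] : exists2 d, 0 < d & forall y, B y -> d <= nrm (1 - y).
  apply: contra_notP nB => hn; rewrite limBE; apply: mclos_closed => e e0.
  apply: contra_notP hn => hn; exists e => // y By; rewrite leNgt; apply/negP => h.
  by apply: hn; exists y => //; rewrite -limBE.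
have hd2 y t : B y -> nc t * d <= nrm (y + t *: 1).
  move=> By; have [->|t0] := eqVneq t 0; first by rewrite nc0 mul0r nrm_ge0.
  have -> : y + t *: 1 = t *: (1 - (- t^-1 *: y)).
    by rewrite scalerBr scalerA mulrN mulfV// scaleN1r opprK addrC.
  by rewrite nrmZ ler_wpM2l ?nc_ge0// hd//; exact: limBZ.
exists b; last by exists c.
rewrite limAE; apply: mclos_closed => e e0.
have s0 : 0 < 1 + nrm (1 : U) / d by rewrite ltr_wpDr// divr_ge0 ?nrm_ge0 ?ltW.
have [y [a Aa [t yE]] xy] := hx _ (divr_gt0 e0 s0).
exists a; first by rewrite -limAE.
have xyE : x - y = (b - a) + (c - t) *: 1 by rewrite xE yE opprD addrACA scalerBl.
have h1 : nc (c - t) * d <= nrm (x - y).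
  by rewrite xyE; apply: hd2; apply: limBD => //; apply: limBN; exact: limAB.
have -> : b - a = (x - y) - (c - t) *: 1 by rewrite xyE addrK.
apply: le_lt_trans (nrmB _ _) _; rewrite nrmZ.
rewrite ltr_pdivlMr// mulrDr mulr1 in xy; apply: le_lt_trans xy.
rewrite lerD2l mulrA ler_pdivlMr// mulrAC ler_wpM2r// nrm_ge0//.
Qed.

(** A matrix h at a finite level and close to z is left cancellable, since [mxstar z] nearly inverts
    it; a linear relation between its powers then yields a right inverse h' at the same level. As h'
    is close to [mxstar z], the adjoint also has entries in [with_unit A]. *)
Lemma normalising_unitaryC n (z : 'M[U]_n) : normalising_unitary A C z -> Mset Cu z.
Proof.
move=> [zA zz sz _].
suff hs : Mset Au (mxstar z).
  move=> i j; apply: with_unitA_starC; first exact: zA.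
  by have := hs j i; rewrite mxstarE.
have /choice[a ha] : forall q : 'I_n * 'I_n, exists a, A a /\ exists c : K, z q.1 q.2 = a + c *: 1.
  by move=> [i j]; have [a Aa [c h]] := zA i j; exists a; split=> //; exists c.
have /choice[c hc] : forall q : 'I_n * 'I_n, exists c : K, z q.1 q.2 = a q + c *: 1.
  by move=> q; have [_ []] := ha q; move=> c; exists c.
pose am : 'M[U]_n := \matrix_(i, j) a (i, j).
pose cm : 'M[K]_n := \matrix_(i, j) c (i, j).
have zE : z = am + amp cm 1.
  by apply/matrixP => i j; rewrite !mxE (hc (i, j)).
have hA : Mset (mclos T) am by move=> i j; rewrite mxE -limAE; have [] := ha (i, j).
have nz := mn_ge0 z.
have inv e : 0 < e -> exists2 h', Mset Au h' & mn (mxstar z - h') < e.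
  move=> e0; pose m := mn z + 1; have m0 : 0 < m by rewrite /m; lra.
  (* The first bound makes h left cancellable and keeps [mn h'] below 2m. The second makes the error
     [mn z * d * mn h'], at most 2 * m * m * d, smaller than e. *)
  pose d := Num.min (1 / (2 * m)) (e / (4 * m * m)).
  have d0 : 0 < d by rewrite lt_min !divr_gt0// ?mulr_gt0.
  have d1 : d * m <= 1 / 2.
    have -> : 1 / 2 = 1 / (2 * m) * m by field; rewrite gt_eqF.
    apply: ler_wpM2r; first exact: ltW.
    by rewrite /d ge_min lexx.
  have d2 : 4 * m * m * d <= e.
    by rewrite mulrC -ler_pdivlMr ?mulr_gt0// /d ge_min lexx orbT.
  have [k [w [_ wT zw]]] := Mset_approx mspan_tri_le hA d0 0.
  pose h := w + amp cm 1.
  have zh : z - h = am - w by rewrite zE /h opprD addrACA subrr addr0.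
  have hT : Mset (with_unit (mspan (@T k))) h.
    by move=> i j; rewrite !mxE; exists (w i j) => //; exists (c (i, j)).
  have [D [f [fn f0]]] := tri_level_dep hT.
  have cancel (x : 'M_n) : h *m x = 0 -> x = 0.
    move=> hx; apply: mn_eq0.
    have xE : x = mxstar z *m (z - h) *m x.
      by rewrite -mulmxA mulmxBl hx subr0 mulmxA sz mul1mx.
    have e1 := mnM (mxstar z *m (z - h)) x; rewrite -xE in e1.
    have e2 := mnM (mxstar z) (z - h); rewrite mn_star in e2.
    have e3 : mn z * mn (z - h) <= mn z * d by rewrite zh ler_wpM2l// ltW.
    have e4 : mn (mxstar z *m (z - h)) <= 1 / 2.
      apply: le_trans e2 _; apply: le_trans e3 _; apply: le_trans d1.
      by rewrite mulrC ler_wpM2l// ?ltW// /m; lra.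
    by have := mn_ge0 x; nra.
  have [|||||h' h'T hh'] := poly_inverse (F := Mset (with_unit (mspan (@T k))) (n := n)) _ _ _ _ _ cancel fn f0.
  - by move=> i j; rewrite mxE; exact: tri_level0.
  - by move=> i j; rewrite mxE; case: (i == j); [exact: tri_level1|exact: tri_level0].
  - by move=> u v hu hv i j; rewrite mxE; exact: tri_levelD.
  - by move=> t u hu i j; rewrite mxE; exact: tri_levelZ.
  - by move=> u hu; exact: (MsetM (tri_level0 k) (@tri_levelD k) (@tri_levelM k) hT hu).
  exists h'.
    move=> i j; have [y Ty [t ->]] := h'T i j; exists y; last by exists t.
    by rewrite limAE; exact: (mspan_clos mspan_tri_le Ty).
  have hE : h' - mxstar z = mxstar z *m (z - h) *m h'.
    by rewrite -mulmxA mulmxBl hh' mulmxBr mulmxA sz mul1mx mulmx1.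
  have e1 := mnM (mxstar z *m (z - h)) h'; have e2 := mnM (mxstar z) (z - h).
  rewrite mn_star zh in e2; rewrite -hE zh in e1.
  have e3 : mn h' <= mn (h' - mxstar z) + mn z.
    by rewrite -{1}(subrK (mxstar z) h') -(mn_star z) mnD.
  rewrite mn_distC; have := mn_ge0 h'; have := mn_ge0 (am - w).
  have := mn_ge0 (mxstar z *m (am - w)); have := mn_ge0 (h' - mxstar z).
  set x1 := mn (h' - _) in e1 e3 *; set x2 := mn (mxstar z *m _) in e1 e2 *.
  set x3 := mn (am - w) in e2 zw *; set x4 := mn h' in e1 e3 *.
  rewrite -/x1 in e1; have mE : mn z = m - 1 by rewrite /m addrK.
  rewrite mE in e2 e3 nz; move=> p1 p2 p3 p4.
  have q2 : x2 <= m * d by nra.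
  have q4 : x4 <= 2 * m by nra.
  nra.
move=> i j; apply: limAu_closed.
  rewrite mxstarE (hc (j, i)); have [Aa _] := ha (j, i); exists (star (a (j, i))).
    by apply: limB_star; exact: limAB.
  by exists (c (j, i))^*; rewrite starD starZ star1.
move=> e e0; have [h' h'A zh] := inv e e0; exists (h' i j) => //.
by apply: le_lt_trans zh; have := le_mn (mxstar z - h') i j; rewrite !mxE.
Qed.

(** * Pinching onto the diagonal *)

Definition pinch (e x : U) : U := e * x * e + (1 - e) * x * (1 - e).

(** The pinching is the average of x and s x s for the symmetry s = 1 - 2e, whose norm is at most
    1. *)
Lemma pinch_nrm e x : e * e = e -> star e = e -> nrm (pinch e x) <= nrm x.
Proof.
move=> ee se; pose s := 1 - e - e.
have ss : s * s = 1.
  have es : e * s = - e by rewrite /s !mulrBr mulr1 ee subrr add0r.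
  by rewrite {1}/s 2!mulrBl mul1r !es !opprK /s !subrK.
have st : star s = s by rewrite /s !starB star1 se.
have ns : nrm s <= 1.
  have := nrm_starM s; rewrite st ss => h; have := @nrm1_le _ U; have := nrm_ge0 s; nra.
have -> : pinch e x = (2^-1 : K) *: (x + s * x * s).
  have half (y : U) : y = (2^-1 : K) *: (y + y).
    by rewrite -mulr2n -[y *+ 2](scaler_nat (R := K)) scalerA mulVf ?scale1r// pnatr_eq0.
  rewrite {1}[pinch e x]half; congr (_ *: _).
  pose f := 1 - e; have sE : s = f - e by [].
  have {3}-> : x = f * x * f + f * x * e + (e * x * f + e * x * e).
    by rewrite -!mulrDr subrK !mulr1 -mulrDl subrK mul1r.
  have -> : s * x * s = (f * x * f - f * x * e) - (e * x * f - e * x * e).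
    by rewrite sE (mulrBl x) (mulrBl (f - e)) !mulrBr.
  rewrite /pinch -/f opprB [RHS]addrACA (addrACA (f * x * f)) subrr addr0.
  rewrite (addrC (e * x * f) (e * x * e)) (addrACA (e * x * e) (e * x * f)) subrr addr0.
  by rewrite [LHS]addrACA addrC.
rewrite nrmZ.
have -> : nc (2^-1 : K) = 2^-1.
  have -> : (2^-1 : K) = (2^-1 : R)%:C%C by rewrite fmorphV rmorph_nat.
  by rewrite nc_real ger0_norm// invr_ge0.
have h1 := nrmD x (s * x * s); have h2 := nrmM (s * x) s; have h3 := nrmM s x.
have := nrm_ge0 x; have := nrm_ge0 s; have := nrm_ge0 (s * x).
have h4 : nrm (s * x * s) <= nrm x.
  apply: le_trans h2 _; apply: (@le_trans _ _ (nrm (s * x))).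
    by rewrite -[leRHS]mulr1 ler_wpM2l ?nrm_ge0.
  by apply: le_trans h3 _; rewrite -[leRHS]mul1r ler_wpM2r ?nrm_ge0.
lra.
Qed.

Definition pinch_seq k (r : seq (I k)) x : U := foldr (fun i y => pinch (E i i) y) x r.

Lemma pinchB e x y : pinch e (x - y) = pinch e x - pinch e y.
Proof. by rewrite /pinch; move: (1 - e) => f; rewrite !mulrBr !mulrBl opprD addrACA. Qed.

Lemma pinch_seqB k (r : seq (I k)) x y : pinch_seq r (x - y) = pinch_seq r x - pinch_seq r y.
Proof. by elim: r => [//|i r /= ->]; rewrite pinchB. Qed.

Lemma pinch_seq_nrm k (r : seq (I k)) x : nrm (pinch_seq r x) <= nrm x.
Proof.
elim: r => [//|i r IH] /=; apply: le_trans IH.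
by apply: pinch_nrm; rewrite ?munit_idl ?munit_star.
Qed.

Lemma pinch_id e x : e * e = e -> x * e = e * x -> pinch e x = x.
Proof.
move=> ee xe; have xf : (1 - e) * x = x * (1 - e) by rewrite mulrBl mulrBr mul1r mulr1 xe.
have ff : (1 - e) * (1 - e) = 1 - e by rewrite mulrBl mul1r mulrBr mulr1 ee subrr subr0.
by rewrite /pinch xf -xe -!mulrA ee ff -mulrDr subrKC mulr1.
Qed.

Lemma pinch_seq_id k (r : seq (I k)) x : (forall i : I k, x * E i i = E i i * x) ->
  pinch_seq r x = x.
Proof. by move=> h; elim: r => [//|i r /= ->]; rewrite pinch_id// munit_idl. Qed.

Lemma pinchZ c e x : pinch e (c *: x) = c *: pinch e x.
Proof. by rewrite /pinch -!scalerAr -!scalerAl scalerDr. Qed.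

Lemma pinchD e x y : pinch e (x + y) = pinch e x + pinch e y.
Proof. by rewrite /pinch; move: (1 - e) => f; rewrite !mulrDr !mulrDl addrACA. Qed.

Lemma pinch0 e : pinch e 0 = 0.
Proof. by rewrite /pinch !mulr0 !mul0r addr0. Qed.

Lemma pinch_unit k (a i j : I k) : i != j ->
  pinch (E a a) (E i j) = if (a == i) || (a == j) then 0 else E i j.
Proof.
move=> ij; rewrite /pinch !(mulrBl, mulrBr) !mul1r !mulr1.
have [->|ai] := eqVneq a i; rewrite /=.
  by rewrite munit_idl munit_mul0 1?eq_sym// !subrr addr0.
have [->|aj] := eqVneq a j; rewrite /=.
  by rewrite munit_mul0 1?eq_sym// mul0r !subr0 munit_idr subrr addr0.
by rewrite munit_mul0// mul0r (munit_mul0 _ _ (j := j)) 1?eq_sym// !subr0 add0r.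
Qed.

Lemma pinch_seq_unit k (r : seq (I k)) i j : i != j ->
  pinch_seq r (E i j) = if (i \in r) || (j \in r) then 0 else E i j.
Proof.
move=> ij; elim: r => [//|a r /= ->]; rewrite !inE.
case: ifP => [/orP[->|->]|/norP[/negbTE-> /negbTE->]]; rewrite ?orbT ?pinch0//.
by rewrite !orbF pinch_unit// ![a == _]eq_sym.
Qed.

Lemma pinch_seq_span k x : mspan (@full_rel k) x -> mspan (@diag_rel k) (pinch_seq (enum (I k)) x).
Proof.
move: x; apply: mspan_ind => [|x y|c i j _].
- suff -> : pinch_seq (enum (I k)) 0 = 0 by exact: mspan0.
  by elim: (enum _) => [//|a r /= ->]; rewrite pinch0.
- have -> : pinch_seq (enum (I k)) (x + y) = pinch_seq (enum (I k)) x + pinch_seq (enum (I k)) y.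
    by elim: (enum _) => [//|a r /= ->]; rewrite pinchD.
  exact: mspanD.
- have -> : pinch_seq (enum (I k)) (c *: E i j) = c *: pinch_seq (enum (I k)) (E i j).
    by elim: (enum _) => [//|a r /= ->]; rewrite pinchZ.
  apply: mspanZ; have [->|ij] := eqVneq i j; last first.
    by rewrite pinch_seq_unit// mem_enum; exact: mspan0.
  rewrite pinch_seq_id; first by apply: mspan_unit; exact: eqxx.
  by move=> a; rewrite !munit_diagM eq_sym; case: eqP => // ->.
Qed.

(** The masa is its own relative commutant: pinching by all diagonal units of a level fixes x, moves
    an approximant into the diagonal, and does not increase their distance. *)
Lemma comm_limC x : B x -> (forall k (i : I k), x * E i i = E i i * x) -> C x.
Proof.
rewrite limBE limCE => hx xE e e0 L; have [k [y [Lk yB xy]]] := hx e e0 L.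
exists k, (pinch_seq (enum (I k)) y); split=> //; first exact: pinch_seq_span.
rewrite -(@pinch_seq_id k (enum (I k)) x (xE k)) -pinch_seqB.
exact: le_lt_trans (pinch_seq_nrm _ _) xy.
Qed.

(** * Cuts of normalising partial isometries *)

Section Cut.
Variables (n : nat) (v : 'M[U]_n).
Hypotheses (vv : v *m mxstar v *m v = v) (vC : Mset C (mxstar v *m v)).
Hypothesis vN : forall c, Mset C c -> Mset C (v *m c *m mxstar v).
Local Notation "a %:S" := (a%:M : 'M[U]_n) (at level 1, format "a %:S").

Lemma scalarMM (a b : U) : a%:S *m b%:S = (a * b)%:S.
Proof. by rewrite -scalar_mxM. Qed.

(** By normalisation, v e times the adjoint of v has entries in [C], hence commutes with the scalar
    matrix g; likewise [mxstar v *m v] commutes with e. So g and e can be moved next to their copies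
    and absorbed. *)
Lemma pisom_cut g e : Cu g -> Cu e -> g * g = g -> star g = g -> e * e = e -> star e = e ->
  (g%:S *m v *m e%:S) *m mxstar (g%:S *m v *m e%:S) *m (g%:S *m v *m e%:S) =
  g%:S *m v *m e%:S.
Proof.
move=> Cg Ce gg sg ee se; rewrite !mxstarM !mxstar_scalar sg se.
pose Q := v *m (e%:S *m (mxstar v *m v)) *m mxstar v.
have QC : Mset C Q by apply: vN; apply: MsetCuC => //; exact: Mset_scalarCu.
have QE : Q = v *m e%:S *m mxstar v.
  by rewrite /Q (scalar_comm Ce vC) !mulmxA vv.
have -> : g%:S *m v *m e%:S *m (e%:S *m (mxstar v *m g%:S)) *m (g%:S *m v *m e%:S)
  = g%:S *m (v *m e%:S *m mxstar v) *m g%:S *m v *m e%:S.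
  by rewrite !mulmxA -(mulmxA _ e%:S e%:S) -(mulmxA _ g%:S g%:S) !scalarMM ee gg.
rewrite -QE -[g%:S *m Q *m g%:S]mulmxA -(scalar_comm Cg QC) mulmxA scalarMM gg.
rewrite QE -!mulmxA; congr (_ *m _); rewrite !mulmxA -(mulmxA (v *m _)).
rewrite -(mulmxA v) (scalar_comm Ce vC) !mulmxA vv -mulmxA scalarMM ee.
by [].
Qed.

(** For a diagonal unit e, the cuts e v (1 - e) and (1 - e) v e are partial isometries. The same
    cuts of c vanish, so these have norm less than 1 and are zero. The entries of v therefore
    commute with all diagonal units. *)
Lemma pisom_near c : Mset B v -> Mset C c -> mn (v - c) < 1 -> Mset C v.
Proof.
move=> vB cC vc i j; apply: comm_limC => // k a.
set e := E a a; have Ce : C e by exact: munitC.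
have Cue : Cu e by exact: sub_with_unit.
have Cug : Cu (1 - e) by apply: limCuD; [exact: limCu1|exact: limCuN].
have ee : e * e = e by rewrite munit_idl.
have se : star e = e by rewrite munit_star.
have gg : (1 - e) * (1 - e) = 1 - e by rewrite mulrBl mul1r mulrBr mulr1 ee subrr subr0.
have sg : star (1 - e) = 1 - e by rewrite starB star1 se.
have small g f : Cu g -> Cu f -> g * g = g -> star g = g -> f * f = f -> star f = f -> g * f = 0 ->
    g%:S *m v *m f%:S = 0.
  move=> Cg Cf gg' sg' ff sf gf; apply: pisom_small; first exact: pisom_cut.
  have -> : g%:S *m v *m f%:S = g%:S *m (v - c) *m f%:S.
    rewrite mulmxBr mulmxBl -[g%:S *m c *m _]mulmxA -(scalar_comm Cf cC) mulmxA scalarMM gf.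
    by rewrite raddf0 mul0mx subr0.
  apply: le_lt_trans vc; apply: le_trans (mn_scalarMr1 _ (nrm_proj ff sf)) _.
  exact: (mn_scalarMl1 _ (nrm_proj gg' sg')).
have h1 : e%:S *m v *m (1 - e)%:S = 0.
  by apply: small => //; rewrite mulrBr mulr1 ee subrr.
have h2 : (1 - e)%:S *m v *m e%:S = 0.
  by apply: small => //; rewrite mulrBl mul1r ee subrr.
have := congr1 (fun M : 'M[U]_n => M i j) h1; rewrite scalarMr scalarMl mxE mulrBr mulr1.
move/eqP; rewrite subr_eq0 => /eqP ->.
have := congr1 (fun M : 'M[U]_n => M i j) h2; rewrite scalarMr scalarMl mxE mulrBl mul1r mulrBl.
by move/eqP; rewrite subr_eq0 => /eqP ->.
Qed.
End Cut.

(** * Inverse square roots and constant projections *)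

Lemma mn_complete n (u : nat -> 'M[U]_n) :
  (forall e, 0 < e -> exists N, forall m p, (N <= m)%N -> (N <= p)%N -> mn (u m - u p) < e) ->
  exists x, forall e, 0 < e -> exists N, forall p, (N <= p)%N -> mn (u p - x) < e.
Proof.
move=> hu.
have /choice[x hx] : forall q : 'I_n * 'I_n, exists l, forall e, 0 < e ->
    exists N, forall p, (N <= p)%N -> nrm (u p q.1 q.2 - l) < e.
  move=> [i j]; apply: nrm_complete => e e0; have [N hN] := hu e e0.
  exists N => m p Nm Np; apply: le_lt_trans (hN m p Nm Np).
  by have := le_mn (u m - u p) i j; rewrite !mxE.
exists (\matrix_(i, j) x (i, j)) => e e0.
have s0 : 0 < (n * n)%:R + 1 :> R by rewrite ltr_wpDl.
have /choice[f hf] : forall q : 'I_n * 'I_n, exists N, forall p, (N <= p)%N ->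
    nrm (u p q.1 q.2 - x q) < e / ((n * n)%:R + 1).
  by move=> q; apply: hx; exact: divr_gt0.
exists (\max_q f q) => p hp.
apply: (@le_lt_trans _ _ ((n * n)%:R * (e / ((n * n)%:R + 1)))).
  apply: mn_leC => i j; rewrite !mxE; apply: ltW; apply: (hf (i, j)).
  by apply: leq_trans hp; exact: leq_bigmax.
rewrite mulrA ltr_pdivrMr// mulrC ltr_pM2l//; lra.
Qed.

Lemma half_pow_small (c e : R) : 0 <= c -> 0 < e -> exists N : nat, (1 / 2) ^+ N * c < e.
Proof.
move=> c0 e0; pose N := Num.bound (c / e); exists N.
have h1 : c / e < N%:R by apply: archi_boundP; exact: divr_ge0 c0 (ltW e0).
have h2 : N%:R <= 2 ^+ N :> R by rewrite -natrX ler_nat ltnW// ltn_expl.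
rewrite ltr_pdivrMr// in h1.
rewrite div1r exprVn mulrC ltr_pdivrMr ?exprn_gt0//.
apply: lt_le_trans h1 _; rewrite mulrC ler_wpM2l// ltW//.
Qed.

(* A solution x of x = (k + 2kx - x^2 + kx^2) / 2 commuting with k satisfies
   (1 + x)^2 (1 - k) = 1; the right-hand side is a contraction for small k. *)
Lemma inv_sqrt_fix n (k : 'M[U]_n) (W : set 'M[U]_n) :
  let F x := mxkscale 2^-1 (k + (k *m x + k *m x) - x *m x + k *m x *m x) in
  mn k <= 1 / 16 -> W 0 -> (forall x, W x -> W (F x)) ->
  (forall x, (forall e, 0 < e -> exists2 y, W y & mn (x - y) < e) -> W x) ->
  exists x, [/\ W x, mn x <= 2 * mn k & x = F x].
Proof.
move=> F k16 W0 WF Wcl.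
have k0 := mn_ge0 k; set t := mn k in k16 k0 *.
have half (v : 'M[U]_n) : mn (mxkscale 2^-1 v) = 2^-1 * mn v.
  rewrite /mn mulr_sumr; apply: eq_bigr => i _; rewrite mulr_sumr; apply: eq_bigr => j _.
  rewrite mxE nrmZ; congr (_ * _).
  have -> : (2^-1 : K) = (2^-1 : R)%:C%C by rewrite fmorphV rmorph_nat.
  by rewrite nc_real ger0_norm// invr_ge0.
have kB (v w : 'M[U]_n) : mxkscale 2^-1 v - mxkscale 2^-1 w = mxkscale 2^-1 (v - w).
  by apply/matrixP => i j; rewrite !mxE scalerBr.
(* With t at most 1/16 the terms of higher order are small enough for F to preserve the ball of
   radius 2t and to halve distances on it. *)
have ball x : mn x <= 2 * t -> mn (F x) <= 2 * t.
  move=> xt; rewrite half.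
  have h1 := mnM k x; have h2 := mnM x x; have h3 := mnM (k *m x) x; rewrite -/t in h1.
  have h4 := mnD (k + (k *m x + k *m x) - x *m x) (k *m x *m x).
  have h5 := mnB (k + (k *m x + k *m x)) (x *m x).
  have h6 := mnD k (k *m x + k *m x); have h7 := mnD (k *m x) (k *m x); rewrite -/t in h6.
  have x0 := mn_ge0 x; have kx0 := mn_ge0 (k *m x).
  have q1 : mn (k *m x) <= t * (2 * t) by nra.
  have q2 : mn (x *m x) <= (2 * t) * (2 * t) by nra.
  have q3 : mn (k *m x *m x) <= (t * (2 * t)) * (2 * t) by nra.
  have q4 : t * t <= t / 16 by nra.
  have q5 : t * (t * t) <= t / 16 by nra.
  nra.
have contr x y : mn x <= 2 * t -> mn y <= 2 * t -> mn (F x - F y) <= 1 / 2 * mn (x - y).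
  move=> xt yt; rewrite kB half.
  set D := x *m x - y *m y.
  have DE : D = x *m (x - y) + (x - y) *m y by rewrite mulmxBr mulmxBl addrA subrK.
  have -> : k + (k *m x + k *m x) - x *m x + k *m x *m x -
      (k + (k *m y + k *m y) - y *m y + k *m y *m y) =
      (k *m (x - y) + k *m (x - y)) - D + k *m D.
    have zmodE (V : zmodType) (p a b c a' b' c' : V) :
        p + a - b + c - (p + a' - b' + c') = (a - a') - (b - b') + (c - c').
      rewrite opprD addrACA; congr (_ + _); rewrite opprD addrACA -(opprD b); congr (_ + _).
      by rewrite opprD addrACA subrr add0r.
    by rewrite zmodE /D !mulmxBr !mulmxA; congr (_ - _ + _); rewrite opprD addrACA.
  set d := mn (x - y).
  have h1 := mnD (k *m (x - y) + k *m (x - y) - D) (k *m D).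
  have h2 := mnB (k *m (x - y) + k *m (x - y)) D.
  have h3 := mnD (k *m (x - y)) (k *m (x - y)).
  have h4 := mnM k (x - y); have h5 := mnM k D.
  have h6 := mnD (x *m (x - y)) ((x - y) *m y); rewrite -DE in h6.
  have h7 := mnM x (x - y); have h8 := mnM (x - y) y.
  have d0 : 0 <= d by exact: mn_ge0.
  rewrite -/t -/d in h4 h5 h7 h8; have D0 := mn_ge0 D.
  have q1 : mn (x *m (x - y)) <= 2 * t * d.
    by apply: le_trans h7 _; rewrite ler_wpM2r.
  have q2 : mn ((x - y) *m y) <= 2 * t * d.
    by apply: le_trans h8 _; rewrite mulrC ler_wpM2r.
  have q3 : mn D <= 4 * t * d by lra.
  have q4 : t * mn D <= 1 / 16 * mn D by rewrite ler_wpM2r.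
  have q5 : t * d <= 1 / 16 * d by rewrite ler_wpM2r.
  lra.
pose u := fix u m := if m is m'.+1 then F (u m') else 0.
have uW m : W (u m) by elim: m => [//|m IH]; exact: WF.
have ub m : mn (u m) <= 2 * t.
  by elim: m => [|m IH]; [rewrite mn0 mulr_ge0|exact: ball].
have uC m p : mn (u (m + p)%N - u m) <= (1 / 2) ^+ m * (2 * t).
  elim: m => [|m IH]; first by rewrite add0n subr0 expr0 mul1r.
  rewrite addSn /= exprS -mulrA; apply: le_trans (contr _ _ (ub _) (ub _)) _.
  by rewrite ler_wpM2l// divr_ge0.
have t2 : 0 <= 4 * t by lra.
have [|x hx] := @mn_complete n u.
  move=> e e0; have [N hN] := half_pow_small t2 e0; exists N => m p Nm Np.
  apply: le_lt_trans hN; apply: le_trans (mn_dist _ (u N) _) _.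
  rewrite (mn_distC (u N)); have := uC N (m - N)%N; have := uC N (p - N)%N.
  rewrite !subnKC//; lra.
have xb : mn x <= 2 * t.
  apply/ler_addgt0Pl => e e0; have [N hN] := hx e e0.
  have := mnB (u N) (u N - x); rewrite subKr => h; apply: le_trans h _.
  by have := ub N; have := hN N (leqnn N); lra.
exists x; split=> //.
  apply: Wcl => e e0; have [N hN] := hx e e0; exists (u N) => //.
  by rewrite mn_distC hN.
apply/eqP; rewrite -subr_eq0; apply/eqP; apply: mn_small => e e0.
have e2 : 0 < e / 2 by lra.
have [N hN] := hx _ e2.
apply: le_trans (mn_dist _ (u N.+1) _) _; rewrite (mn_distC x).
have := hN N.+1 (leqnSn N); have := hN N (leqnn N).
have := contr _ _ (ub N) xb; rewrite -[F (u N)]/(u N.+1).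
have := mn_ge0 (u N - x); lra.
Qed.

(** Schmidt orthonormalisation of a row basis of b gives an r by n matrix V with orthonormal rows
    and b equal to its adjoint times V. Padding V with zero rows makes it square. The entries are at
    most 1 in modulus because the rows of beta have length 0 or 1. *)
Lemma projection_factor n (b : 'M[K]_n) : b *m b = b -> (b ^t*)%sesqui = b ->
  exists r (beta : 'M[K]_n), [/\ (beta ^t*)%sesqui *m beta = b,
    beta *m (beta ^t*)%sesqui = pid_mx r, pid_mx r *m beta = beta,
    (r <= n)%N & forall i j, nc (beta i j) <= 1].
Proof.
move=> bb sb; set r := \rank b; pose V := schmidt (row_base b).
have rn : (r <= n)%N by exact: rank_leq_row.
have Vu : V *m (V ^t*)%sesqui = 1%:M.
  by apply/unitarymxP; apply: schmidt_unitarymx.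
have Vb : (V :=: b)%MS.
  apply: (eqmx_trans _ (eq_row_base b)); apply: eqmx_schmidt_free; exact: row_base_free.
have VbV : V *m b = V.
  have /submxP[W ->] : (V <= b)%MS by rewrite Vb.
  by rewrite -mulmxA bb.
have VVb : (V ^t*)%sesqui *m V = b.
  have /submxP[W bW] : (b <= V)%MS by rewrite Vb.
  have h : b *m (V ^t*)%sesqui *m V = b.
    have gen (X : 'M[K]_n) : X = W *m V -> X *m (V ^t*)%sesqui *m V = X.
      by move=> ->; rewrite -(mulmxA W) Vu mulmx1.
    exact: gen bW.
  have h2 : b *m (V ^t*)%sesqui = (V ^t*)%sesqui.
    have := congr1 (fun X : 'M_(r, n) => (X ^t*)%sesqui) VbV.
    by rewrite trmx_mul map_mxM sb.
  by rewrite -h2 h.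
pose P : 'M[K]_(n, r) := pid_mx r.
have sP : (P ^t*)%sesqui = pid_mx r.
  by rewrite /P tr_pid_mx map_pid_mx.
pose beta := P *m V.
have sbeta : (beta ^t*)%sesqui = (V ^t*)%sesqui *m (pid_mx r : 'M_(r, n)).
  by rewrite /beta trmx_mul map_mxM -/(P ^t*)%sesqui sP.
have Pb : beta *m (beta ^t*)%sesqui = pid_mx r.
  by rewrite sbeta /beta mulmxA -(mulmxA P) Vu mulmx1 mul_pid_mx minnn (minn_idPr _).
exists r, beta; split=> //.
- rewrite sbeta /beta mulmxA -(mulmxA _ (pid_mx r : 'M_(r, n))) mul_pid_mx minnn (minn_idPr rn).
  by rewrite pid_mx_1 mulmx1.
- by rewrite /beta mulmxA mul_pid_mx minnn (minn_idPr rn).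
- move=> i j; have h := congr1 (fun M : 'M[K]_n => M i i) Pb.
  rewrite mxE [RHS]mxE in h.
  have h1 : `|beta i j| ^+ 2 <= (1 : K).
    apply: (@le_trans _ _ (\sum_j0 beta i j0 * (beta ^t*)%sesqui j0 i)).
      rewrite (bigD1 j)//= !mxE -normCK lerDl sumr_ge0// => l _.
      by rewrite !mxE -normCK exprn_ge0.
    rewrite h; case: (_ && _); rewrite ?lexx ?ler01//.
  have : `|beta i j| <= 1 by rewrite -(@expr_le1 _ 2).
  by rewrite ncE -[1]/((1 : R)%:C%C) lecR.
Qed.

Lemma MsetC_closed n (v : 'M[U]_n) :
  (forall e, 0 < e -> exists2 w, Mset C w & mn (v - w) < e) -> Mset C v.
Proof. by rewrite limCE; exact: Mset_closed. Qed.

Lemma MsetC_kscale n c (v : 'M[U]_n) : Mset C v -> Mset C (mxkscale c v).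
Proof. by move=> hv i j; rewrite mxE; exact: limCZ. Qed.

Lemma mxkscaleMl n c (v w : 'M[U]_n) : mxkscale c v *m w = mxkscale c (v *m w).
Proof.
apply/matrixP => i j; rewrite !mxE scaler_sumr; apply: eq_bigr => k _.
by rewrite mxE scalerAl.
Qed.

Lemma mx_closed_eq n (L : 'M[U]_n -> 'M[U]_n) (c : R) (W : set 'M[U]_n) x : 0 <= c ->
  (forall v w, mn (L v - L w) <= c * mn (v - w)) -> (forall y, W y -> L y = 0) ->
  (forall e, 0 < e -> exists2 y, W y & mn (x - y) < e) -> L x = 0.
Proof.
move=> c0 Lc LW h; apply: mn_small => e e0.
have c1 : 0 < c + 1 by lra.
have [y Wy xy] := h _ (divr_gt0 e0 c1).
have := Lc x y; rewrite (LW y)// subr0 => h1; apply: le_trans h1 _.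
rewrite ltr_pdivlMr// in xy; have := mn_ge0 (x - y); nra.
Qed.

(** Here 1 + x is the inverse square root of 1 - k. Its entries, self-adjointness, support under g
    and commutation with k are closed conditions preserved by the iteration, so they are gathered in
    [W]. *)
Lemma inv_sqrt n (k g : 'M[U]_n) : Mset C k -> mxstar k = k -> g *m k = k -> k *m g = k ->
  mn k <= 1 / 16 -> exists x, [/\ Mset C x, mxstar x = x, mn x <= 2 * mn k,
    [/\ g *m x = x, x *m g = x & x *m k = k *m x] &
    (1%:M + x) *m (1%:M + x) *m (1%:M - k) = 1%:M].
Proof.
move=> kC sk gk kg k16.
pose W : set 'M[U]_n := [set x | [/\ Mset C x, mxstar x = x, g *m x = x, x *m g = x & x *m k = k *m x]].
have k0 := mn_ge0 k.
have g0 := mn_ge0 g.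
have [|||x [[xC sx gx xg xk] xn xE]] := @inv_sqrt_fix n k W k16.
- split; [exact: MsetC0|exact: mxstar0|exact: mulmx0|exact: mul0mx|].
  by rewrite mulmx0 mul0mx.
- move=> x [xC sx gx xg xk].
  have kx : Mset C (k *m x) by exact: MsetCM.
  split.
  + apply: MsetC_kscale; apply: MsetCD; last exact: MsetCM.
    apply: MsetCB; last exact: MsetCM.
    by apply: MsetCD => //; exact: MsetCD.
  + have -> : forall v : 'M[U]_n, mxstar (mxkscale 2^-1 v) = mxkscale 2^-1 (mxstar v).
      move=> v; apply/matrixP => i j; rewrite mxstarE !mxE starZ; congr (_ *: _).
      by rewrite fmorphV rmorph_nat.
    by rewrite !(mxstarD, mxstarN, mxstarM) sk sx xk mulmxA xk.
  + by rewrite mxkscaleMr !(mulmxDr, mulmxBr, mulmxN) !mulmxA gk gx.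
  + by rewrite mxkscaleMl !(mulmxDl, mulmxBl, mulNmx) -!mulmxA kg xg.
  + rewrite mxkscaleMl mxkscaleMr; congr mxkscale.
    rewrite !(mulmxDl, mulmxBl, mulmxDr, mulmxBr, mulNmx, mulmxN).
    have e1 : k *m x *m k = k *m (k *m x) by rewrite -mulmxA xk.
    have e2 : x *m x *m k = k *m (x *m x) by rewrite -mulmxA xk mulmxA xk mulmxA.
    have e3 : k *m x *m x *m k = k *m (k *m x *m x) by rewrite -!mulmxA xk (mulmxA x) xk !mulmxA.
    by rewrite e1 e2 e3.
(* Each defining equation of [W] says that a Lipschitz map vanishes, so it passes to limits. *)
- move=> x hx.
  have lin (L : 'M[U]_n -> 'M[U]_n) (c : R) : 0 <= c ->
    (forall v w, mn (L v - L w) <= c * mn (v - w)) -> (forall y, W y -> L y = 0) -> L x = 0.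
    by move=> c0 Lc LW; exact: (mx_closed_eq c0 Lc LW hx).
  have zmodE (V : zmodType) (a b c d : V) : a - b - (c - d) = (a - c) - (b - d).
    by rewrite opprD addrACA -opprD.
  split.
  + apply: MsetC_closed => e e0; have [y [yC _ _ _ _] xy] := hx e e0; by exists y.
  + apply/eqP; rewrite -subr_eq0; apply/eqP; apply: (lin (fun x => mxstar x - x) 2) => //.
      move=> v w; rewrite zmodE -mxstarB; apply: le_trans (mnB _ _) _.
      rewrite mn_star; lra.
    by move=> y [_ -> _ _ _]; rewrite subrr.
  + apply/eqP; rewrite -subr_eq0; apply/eqP; apply: (lin (fun x => g *m x - x) (mn g + 1)).
    * lra.
    * move=> v w; rewrite zmodE -mulmxBr; apply: le_trans (mnB _ _) _.
      have := mnM g (v - w); lra.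
    by move=> y [_ _ -> _ _]; rewrite subrr.
  + apply/eqP; rewrite -subr_eq0; apply/eqP; apply: (lin (fun x => x *m g - x) (mn g + 1)).
    * lra.
    * move=> v w; rewrite zmodE -mulmxBl; apply: le_trans (mnB _ _) _.
      have := mnM (v - w) g; lra.
    by move=> y [_ _ _ -> _]; rewrite subrr.
  + apply/eqP; rewrite -subr_eq0; apply/eqP; apply: (lin (fun x => x *m k - k *m x) (2 * mn k)).
    * lra.
    * move=> v w; rewrite zmodE -mulmxBl -mulmxBr; apply: le_trans (mnB _ _) _.
      have := mnM (v - w) k; have := mnM k (v - w); lra.
    by move=> y [_ _ _ _ ->]; rewrite subrr.
exists x; split=> //.
have h2 : 2^-1 + 2^-1 = 1 :> K.
  by rewrite -mulr2n -[_ *+ 2]mulr_natl mulfV// pnatr_eq0.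
have two (v : 'M[U]_n) : mxkscale 2^-1 v + mxkscale 2^-1 v = v.
  by apply/matrixP => i j; rewrite !mxE -scalerDl h2 scale1r.
have x2 : x + x = k + (k *m x + k *m x) - x *m x + k *m x *m x by rewrite {1 2}xE two.
have e2 : x *m x *m k = k *m x *m x by rewrite -mulmxA xk mulmxA xk.
have P1 : (1%:M + x) *m (1%:M + x) = 1%:M + (x + x + x *m x).
  by rewrite mulmxDl mul1mx mulmxDr mulmx1 -!addrA.
have P2 : x + x + x *m x = k + (k *m x + k *m x) + k *m x *m x.
  by rewrite x2 addrAC subrK.
have P3 : (1%:M + (x + x + x *m x)) *m k = k + (k *m x + k *m x) + k *m x *m x.
  by rewrite mulmxDl mul1mx !mulmxDl xk e2 addrA.
by rewrite P1 mulmxBr mulmx1 P3 P2 addrK.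
Qed.

(* Normalises the partial isometry beta (x) e cut down by q: the corrected
   s = (1 + x) (beta (x) e) q implements the equivalence of q with a constant
   projection. *)
Lemma projection_equiv n (q : 'M[U]_n) (e : U) (b beta : 'M[K]_n) r (N : R) :
  C e -> e * e = e -> star e = e -> Mset C q -> q *m q = q -> mxstar q = q ->
  e%:M *m q = q ->
  (beta ^t*)%sesqui *m beta = b -> beta *m (beta ^t*)%sesqui = pid_mx r ->
  pid_mx r *m beta = beta -> (r <= n)%N ->
  1 <= N -> mn q <= N -> mn (amp beta e) <= N -> 16 * N ^+ 6 * mn (q - amp b e) <= 1 ->
  exists s : 'M[U]_n, [/\ Mset C s, mxstar s *m s = q, s *m mxstar s = amp (pid_mx r) e &
    s *m mxstar s *m s = s].
Proof.
move=> eC ee se qC qq sq eq' bb br rb rn N1 qN bN tN.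
set t := mn (q - amp b e) in tN; have t0 : 0 <= t by exact: mn_ge0.
pose Bt := amp beta e; pose g : 'M[U]_n := amp (pid_mx r) e.
have sBt : mxstar Bt = amp (beta ^t*)%sesqui e by rewrite mxstar_amp se.
have BBs : Bt *m mxstar Bt = g by rewrite sBt ampM br ee.
have sBB : mxstar Bt *m Bt = amp b e by rewrite sBt ampM bb ee.
have gg : g *m g = g by rewrite ampM mul_pid_mx !minnn (minn_idPr rn) ee.
have gB : g *m Bt = Bt by rewrite ampM rb ee.
have sg : mxstar g = g.
  by rewrite -BBs mxstarM mxstarK.
have Bg : mxstar Bt *m g = mxstar Bt by rewrite -{1}sg -mxstarM gB.
have gC : Mset C g by exact: Mset_ampC.
have BC : Mset C Bt by exact: Mset_ampC.
pose s0 := Bt *m q; pose h := s0 *m mxstar s0.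
have ss0 : mxstar s0 = q *m mxstar Bt by rewrite mxstarM sq.
have hE : h = Bt *m q *m mxstar Bt by rewrite /h ss0 /s0 mulmxA -(mulmxA Bt) qq.
(* The defect of s0 from having final projection g. It is supported under g, where h = g (1 - k);
   multiplying s0 by the inverse square root of 1 - k removes it. *)
pose k := g - h.
have gs0 : g *m s0 = s0 by rewrite /s0 mulmxA gB.
have gh : g *m h = h by rewrite /h mulmxA gs0.
have hg : h *m g = h by rewrite hE -!mulmxA Bg.
have kE : k = Bt *m (amp b e - q) *m mxstar Bt.
  by rewrite mulmxBr mulmxBl -hE -sBB !mulmxA BBs -mulmxA BBs gg.
have N0 : 0 <= N by lra.
have nB := mn_ge0 Bt; have nq := mn_ge0 q.
have kn : mn k <= N ^+ 2 * t.
  rewrite kE; have h1 := mnM (Bt *m (amp b e - q)) (mxstar Bt).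
  have h2 := mnM Bt (amp b e - q); rewrite mn_star in h1; rewrite mn_distC -/t in h2.
  apply: le_trans h1 _; apply: (@le_trans _ _ (mn Bt * t * mn Bt)).
    by rewrite ler_wpM2r.
  by rewrite mulrAC expr2 ler_wpM2r// ler_pM.
have NN m p : (m <= p)%N -> N ^+ m <= N ^+ p by move=> mp; rewrite ler_weXn2l.
have tp m : (m <= 6)%N -> 16 * (N ^+ m * t) <= 1.
  move=> m6; apply: le_trans tN; rewrite -mulrA ler_wpM2l// ler_wpM2r// NN//.
have [|||||x [xC sx xn [gx xg xk] xE]] := @inv_sqrt n k g.
- by apply: MsetCB => //; apply: MsetCM; [apply: MsetCM|apply: MsetC_star; exact: MsetCM].
- by rewrite mxstarB sg /h mxstarM mxstarK.
- by rewrite mulmxBr gg gh.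
- by rewrite mulmxBl gg hg.
- have := tp 2 isT; lra.
pose y := 1%:M + x; have sy : mxstar y = y by rewrite mxstarD mxstar1 sx.
have yg : y *m g = g *m y by rewrite (mulmxDl 1%:M x g) (mulmxDr g 1%:M x) mul1mx mulmx1 gx xg.
pose s := y *m s0; have ss : mxstar s = mxstar s0 *m y by rewrite mxstarM sy.
have yk : y *m (1%:M - k) = (1%:M - k) *m y.
  have yk0 : y *m k = k *m y by rewrite (mulmxDl 1%:M x k) (mulmxDr k 1%:M x) mul1mx mulmx1 xk.
  by rewrite (mulmxBr y 1%:M k) (mulmxBl 1%:M k y) mul1mx mulmx1 yk0.
have ssE : s *m mxstar s = g.
  rewrite ss /s -[y *m s0 *m _]mulmxA (mulmxA s0) -/h.
  have -> : h = g *m (1%:M - k) by rewrite mulmxBr mulmx1 mulmxBr gg gh /k subKr.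
  by rewrite -mulmxA -yk !mulmxA yg -!mulmxA (mulmxA y) xE mulmx1.
have gs : g *m s = s by rewrite /s mulmxA -yg -mulmxA gs0.
exists s; split=> //; last by rewrite ssE.
  by apply: MsetCuC; [apply: MsetCuD; [exact: MsetCu1|exact: MsetC_Cu]|exact: MsetCM].
pose p := mxstar s *m s.
have pp : p *m p = p by rewrite /p mulmxA -(mulmxA (mxstar s)) ssE -mulmxA gs.
have sq0 : s *m q = s by rewrite /s /s0 -!mulmxA qq.
have qss : q *m mxstar s = mxstar s by rewrite -{1}sq -mxstarM sq0.
have pq : p *m q = p by rewrite /p -mulmxA sq0.
have qp : q *m p = p by rewrite /p mulmxA qss.
(* The projection p lies under q, so q - p is idempotent. The hypothesis on N bounds its norm by
   1/16 + 6/16, less than 1. *)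
suff h0 : q - p = 0 by apply/esym/eqP; rewrite -subr_eq0 -/p h0.
apply: idem_small.
  by rewrite mulmxBl !mulmxBr qq pq qp pp subrr subr0.
have -> : q - p = q *m (q - amp b e) *m q - mxstar s0 *m (x + x + x *m x) *m s0.
  have -> : x + x + x *m x = y *m y - 1%:M.
    by rewrite /y mulmxDl mul1mx mulmxDr mulmx1 [RHS]addrC -[1%:M + x + _]addrA addKr addrA.
  rewrite mulmxBr mulmxBl !mulmxBr mulmxBl qq qq mulmx1.
  have -> : mxstar s0 *m s0 = q *m amp b e *m q by rewrite ss0 /s0 -!mulmxA (mulmxA (mxstar Bt)) sBB.
  by rewrite opprB addrA subrK /p ss /s !mulmxA.
apply: le_lt_trans (mnB _ _) _.
have h1 : mn (q *m (q - amp b e) *m q) <= N ^+ 2 * t.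
  apply: le_trans (mnM _ _) _; have := mnM q (q - amp b e); rewrite -/t => h1.
  apply: (@le_trans _ _ (mn q * t * mn q)); first by rewrite ler_wpM2r.
  by rewrite mulrAC expr2 ler_wpM2r// ler_pM.
have s0n : mn s0 <= N ^+ 2.
  apply: le_trans (mnM _ _) _; rewrite expr2 ler_pM//.
have xt : mn x <= 2 * (N ^+ 2 * t) by lra.
have xnn := mn_ge0 x.
have x1 : mn x <= 1 by have := tp 2 isT; lra.
have h2 : mn (x + x + x *m x) <= 3 * mn x.
  have := mnD (x + x) (x *m x); have := mnD x x; have := mnM x x; nra.
have h3 : mn (mxstar s0 *m (x + x + x *m x) *m s0) <= 6 * (N ^+ 6 * t).
  apply: le_trans (mnM _ _) _; have := mnM (mxstar s0) (x + x + x *m x); rewrite mn_star => h3.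
  have s00 := mn_ge0 s0.
  have -> : 6 * (N ^+ 6 * t) = N ^+ 2 * (6 * (N ^+ 2 * t)) * N ^+ 2 by ring.
  apply: ler_pM => //; first exact: mn_ge0.
  apply: le_trans h3 _; apply: ler_pM => //; first exact: mn_ge0.
  lra.
have := tp 2 isT; have := tp 6 isT; lra.
Qed.

Local Notation gelfand := (gelfand_space iota).

Lemma expr_small (r M e : R) : 0 <= r -> r < 1 -> 0 <= M -> 0 < e -> exists N : nat, r ^+ N * M < e.
Proof.
move=> r0 r1 M0 e0; have M1 : 0 < M + 1 by lra.
have /cvgrPdist_lt/(_ _ (divr_gt0 e0 M1)) : (fun n => r ^+ n) @ \oo --> (0 : R).
  by apply: cvg_expr; rewrite ger0_norm.
move=> [N _ /(_ N (leqnn N))] /=; rewrite sub0r normrN ger0_norm ?exprn_ge0//.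
rewrite ltr_pdivlMr// => h; exists N; apply: le_lt_trans h.
by rewrite ler_wpM2l ?exprn_ge0// lerDl.
Qed.

(** * Characters of the masa *)

Section Character.
Variable x : U -> K.
Hypothesis xG : gelfand x.

Lemma charD a b : C a -> C b -> x (a + b) = x a + x b.
Proof. by case: xG => h _ _ _ _; exact: h. Qed.
Lemma charZ c a : C a -> x (c *: a) = c * x a.
Proof. by case: xG => _ h _ _ _; exact: h. Qed.
Lemma charM a b : C a -> C b -> x (a * b) = x a * x b.
Proof. by case: xG => _ _ h _ _; exact: h. Qed.
Lemma char0 : x 0 = 0.
Proof. by rewrite -(scale0r 0) charZ ?mul0r//; exact: limC0. Qed.
Lemma charB a b : C a -> C b -> x (a - b) = x a - x b.
Proof.
move=> Ca Cb; rewrite charD//; last exact: limCN.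
by rewrite -(scaleN1r b) charZ// mulN1r.
Qed.
Lemma char_sum J (r : seq J) (P : pred J) F : (forall i, P i -> C (F i)) ->
  x (\sum_(i <- r | P i) F i) = \sum_(i <- r | P i) x (F i).
Proof.
move=> h; elim: r => [|j r IH]; first by rewrite !big_nil char0.
rewrite !big_cons; case: ifP => // Pj; rewrite charD ?IH//; first exact: h.
by elim/big_ind: _ => //; [exact: limC0|exact: limCD].
Qed.

(* Otherwise some c in C with x(c) = 1 and |c| < 1 would have b = c + cb in C,
   the sum of a Neumann series. *)
Lemma char_le a : C a -> nc (x a) <= nrm a.
Proof.
move=> Ca; rewrite leNgt; apply/negP => lt.
have xa0 : x a != 0.
  by apply: contraTneq lt => ->; rewrite nc0 -leNgt nrm_ge0.
have nxa : 0 < nc (x a) by exact: le_lt_trans (nrm_ge0 a) lt.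
pose c := (x a)^-1 *: a.
have Cc : C c by exact: limCZ.
have xc : x c = 1 by rewrite charZ// mulVf.
have ncE' : nrm c < 1.
  rewrite nrmZ; have : nc (x a)^-1 * nc (x a) = 1 by rewrite -ncM mulVf// nc1.
  have := nc_ge0 (x a)^-1; nra.
set r := nrm c in ncE'; have r0 : 0 <= r by exact: nrm_ge0.
pose u := fix u m := if m is m'.+1 then c + c * u m' else 0.
have uC m : C (u m).
  by elim: m => [|m IH] /=; [exact: limC0|apply: limCD => //; exact: limCM].
pose M := r / (1 - r); have r1 : 0 < 1 - r by lra.
have M0 : 0 <= M by rewrite divr_ge0// ltW.
have ME : M * (1 - r) = r by rewrite /M divfK// gt_eqF.
have ub m : nrm (u m) <= M.
  elim: m => [|m IH] /=; first by rewrite nrm0.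
  have h1 := nrmD c (c * u m); have h2 := nrmM c (u m); rewrite -/r in h1 h2.
  have h3 : r * nrm (u m) <= r * M by rewrite ler_wpM2l.
  lra.
have ud m p : nrm (u (m + p)%N - u m) <= r ^+ m * M.
  elim: m => [|m IH]; first by rewrite add0n subr0 expr0 mul1r.
  rewrite addSn /= opprD addrACA subrr add0r -mulrBr exprS -mulrA.
  by apply: le_trans (nrmM _ _) _; rewrite ler_wpM2l.
have [|b hb] := @nrm_complete _ _ u.
  move=> e e0; have [N hN] := expr_small r0 ncE' (mulr_ge0 (ler0n _ 2) M0) e0.
  exists N => m p Nm Np; apply: le_lt_trans hN.
  apply: le_trans (nrm_dist _ (u N) _) _; rewrite (nrm_distC (u N)).
  have := ud N (m - N)%N; have := ud N (p - N)%N; rewrite !subnKC//; lra.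
have Cb : C b.
  rewrite limCE; apply: mclos_closed => e e0; have [N hN] := hb e e0.
  by exists (u N); [rewrite -limCE|rewrite nrm_distC hN].
have bE : b = c + c * b.
  apply/eqP; rewrite -subr_eq0; apply/eqP; apply: nrm_small => e e0.
  have e2 : 0 < e / 2 by lra.
  have [N hN] := hb _ e2.
  apply: le_trans (nrm_dist _ (u N.+1) _) _; rewrite (nrm_distC b).
  have h1 := hN N.+1 (leqnSn N); have h2 := hN N (leqnn N).
  rewrite [u N.+1 - (c + c * b)]/= opprD addrACA subrr add0r -mulrBr.
  have := nrmM c (u N - b); rewrite -/r; have := nrm_ge0 (u N - b); nra.
have : x b = 1 + x b by rewrite {1}bE charD// ?charM ?xc ?mul1r//; exact: limCM.
by rewrite -{1}[x b]add0r => /addIr/eqP; rewrite eq_sym oner_eq0.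
Qed.

Lemma char_unit k (i : I k) : x (E i i) = 0 \/ x (E i i) = 1.
Proof.
have /eqP := charM (munitC i) (munitC i); rewrite munit_idl.
rewrite -subr_eq0 -{1}[x _]mulr1 -mulrBr mulf_eq0 => /orP[/eqP->|]; first by left.
by rewrite subr_eq0 => /eqP <-; right.
Qed.

Lemma char_uniq k (i j : I k) : x (E i i) = 1 -> x (E j j) = 1 -> i = j.
Proof.
move=> xi xj; apply/eqP/negPn/negP => ij.
have := charM (munitC i) (munitC j); rewrite munit_mul0// xi xj char0 mulr1.
by move/esym/eqP; rewrite oner_eq0.
Qed.

Lemma char_below k l (kl : (k <= l)%N) (i : I k) (b : I l) :
  x (E b b) = 1 -> (E i i * E b b = E b b) <-> (x (E i i) = 1).
Proof.
move=> xb; have := charM (munitC i) (munitC b); rewrite xb mulr1.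
case: (munit_diag_le kl i b) => ->.
  rewrite char0 => <-; split=> [h|/esym/eqP]; last by rewrite oner_eq0.
  by move: xb; rewrite -h char0 => /esym/eqP; rewrite oner_eq0.
by rewrite xb => <-.
Qed.

Lemma char_step k l (kl : (k <= l)%N) (i : I k) : x (E i i) = 1 ->
  exists b : I l, x (E b b) = 1.
Proof.
move=> xi; apply: contra_notP (negP (oner_neq0 K)) => hn; apply/eqP.
rewrite -xi; have [_ <-] := munit1_le kl i i.
rewrite mulr_sumr char_sum; last by move=> b _; apply: limCM; exact: munitC.
rewrite big1// => b _; rewrite charM; [|exact: munitC..].
by have [->|xb] := char_unit b; [rewrite mulr0|case: hn; exists b].
Qed.

(** A unit through x at a later level lies under a given diagonal unit of level k when x takes the
    value 1 there and is orthogonal to it otherwise, so compression reads off the value of x. *)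
Lemma char_diag_span k c : mspan (@diag_rel k) c -> C c /\
  forall l (i : I l), (k <= l)%N -> x (E i i) = 1 -> E i i * c * E i i = x c *: E i i.
Proof.
move: c; apply: mspan_ind => [|a b [Ca ha] [Cb hb]|c i j /eqP <-].
- by split; [exact: limC0|move=> l i _ _; rewrite mulr0 mul0r char0 scale0r].
- split; first exact: limCD.
  by move=> l i kl xi; rewrite mulrDr mulrDl ha// hb// charD// scalerDl.
- split; first by apply: limCZ; exact: munitC.
  move=> l b kl xb; rewrite charZ; last exact: munitC.
  rewrite -scalerAr -scalerAl -scalerA; congr (_ *: _).
  have [xi|xi] := char_unit i; rewrite xi.
    rewrite -mulrA; case: (munit_diag_le kl i b) => h; first by rewrite h mulr0 scale0r.
    have /(char_below kl i) [+ _] := xb; move=> /(_ h).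
    by rewrite xi => /esym/eqP; rewrite oner_eq0.
  by rewrite -mulrA ((char_below kl i xb).2 xi) munit_idl scale1r.
Qed.

(** A character that vanishes on all diagonal units vanishes on their dense span, hence on [C],
    because it is contractive. *)
Lemma char_level : exists k (i : I k), x (E i i) = 1.
Proof.
case: xG => _ _ _ [a Ca xa] _; apply: contra_notP (negP xa) => hn.
have zero k c : mspan (@diag_rel k) c -> x c = 0.
  move: c => c hc; suff [] : C c /\ x c = 0 by [].
  move: c hc; apply: mspan_ind => [|u v [Cu' hu] [Cv hv]|t i j /eqP <-].
  - by split; [exact: limC0|exact: char0].
  - by split; [exact: limCD|rewrite charD// hu hv addr0].
  - split; first by apply: limCZ; exact: munitC.
    rewrite charZ; last exact: munitC.
    by have [->|xi] := char_unit i; [rewrite mulr0|case: hn; exists k, i].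
apply/eqP/nc_eq0/eqP; rewrite eq_le nc_ge0 andbT; apply/ler_addgt0Pl => e e0; rewrite addr0.
have := Ca; rewrite limCE => /(_ e e0 0%N)[k [c [_ hc ac]]].
have Cc : C c by have [] := char_diag_span hc.
apply: le_trans (ltW ac); rewrite -[x a]subr0 -(zero _ _ hc) -charB//.
by apply: char_le; apply: limCD => //; exact: limCN.
Qed.

End Character.

(* t is the limit of the coefficients of a at the matrix units whose graphs
   contain (x, y). *)
Definition pcoef (x y : U -> K) (a : U) (t : K) : Prop := forall e, 0 < e ->
  exists L, forall l (i j : I l), (L <= l)%N -> x (E i i) = 1 -> y (E j j) = 1 ->
  nrm (E i i * a * E j j - t *: E i j) <= e.

(** * Paths of matrix units and their limit points *)

Section Path.
Variables (k : nat) (r s : forall m, I (m + k)).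

(** Each unit of the path is a summand of the preceding one. The level is written m + k, so that the
    levels of consecutive units differ by a definitional successor. *)
Definition unit_path : Prop := forall m, [/\ E (r m) (s m) != 0,
  E (r m) (r m) * E (r m.+1) (r m.+1) = E (r m.+1) (r m.+1),
  E (s m) (s m) * E (s m.+1) (s m.+1) = E (s m.+1) (s m.+1) &
  E (r m) (s m) * E (s m.+1) (s m.+1) = E (r m.+1) (s m.+1)].

Hypothesis rs : unit_path.
Let lev m p : (m <= p)%N -> (m + k <= p + k)%N. Proof. by rewrite leq_add2r. Qed.

Lemma path_r m p : (m <= p)%N -> E (r m) (r m) * E (r p) (r p) = E (r p) (r p).
Proof.
move=> /subnK <-; elim: (p - m)%N => [|q IH]; first by rewrite add0n munit_idl.
by have [_ <- _ _] := rs (q + m); rewrite mulrA IH.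
Qed.

Lemma path_s m p : (m <= p)%N -> E (s m) (s m) * E (s p) (s p) = E (s p) (s p).
Proof.
move=> /subnK <-; elim: (p - m)%N => [|q IH]; first by rewrite add0n munit_idl.
by have [_ _ <- _] := rs (q + m); rewrite mulrA IH.
Qed.

Lemma path_rs m p : (m <= p)%N -> E (r m) (s m) * E (s p) (s p) = E (r p) (s p).
Proof.
move=> /subnK <-; elim: (p - m)%N => [|q IH]; first by rewrite add0n munit_idr.
by have [_ _ h3 h4] := rs (q + m); rewrite -h3 mulrA IH.
Qed.

Lemma path_neq0 m : E (r m) (s m) != 0. Proof. by have [] := rs m. Qed.

Lemma path_rsl m p : (m <= p)%N -> E (r p) (r p) * E (r m) (s m) = E (r p) (s p).
Proof.
move=> mp; case: (munit_refine_lel (lev mp) (r m) (s m) (r p)) => [h|[b rb h]].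
  have := path_rs mp; rewrite -[in RHS](munit_idl (r p) (s p)) -(path_rs mp) mulrA h mul0r => h0.
  by have := path_neq0 p; rewrite -(path_rs mp) h0 eqxx.
have := congr1 (fun z => z * E (s p) (s p)) h; rewrite -mulrA path_rs// munit_idl.
have [bs|bs] := eqVneq b (s p); first by rewrite h bs.
by rewrite munit_mul0// => h0; have := path_neq0 p; rewrite h0 eqxx.
Qed.

Definition path_coef (a : U) (t : K) : Prop := forall e, 0 < e ->
  exists M, forall m, (M <= m)%N -> nrm (E (r m) (r m) * a * E (s m) (s m) - t *: E (r m) (s m)) <= e.

Lemma nrm_cut a l (i j : I l) : nrm (E i i * a * E j j) <= nrm a.
Proof.
apply: le_trans (nrmM _ _) _; have h1 := nrmM (E i i) a.
have := nrm_munit i i; have := nrm_munit j j; have := nrm_ge0 (E i i * a).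
have := nrm_ge0 a; have := nrm_ge0 (E j j); have := nrm_ge0 (E i i); nra.
Qed.

(** The coefficient is the one at the path's unit of level m; all later units of the path are cut
    out of that unit. *)
Lemma path_coef_span m a : mspan (@full_rel (m + k)) a -> exists t, forall p, (m <= p)%N ->
  E (r p) (r p) * a * E (s p) (s p) = t *: E (r p) (s p).
Proof.
move=> [l [_ aE]]; exists (l (r m) (s m)) => p mp; have h := mspan_coef (r m) (s m) aE.
have rr : E (r p) (r p) * E (r m) (r m) = E (r p) (r p).
  by rewrite -(munit_diagC (lev mp)) path_r.
rewrite -(path_s mp) mulrA -(mulrA _ a) -{1}rr -!mulrA (mulrA (E (r m) (r m))) (mulrA _ (E (s m) (s m))).
by rewrite h -scalerAl -scalerAr path_rs// munit_idl.
Qed.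

Lemma path_coef_uniq a t t' : path_coef a t -> path_coef a t' -> t = t'.
Proof.
move=> h h'; apply/eqP; rewrite -subr_eq0; apply/eqP/nc_eq0/eqP.
rewrite eq_le nc_ge0 andbT; apply/ler_addgt0Pl => e e0; rewrite addr0.
have e2 : 0 < e / 2 by lra.
have [M hM] := h _ e2; have [M' hM'] := h' _ e2.
have h1 := hM (maxn M M') (leq_maxl _ _); have h2 := hM' (maxn M M') (leq_maxr _ _).
set m := maxn M M' in h1 h2; set X := E (r m) (r m) * a * _ in h1 h2.
have := nrmB (X - t' *: E (r m) (s m)) (X - t *: E (r m) (s m)).
rewrite opprB addrC addrA subrK -scalerBl nrmZ nrm_munit1 ?path_neq0// mulr1; lra.
Qed.

Lemma path_coefD a b t u : path_coef a t -> path_coef b u -> path_coef (a + b) (t + u).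
Proof.
move=> h h' e e0; have e2 : 0 < e / 2 by lra.
have [M hM] := h _ e2; have [M' hM'] := h' _ e2.
exists (maxn M M') => m; rewrite geq_max => /andP[/hM h1 /hM' h2].
rewrite mulrDr mulrDl scalerDl opprD addrACA; apply: le_trans (nrmD _ _) _; lra.
Qed.

Lemma path_coefZ c a t : path_coef a t -> path_coef (c *: a) (c * t).
Proof.
move=> h e e0; have c1 : 0 < nc c + 1 by have := nc_ge0 c; lra.
have [M hM] := h _ (divr_gt0 e0 c1); exists M => m /hM h1.
rewrite -scalerAr -scalerAl -scalerA -scalerBr nrmZ.
rewrite ler_pdivlMr// in h1; have := nc_ge0 c; set X := nrm _ in h1 *.
have : 0 <= X by exact: nrm_ge0. nra.
Qed.

(** Compressions are contractive and the units of the path have norm 1, so the coefficients of a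
    convergent sequence of approximants form a Cauchy sequence. *)
Lemma path_coef_ex a : B a -> exists t, path_coef a t.
Proof.
rewrite limBE => hB.
(* The triple consists of an index on the path, an approximant of a, and the coefficient that the
   approximant keeps from that index on. *)
have /choice[f hf] : forall n : nat, exists q : nat * (U * K), nrm (a - q.2.1) < n.+1%:R^-1 /\
    forall p, (q.1 <= p)%N -> E (r p) (r p) * q.2.1 * E (s p) (s p) = q.2.2 *: E (r p) (s p).
  move=> n; have n0 : 0 < (n.+1%:R^-1 : R) by rewrite invr_gt0 ltr0n.
  have [l [y [kl hy ay]]] := hB _ n0 k.
  have hy' : mspan (@full_rel (l - k + k)) y by apply: mspan_full_le hy; rewrite subnK.
  by have [t ht] := path_coef_span hy'; exists ((l - k)%N, (y, t)).
pose t n := (f n).2.2; pose y n := (f n).2.1.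
have ty n e : n.+1%:R^-1 <= e -> nrm (a - y n) < e.
  by move=> ne; apply: lt_le_trans ne; have [] := hf n.
have tt n m : nc (t n - t m) <= nrm (y n - y m).
  pose p := maxn (f n).1 (f m).1.
  have h1 := (hf n).2 p (leq_maxl _ _); have h2 := (hf m).2 p (leq_maxr _ _).
  have : nrm (E (r p) (r p) * (y n - y m) * E (s p) (s p)) <= nrm (y n - y m) by exact: nrm_cut.
  by rewrite mulrBr mulrBl h1 h2 -scalerBl nrmZ nrm_munit1 ?path_neq0// mulr1.
have inv (e : R) : 0 < e -> exists N : nat, forall n, (N <= n)%N -> n.+1%:R^-1 <= e.
  move=> e0; pose N := Num.bound (e^-1 : R); exists N => n Nn.
  have : e^-1 < N%:R by apply: archi_boundP; rewrite invr_ge0 ltW.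
  move=> h; rewrite -[leRHS]invrK lef_pV2 ?posrE ?invr_gt0 ?ltr0n//.
  by apply: le_trans (ltW h) _; rewrite ler_nat ltnW.
have [|z hz] := @nc_complete R t.
  move=> e e0; have e2 : 0 < e / 2 by lra.
  have [N hN] := inv _ e2; exists N => n m /hN h1 /hN h2.
  apply: le_lt_trans (tt n m) _; have := nrm_dist (y n) a (y m); rewrite (nrm_distC (y n) a).
  have := ty n _ h1; have := ty m _ h2; lra.
exists z => e e0; have e2 : 0 < e / 2 by lra.
have [N hN] := inv _ e2; have [N' hN'] := hz _ e2.
pose n := maxn N N'; have h1 := ty n _ (hN n (leq_maxl _ _)).
have h2 := hN' n (leq_maxr _ _).
exists (f n).1 => m /(hf n).2; rewrite -/(y n) -/(t n) => h3.
have -> : E (r m) (r m) * a * E (s m) (s m) - z *: E (r m) (s m) =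
   E (r m) (r m) * (a - y n) * E (s m) (s m) + (t n - z) *: E (r m) (s m).
  by rewrite mulrBr mulrBl h3 scalerBl addrA subrK.
apply: le_trans (nrmD _ _) _; rewrite nrmZ nrm_munit1 ?path_neq0// mulr1.
have := nrm_cut (a - y n) (r m) (s m); lra.
Qed.

End Path.

Section PathCharacter.
Variables (k : nat) (r : forall m, I (m + k)).
Hypothesis rr : unit_path r r.

(** Elements of [C] commute with the diagonal units, so the compression of a product is the product
    of the compressions. *)
Lemma path_coefM a b t u : C a -> C b -> path_coef r r a t -> path_coef r r b u -> path_coef r r (a * b) (t * u).
Proof.
move=> Ca Cb ha hb e e0.
have s0 : 0 < nrm a + nc u + 1 by have := nrm_ge0 a; have := nc_ge0 u; lra.
have [M hM] := ha _ (divr_gt0 e0 s0); have [M' hM'] := hb _ (divr_gt0 e0 s0).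
exists (maxn M M') => m; rewrite geq_max => /andP[/hM h1 /hM' h2].
set e' := E (r m) (r m) in h1 h2 *.
have ee : e' * e' = e' by rewrite munit_idl.
have ae : a * e' = e' * a by apply: limC_comm => //; exact: munitC.
rewrite !ler_pdivlMr// in h1 h2.
have -> : e' * (a * b) * e' - (t * u) *: e' =
   e' * a * e' * (e' * b * e' - u *: e') + u *: (e' * a * e' - t *: e').
  rewrite mulrBr scalerBr scalerA (mulrC u) addrA; congr (_ - _).
  rewrite -scalerAr -(mulrA (e' * a) e' e') ee subrK !mulrA.
  by rewrite -(mulrA (e' * a) e' e') ee -(mulrA e' a e') ae (mulrA e' e') ee.
apply: le_trans (nrmD _ _) _; rewrite nrmZ.
have := nrmM (e' * a * e') (e' * b * e' - u *: e').
have := nrm_cut a (r m) (r m); rewrite -/e'.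
have := nrm_ge0 a; have := nc_ge0 u.
have := nrm_ge0 (e' * a * e'); have := nrm_ge0 (e' * b * e' - u *: e').
have := nrm_ge0 (e' * a * e' - t *: e').
set X := nrm (e' * a * e'); set Y := nrm (e' * b * e' - _) in h2 *; set Z := nrm (_ - t *: e') in h1 *.
nra.
Qed.

(** The point of the Gelfand space on which all diagonal units of the path take the value 1. Outside
    [C] it is 0, as [gelfand_space] demands. *)
Definition path_char (c : U) : K := if pselect (C c) then xget 0 (path_coef r r c) else 0.

Lemma path_charP c : C c -> path_coef r r c (path_char c).
Proof.
move=> Cc; rewrite /path_char; case: (pselect (C c)) => //= _.
by have [t ht] := path_coef_ex rr (limCB Cc); exact: (xgetPex 0 (ex_intro _ t ht)).
Qed.

Lemma path_charE c t : C c -> path_coef r r c t -> path_char c = t.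
Proof. by move=> Cc; apply: (path_coef_uniq rr); exact: path_charP. Qed.

Lemma path_char_unit m : path_char (E (r m) (r m)) = 1.
Proof.
apply: path_charE; first exact: munitC.
move=> e e0; exists m => p mp.
have -> : E (r p) (r p) * E (r m) (r m) * E (r p) (r p) = E (r p) (r p).
  by rewrite -mulrA (path_r rr)// munit_idl.
by rewrite scale1r subrr nrm0 ltW.
Qed.

Lemma path_char_gelfand : gelfand path_char.
Proof.
split.
- move=> a b Ca Cb; apply: path_charE; first exact: limCD.
  by apply: path_coefD; exact: path_charP.
- move=> c a Ca; apply: path_charE; first exact: limCZ.
  by apply: path_coefZ; exact: path_charP.
- move=> a b Ca Cb; apply: path_charE; first exact: limCM.
  by apply: path_coefM => //; exact: path_charP.
- by exists (E (r 0%N) (r 0%N)); [exact: munitC|rewrite path_char_unit oner_neq0].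
- by move=> a nC; rewrite /path_char; case: (pselect (C a)).
Qed.
End PathCharacter.

Lemma unit_path_l k (r s : forall m, I (m + k)) : unit_path r s -> unit_path r r.
Proof. by move=> h m; have [_ h2 _ _] := h m; split=> //; exact: munit_diag. Qed.
Lemma unit_path_r k (r s : forall m, I (m + k)) : unit_path r s -> unit_path s s.
Proof. by move=> h m; have [_ _ h2 _] := h m; split=> //; exact: munit_diag. Qed.

(** After compression to a later level p of the path, conjugation by [E (r m) (s m)] becomes
    conjugation by [E (r p) (s p)], which carries the coefficient at [s p] to the one at [r p]. *)
Lemma path_graph k (r s : forall m, I (m + k)) (rs : unit_path r s) m :
  unit_graph iota (E (r m) (s m)) (path_char r, path_char s).
Proof.
have rr := unit_path_l rs; have ss := unit_path_r rs.
split=> /=; [exact: path_char_gelfand|exact: path_char_gelfand| |].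
  rewrite munit_star munit_starl 1?munit_sym ?path_neq0//; exact: path_char_unit.
move=> c Cc; rewrite munit_star; apply: path_charE => //; first exact: limC_conj.
move=> e e0; have [M hM] := path_charP ss Cc e0; exists (maxn M m) => p.
rewrite geq_max => /andP[/hM h1 mp]; apply: le_trans h1.
have e1 := path_rsl rs mp.
have e2 : E (s m) (r m) * E (r p) (r p) = E (s p) (r p).
  by rewrite -[RHS]munit_star -e1 starM !munit_star.
have -> : E (r p) (r p) * (E (r m) (s m) * c * E (s m) (r m)) * E (r p) (r p) -
    path_char s c *: E (r p) (r p) =
    E (r p) (s p) * (E (s p) (s p) * c * E (s p) (s p) - path_char s c *: E (s p) (s p)) * E (s p) (r p).
  rewrite mulrBr mulrBl -scalerAr -scalerAl munit_idr munit_starl ?path_neq0//.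
  by rewrite !mulrA e1 -mulrA e2 munit_idr -(mulrA _ (E (s p) (s p))) munit_idl.
apply: le_trans (nrmM _ _) _; set X := _ - _.
have := nrmM (E (r p) (s p)) X; have := nrm_munit (r p) (s p); have := nrm_munit (s p) (r p).
have := nrm_ge0 X; have := nrm_ge0 (E (r p) (s p)); have := nrm_ge0 (E (s p) (r p)).
have := nrm_ge0 (E (r p) (s p) * X); nra.
Qed.

Local Notation graph k i j := (unit_graph iota (@munit k i j)).

(** * Coefficients at the points of the spectrum *)

Section Graph.
Variables (x y : U -> K).

Lemma graph_units k (i j : I k) : graph k i j (x, y) ->
  [/\ gelfand x, gelfand y, x (E i i) = 1, y (E j j) = 1 & E i j != 0].
Proof.
move=> [/= Gx Gy y1 xy].
have e0 : E i j != 0.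
  apply: contra_eq_neq y1 => ->; rewrite mulr0 (char0 Gy) eq_sym oner_neq0//.
rewrite munit_star munit_starl 1?munit_sym// in y1; split=> //.
by rewrite -y1 -xy ?munit_star ?munit_idr ?munit_starl//; exact: munitC.
Qed.

(** The character y selects j' under j at level l, the refinement of [E i j] at j' supplies i', and
    x, being the image of y, takes the value 1 there. *)
Lemma graph_step k l (kl : (k <= l)%N) (i j : I k) : graph k i j (x, y) ->
  exists i' j' : I l, [/\ E i' j' != 0, E i j * E j' j' = E i' j', E i i * E i' i' = E i' i',
     E j j * E j' j' = E j' j' & graph l i' j' (x, y)].
Proof.
move=> g; have [Gx Gy xi yj e0] := graph_units g.
have [_ _ _ /= xy] := g.
have [j' yj'] := char_step Gy kl yj.
have jj : E j j * E j' j' = E j' j' by exact/(char_below Gy kl).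
have ej' : E i j * E j' j' != 0.
  apply/eqP => h; have := munit_diag j'; rewrite -jj -(munit_starl (i := j) (j := i)) 1?munit_sym//.
  by rewrite -mulrA h mulr0 eqxx.
case: (munit_refine_le kl i j j') => [h|[i' e' h]]; first by rewrite h eqxx in ej'.
have h2 : E j' j' * E j i = E j' i' by rewrite -[RHS]munit_star -h starM !munit_star.
have xi' : x (E i' i') = 1.
  rewrite -yj' -xy; last exact: munitC.
  by rewrite munit_star -(munit_idl j' j') mulrA -mulrA h h2 munit_starl.
exists i', j'; split=> //; first exact/(char_below Gx kl).
split=> //=; first by rewrite munit_star munit_starl 1?munit_sym.
move=> c Cc; rewrite munit_star -h -h2 !mulrA.
have -> : E i j * E j' j' * c * E j' j' * E j i = E i j * (E j' j' * c * E j' j') * star (E i j).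
  by rewrite munit_star !mulrA.
have Cj : C (E j' j') by exact: munitC.
rewrite xy; last by do 2?apply: limCM.
by rewrite !(charM Gy)//; [rewrite yj' mul1r mulr1|exact: limCM].
Qed.

Lemma graph_up k l (kl : (k <= l)%N) (i j : I k) (i' j' : I l) : E i' j' != 0 ->
  E i j * E j' j' = E i' j' -> graph l i' j' (x, y) -> graph k i j (x, y).
Proof.
move=> e' h g; have [Gx Gy xi yj _] := graph_units g; have [_ _ _ /= xy] := g.
have e0 : E i j != 0 by apply: contraNneq e' => e; rewrite -h e mul0r.
have jj : E j j * E j' j' = E j' j'.
  case: (munit_diag_le kl j j') => // h0; move: e'.
  by rewrite -h -(munit_idr i j) -mulrA h0 mulr0 eqxx.
have h2 : E j' j' * E j i = E j' i' by rewrite -[RHS]munit_star -h starM !munit_star.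
have ii : E i' i' * E i j = E i' j'.
  have [b rb h3] : exists2 b, E i' b != 0 & E i' i' * E i j = E i' b.
    case: (munit_refine_lel kl i j i') => // h3.
    by move: e'; rewrite -(munit_idl i' j') -h mulrA h3 mul0r eqxx.
  have [bj|bj] := eqVneq b j'; first by rewrite h3 bj.
  by move: e'; rewrite -(munit_idl i' j') -h mulrA h3 munit_mul0// eqxx.
have ii2 : E j i * E i' i' = E j' i'.
  by rewrite -[RHS]munit_star -ii starM !munit_star.
split=> //=; first by rewrite munit_star munit_starl 1?munit_sym//; exact: (char_below Gy kl j yj).1.
move=> c Cc; rewrite -xy// !munit_star.
have Ci : C (E i' i') by exact: munitC.
have Cc' : C (E i j * c * E j i) by exact: limC_conj.
have -> : E i' j' * c * E j' i' = E i' i' * (E i j * c * E j i) * E i' i'.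
  by rewrite -ii -ii2 !mulrA.
have C2 : C (E i' i' * (E i j * c * E j i)) by exact: limCM.
by rewrite (charM Gx C2 Ci) (charM Gx Ci Cc') xi mul1r mulr1.
Qed.

Lemma graph_uniq k (i j i' j' : I k) : graph k i j (x, y) -> graph k i' j' (x, y) -> i = i' /\ j = j'.
Proof.
move=> /graph_units[Gx Gy xi yj _] /graph_units[_ _ xi' yj' _].
by rewrite (char_uniq Gx xi xi') (char_uniq Gy yj yj').
Qed.

Lemma graph_path k (i j : I k) : graph k i j (x, y) -> exists r s : forall m, I (m + k),
  unit_path r s /\ forall m, graph (m + k) (r m) (s m) (x, y).
Proof.
move=> g.
have h m : exists q : I (m + k) * I (m + k), graph (m + k) q.1 q.2 (x, y).
  by have [i' [j' [_ _ _ _ h]]] := graph_step (leq_addl m k) g; exists (i', j').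
pose f m := projT1 (cid (h m)).
have hf m : graph (m + k) (f m).1 (f m).2 (x, y) := projT2 (cid (h m)).
exists (fun m => (f m).1), (fun m => (f m).2); split; last by move=> m; exact: hf.
move=> m; have [_ _ _ _ e0] := graph_units (hf m).
have [i' [j' [e1 e2 e3 e4 e5]]] := graph_step (leqnSn (m + k)) (hf m).
by have [<- <-] := graph_uniq e5 (hf m.+1); split.
Qed.

Lemma pcoef_path k (r s : forall m, I (m + k)) a t :
  (forall m, graph (m + k) (r m) (s m) (x, y)) -> path_coef r s a t -> pcoef x y a t.
Proof.
move=> g h e e0; have [M hM] := h e e0; exists (M + k)%N => l i j.
move=> Ml; have kl : (k <= l)%N by apply: leq_trans Ml; exact: leq_addl.
have Ml' : (M <= l - k)%N by rewrite leq_subRL// addnC.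
move: i j; rewrite -(subnK kl) => i j xi yj.
have [Gx Gy xi' yj' _] := graph_units (g (l - k)%N).
by rewrite (char_uniq Gx xi xi') (char_uniq Gy yj yj'); exact: hM.
Qed.

Lemma pcoef_ex k (i j : I k) a : graph k i j (x, y) -> B a -> exists t, pcoef x y a t.
Proof.
move=> g Ba; have [r [s [rs h]]] := graph_path g.
by have [t ht] := path_coef_ex rs Ba; exists t; exact: pcoef_path ht.
Qed.

(** The graph provides, at every deep level, a nonzero unit through (x, y). Such a unit has norm 1,
    so it separates two candidate coefficients. *)
Lemma pcoef_uniq k (i j : I k) a t t' : graph k i j (x, y) -> pcoef x y a t -> pcoef x y a t' -> t = t'.
Proof.
move=> g h h'; apply/eqP; rewrite -subr_eq0; apply/eqP/nc_eq0/eqP.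
rewrite eq_le nc_ge0 andbT; apply/ler_addgt0Pl => e e0; rewrite addr0.
have e2 : 0 < e / 2 by lra.
have [M hM] := h _ e2; have [M' hM'] := h' _ e2.
pose l := maxn k (maxn M M').
have Ml : (M <= l)%N by rewrite /l !leq_max leqnn orbT.
have Ml' : (M' <= l)%N by rewrite /l !leq_max leqnn !orbT.
have [i' [j' [e' _ _ _ /graph_units[_ _ xi yj _]]]] := graph_step (leq_maxl k (maxn M M')) g.
have h1 := hM l i' j' Ml xi yj; have h2 := hM' l i' j' Ml' xi yj.
set X := E i' i' * a * _ in h1 h2.
have := nrmB (X - t' *: E i' j') (X - t *: E i' j').
rewrite opprB addrC addrA subrK -scalerBl nrmZ nrm_munit1// mulr1; lra.
Qed.

Lemma pcoefD a b t u : pcoef x y a t -> pcoef x y b u -> pcoef x y (a + b) (t + u).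
Proof.
move=> h h' e e0; have e2 : 0 < e / 2 by lra.
have [M hM] := h _ e2; have [M' hM'] := h' _ e2.
exists (maxn M M') => l i j; rewrite geq_max => /andP[Ml Ml'] xi yj.
have h1 := hM l i j Ml xi yj; have h2 := hM' l i j Ml' xi yj.
rewrite mulrDr mulrDl scalerDl opprD addrACA; apply: le_trans (nrmD _ _) _; lra.
Qed.

Lemma pcoef0 : pcoef x y 0 0.
Proof.
move=> e e0; exists 0%N => l i j _ _ _.
by rewrite mulr0 mul0r scale0r subrr nrm0 ltW.
Qed.

Lemma pcoef_sum J (r : seq J) (F : J -> U) (G : J -> K) :
  (forall i, pcoef x y (F i) (G i)) -> pcoef x y (\sum_(i <- r) F i) (\sum_(i <- r) G i).
Proof.
move=> h; elim: r => [|i r IH]; first by rewrite !big_nil; exact: pcoef0.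
by rewrite !big_cons; exact: pcoefD.
Qed.

(** A factor in [Cu] commutes with the diagonal units, so the compressed product involves no
    intermediate index and coefficients simply multiply. *)
Lemma pcoef_mull z a t u : Cu z -> pcoef x x z t -> pcoef x y a u -> pcoef x y (z * a) (t * u).
Proof.
move=> Cz hz ha e e0.
have s0 : 0 < nrm a + nc t + 1 by have := nrm_ge0 a; have := nc_ge0 t; lra.
have [M hM] := hz _ (divr_gt0 e0 s0); have [M' hM'] := ha _ (divr_gt0 e0 s0).
exists (maxn M M') => l i j; rewrite geq_max => /andP[Ml Ml'] xi yj.
have h1 := hM l i i Ml xi xi; have h2 := hM' l i j Ml' xi yj.
rewrite !ler_pdivlMr// in h1 h2.
have zE : z * E i i = E i i * z by apply: limCu_comm => //; exact: munitC.
have -> : E i i * (z * a) * E j j - (t * u) *: E i j =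
    (E i i * z * E i i - t *: E i i) * (E i i * a * E j j) + t *: (E i i * a * E j j - u *: E i j).
  rewrite mulrBl scalerBr scalerA addrA; congr (_ - _).
  rewrite -scalerAl !mulrA munit_idl subrK -(mulrA _ (E i i) (E i i)) munit_idl.
  by rewrite -(mulrA (E i i) z (E i i)) zE (mulrA (E i i) (E i i)) munit_idl.
apply: le_trans (nrmD _ _) _; rewrite nrmZ.
set X := _ - t *: _ in h1 *; set Y := _ - u *: _ in h2 *.
have := nrmM X (E i i * a * E j j); have := nrm_cut a i j.
have := nrm_ge0 a; have := nc_ge0 t; have := nrm_ge0 X; have := nrm_ge0 Y.
have := nrm_ge0 (E i i * a * E j j); nra.
Qed.

Lemma pcoef_mulr z a t u : Cu z -> pcoef x y a u -> pcoef y y z t -> pcoef x y (a * z) (u * t).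
Proof.
move=> Cz ha hz e e0.
have s0 : 0 < nrm a + nc t + 1 by have := nrm_ge0 a; have := nc_ge0 t; lra.
have [M hM] := hz _ (divr_gt0 e0 s0); have [M' hM'] := ha _ (divr_gt0 e0 s0).
exists (maxn M M') => l i j; rewrite geq_max => /andP[Ml Ml'] xi yj.
have h1 := hM l j j Ml yj yj; have h2 := hM' l i j Ml' xi yj.
rewrite !ler_pdivlMr// in h1 h2.
have zE : z * E j j = E j j * z by apply: limCu_comm => //; exact: munitC.
have -> : E i i * (a * z) * E j j - (u * t) *: E i j =
    (E i i * a * E j j) * (E j j * z * E j j - t *: E j j) + t *: (E i i * a * E j j - u *: E i j).
  rewrite mulrBr scalerBr scalerA (mulrC u) addrA; congr (_ - _).
  rewrite -scalerAr -(mulrA _ (E j j) (E j j)) munit_idl subrK.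
  rewrite -(mulrA (E j j) z) zE (mulrA (E j j)) munit_idl.
  by rewrite (mulrA (E i i * a * E j j)) -(mulrA _ (E j j) (E j j)) munit_idl -(mulrA (E i i * a)) -zE !mulrA.
apply: le_trans (nrmD _ _) _; rewrite nrmZ.
set X := _ - t *: _ in h1 *; set Y := _ - u *: _ in h2 *.
have := nrmM (E i i * a * E j j) X; have := nrm_cut a i j.
have := nrm_ge0 a; have := nc_ge0 t; have := nrm_ge0 X; have := nrm_ge0 Y.
have := nrm_ge0 (E i i * a * E j j); nra.
Qed.

End Graph.

Lemma char_coef x c : gelfand x -> C c -> pcoef x x c (x c).
Proof.
move=> Gx Cc e e0; have e2 : 0 < e / 2 by lra.
have := Cc; rewrite limCE => /(_ _ e2 0%N)[k [d [_ hd cd]]].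
have [Cd dE] := char_diag_span Gx hd.
exists k => l i j kl xi xj; have ij := char_uniq Gx xi xj; subst j.
have -> : E i i * c * E i i - x c *: E i i = E i i * (c - d) * E i i - x (c - d) *: E i i.
  by rewrite mulrBr mulrBl (dE l i kl xi) charB// scalerBl opprB addrA subrK.
apply: le_trans (nrmB _ _) _; rewrite nrmZ nrm_munit1 ?munit_diag// mulr1.
have := nrm_cut (c - d) i i; have := char_le Gx (limCD Cc (limCN Cd)); lra.
Qed.

Lemma Cu_coef x z : gelfand x -> Cu z -> exists t, pcoef x x z t.
Proof.
move=> Gx [c Cc [t ->]]; exists (x c + t); apply: pcoefD; first exact: char_coef.
move=> e e0; exists 0%N => l i j _ xi xj; rewrite (char_uniq Gx xi xj).
by rewrite -scalerAr mulr1 -scalerAl munit_idl subrr nrm0 ltW.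
Qed.

Definition mcoef n x y (v : 'M[U]_n) (V : 'M[K]_n) := forall i j, pcoef x y (v i j) (V i j).

Section Mcoef.
Variables (n : nat) (x y : U -> K).

Lemma mcoef_ex k (i j : I k) (v : 'M[U]_n) : graph k i j (x, y) -> Mset A v -> exists V, mcoef x y v V.
Proof.
move=> g Av; have /choice[f hf] : forall q : 'I_n * 'I_n, exists t, pcoef x y (v q.1 q.2) t.
  by move=> q; apply: (pcoef_ex g); exact: limAB.
by exists (\matrix_(a, b) f (a, b)) => a b; rewrite mxE; exact: (hf (a, b)).
Qed.

Lemma mcoef_Cu (v : 'M[U]_n) : gelfand x -> Mset Cu v -> exists V, mcoef x x v V.
Proof.
move=> g Av; have /choice[f hf] : forall q : 'I_n * 'I_n, exists t, pcoef x x (v q.1 q.2) t.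
  by move=> q; exact: Cu_coef.
by exists (\matrix_(a, b) f (a, b)) => a b; rewrite mxE; exact: (hf (a, b)).
Qed.

Lemma mcoef_uniq k (i j : I k) (v : 'M[U]_n) V W : graph k i j (x, y) ->
  mcoef x y v V -> mcoef x y v W -> V = W.
Proof. by move=> g hV hW; apply/matrixP => a b; exact: (pcoef_uniq g (hV a b) (hW a b)). Qed.

Lemma mcoefMl (z v : 'M[U]_n) Z V : Mset Cu z -> mcoef x x z Z -> mcoef x y v V ->
  mcoef x y (z *m v) (Z *m V).
Proof.
by move=> Cz hz hv i j; rewrite !mxE; apply: pcoef_sum => k; exact: pcoef_mull.
Qed.

Lemma mcoefMr (z v : 'M[U]_n) Z V : Mset Cu z -> mcoef x y v V -> mcoef y y z Z ->
  mcoef x y (v *m z) (V *m Z).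
Proof.
by move=> Cz hv hz i j; rewrite !mxE; apply: pcoef_sum => k; exact: pcoef_mulr.
Qed.

Lemma mcoef1 : gelfand x -> mcoef x x (1%:M : 'M[U]_n) 1%:M.
Proof.
move=> Gx i j; rewrite !mxE; case: (i == j) => /=; last exact: pcoef0.
move=> e e0; exists 0%N => l a b _ xa xb; rewrite (char_uniq Gx xa xb).
by rewrite mulr1 munit_idl scale1r subrr nrm0 ltW.
Qed.
End Mcoef.

Local Notation "a %:S" := (scalar_mx a) (at level 1, format "a %:S").
Local Notation NP := (normalising_pisometry A C).
Local Notation DG := (dim_group A C).

(** * Classes of normalising partial isometries *)

Definition dg_pi (x : {freeg (Pi A C) / int}) : DG := (\pi_(Quotient.quot (@pi_relations _ U A C)) x)%qT.

Lemma dg_piD x y : dg_pi (x + y) = dg_pi x + dg_pi y.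
Proof. by rewrite /dg_pi !piE. Qed.
Lemma dg_piN x : dg_pi (- x) = - dg_pi x.
Proof. by rewrite /dg_pi !piE. Qed.
Lemma dg_pi_surj g : exists x, dg_pi x = g.
Proof. by exists (repr (g : Quotient.quot (@pi_relations _ U A C))); rewrite /dg_pi reprK. Qed.
Lemma dg_pi_rel x y : (x - y) \in @pi_relations _ U A C -> dg_pi x = dg_pi y.
Proof. by move=> h; apply/eqP; rewrite /dg_pi -Quotient.idealrBE. Qed.
Lemma dg_pi_relE x y : dg_pi x = dg_pi y -> (x - y) \in @pi_relations _ U A C.
Proof. by move=> h; rewrite Quotient.idealrBE; apply/eqP. Qed.

Lemma pi_relator_in x : pi_relator x -> x \in @pi_relations _ U A C.
Proof. by move=> h; apply/asboolP; exact: sub_gen_smallest. Qed.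

Definition pi_of n (v : 'M[U]_n) (h : NP v) : Pi A C :=
  exist _ (existT _ n v) (introT (asboolP (NP v)) h).

(* The junk value is 0 when v is not a normalising partial isometry. *)
Definition dg_class n (v : 'M[U]_n) : DG :=
  if pselect (NP v) is left h then dg_pi <<pi_of h>> else 0.

Lemma dg_classE n (v : 'M[U]_n) (h : NP v) : dg_class v = dg_pi <<pi_of h>>.
Proof.
rewrite /dg_class; case: (pselect (NP v)) => // h'.
by rewrite (Prop_irrelevance h' h).
Qed.

Lemma dg_class_Pi (v : Pi A C) : dg_pi <<v>> = dg_class (pi_mx v).
Proof.
have h : NP (pi_mx v) by case: v => w; exact: asboolW.
rewrite (dg_classE h); congr (dg_pi << _ >>); apply: val_inj => /=.
by case: v {h} => [[m w] hw].
Qed.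

Lemma dg_class_equiv n m (v : 'M[U]_n) (w : 'M[U]_m) : NP v -> NP w -> pi_equiv A C v w ->
  dg_class v = dg_class w.
Proof.
move=> hv hw vw; rewrite (dg_classE hv) (dg_classE hw); apply: dg_pi_rel.
by apply: pi_relator_in; left; exists (pi_of hv), (pi_of hw).
Qed.

Lemma dg_class_dsum n m (v : 'M[U]_n) (w : 'M[U]_m) : NP v -> NP w ->
  NP (block_mx v 0 0 w) -> dg_class (block_mx v 0 0 w) = dg_class v + dg_class w.
Proof.
move=> hv hw hs; rewrite (dg_classE hv) (dg_classE hw) (dg_classE hs) -dg_piD.
apply/esym/dg_pi_rel/pi_relator_in; right.
by exists (pi_of hv), (pi_of hw), (pi_of hs).
Qed.

(** Both products are self-adjoint matrices over [A], so the adjoint of each entry is again an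
    entry, and the TAF condition applies. *)
Lemma NP_starC n (v : 'M[U]_n) : NP v -> Mset C (mxstar v *m v) /\ Mset C (v *m mxstar v).
Proof.
move=> [_ _ h1 h2 _]; split=> i j; (apply: limA_starC; first by []).
  by rewrite -mxstarE mxstarM mxstarK.
by rewrite -mxstarE mxstarM mxstarK.
Qed.

Lemma NP_intro n (v : 'M[U]_n) : Mset A v -> v *m mxstar v *m v = v ->
  Mset C (mxstar v *m v) -> Mset C (v *m mxstar v) ->
  (forall c, Mset C c -> Mset C (v *m c *m mxstar v)) ->
  (forall c, Mset C c -> Mset C (mxstar v *m c *m v)) -> NP v.
Proof.
move=> Av vv c1 c2 h1 h2; split=> //; [exact: MsetCA|exact: MsetCA|].
by move=> c cC; split; [exact: h1|exact: h2].
Qed.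

Lemma pisom_star n (v : 'M[U]_n) : v *m mxstar v *m v = v -> mxstar v *m v *m mxstar v = mxstar v.
Proof. by move=> h; rewrite -{4}h !mxstarM mxstarK mulmxA. Qed.

Lemma NP0 n : NP (0 : 'M[U]_n).
Proof.
have C0 : Mset C (0 : 'M[U]_n) by exact: MsetC0.
apply: NP_intro; rewrite ?mul0mx ?mulmx0 ?mxstar0 ?mul0mx//; first exact: MsetCA.
all: by move=> c _; rewrite ?mul0mx ?mulmx0.
Qed.

Section NPCut.
Variables (n : nat) (v : 'M[U]_n).
Hypothesis hv : NP v.
Let vv : v *m mxstar v *m v = v. Proof. by case: hv. Qed.
Let vC := (NP_starC hv).1.
Let vC' := (NP_starC hv).2.
Let vN c : Mset C c -> Mset C (v *m c *m mxstar v).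
Proof. by move=> hc; have [_ _ _ _ h] := hv; exact: (h c hc).1. Qed.
Let vN' c : Mset C c -> Mset C (mxstar v *m c *m v).
Proof. by move=> hc; have [_ _ _ _ h] := hv; exact: (h c hc).2. Qed.

(** Normalisation only speaks of matrices over [C]. Inserting [mxstar v *m v], which commutes with
    e, replaces e by a matrix over [C]; this makes e = 1 - f admissible. *)
Lemma NP_conjCu e : Cu e -> Mset C (v *m e%:S *m mxstar v).
Proof.
move=> Ce; have -> : v *m e%:S *m mxstar v = v *m (e%:S *m (mxstar v *m v)) *m mxstar v.
  by rewrite (scalar_comm Ce vC) !mulmxA vv.
by apply: vN; apply: MsetCuC => //; exact: Mset_scalarCu.
Qed.

Lemma NP_conjCu' e : Cu e -> Mset C (mxstar v *m e%:S *m v).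
Proof.
move=> Ce; have -> : mxstar v *m e%:S *m v = mxstar v *m (e%:S *m (v *m mxstar v)) *m v.
  by rewrite (scalar_comm Ce vC') !mulmxA (pisom_star vv).
by apply: vN'; apply: MsetCuC => //; exact: Mset_scalarCu.
Qed.

Lemma NP_cut g e : Cu g -> Cu e -> g * g = g -> star g = g -> e * e = e -> star e = e ->
  NP (g%:S *m v *m e%:S).
Proof.
move=> Cg Ce gg sg ee se; have Sg := @Mset_scalarCu n _ Cg; have Se := @Mset_scalarCu n _ Ce.
have Av : Mset A v by case: hv.
apply: NP_intro.
- by apply: MsetACu => //; exact: MsetCuA.
- by apply: pisom_cut => // c; exact: vN.
- rewrite !mxstarM !mxstar_scalar sg se -!mulmxA (mulmxA g%:S g%:S) scalarMM gg.
  apply: MsetCuC => //; rewrite !mulmxA; apply: MsetCCu => //; exact: NP_conjCu'.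
- rewrite !mxstarM !mxstar_scalar sg se -!mulmxA (mulmxA e%:S e%:S) scalarMM ee.
  apply: MsetCuC => //; rewrite !mulmxA; apply: MsetCCu => //; exact: NP_conjCu.
- move=> c cC; rewrite !mxstarM !mxstar_scalar sg se.
  have -> : g%:S *m v *m e%:S *m c *m (e%:S *m (mxstar v *m g%:S)) =
     g%:S *m (v *m (e%:S *m c *m e%:S) *m mxstar v) *m g%:S by rewrite !mulmxA.
  apply: MsetCCu => //; apply: MsetCuC => //; apply: vN.
  by apply: MsetCCu => //; exact: MsetCuC.
- move=> c cC; rewrite !mxstarM !mxstar_scalar sg se.
  have -> : e%:S *m (mxstar v *m g%:S) *m c *m (g%:S *m v *m e%:S) =
     e%:S *m (mxstar v *m (g%:S *m c *m g%:S) *m v) *m e%:S by rewrite !mulmxA.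
  apply: MsetCCu => //; apply: MsetCuC => //; apply: vN'.
  by apply: MsetCCu => //; exact: MsetCuC.
Qed.
End NPCut.

Lemma Mset_block (F : set U) n m (a : 'M[U]_n) (b : 'M_(n, m)) (c : 'M_(m, n)) (d : 'M[U]_m) :
  (forall i j, F (a i j)) -> (forall i j, F (b i j)) -> (forall i j, F (c i j)) ->
  (forall i j, F (d i j)) -> Mset F (block_mx a b c d).
Proof.
move=> ha hb hc hd i j; rewrite -(splitK i) -(splitK j).
by case: (fintype.split i) => ?; case: (fintype.split j) => ? /=;
  rewrite ?block_mxEul ?block_mxEur ?block_mxEdl ?block_mxEdr.
Qed.

Lemma star0_tr n m : (map_mx (@star _ U) (0 : 'M_(n, m)))^T = 0.
Proof. by apply/matrixP => i j; rewrite !mxE star0. Qed.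

(** Conjugating a full block matrix over [C] by the direct sum yields off-diagonal blocks mixing v
    with w. The two orthogonality conditions say that these vanish. *)
Lemma NP_dsum n (v w : 'M[U]_n) : NP v -> NP w ->
  (forall c, Mset C c -> v *m c *m mxstar w = 0) ->
  (forall c, Mset C c -> mxstar v *m c *m w = 0) -> NP (block_mx v 0 0 w).
Proof.
move=> hv hw h1 h2.
have h1' c : Mset C c -> w *m c *m mxstar v = 0.
  move=> cC; apply: (can_inj (@mxstarK _ U n)); rewrite !mxstarM mxstarK mxstar0 mulmxA.
  by apply: h1; exact: MsetC_star.
have h2' c : Mset C c -> mxstar w *m c *m v = 0.
  move=> cC; apply: (can_inj (@mxstarK _ U n)); rewrite !mxstarM mxstarK mxstar0 mulmxA.
  by apply: h2; exact: MsetC_star.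
have [Av vv _ _ vN] := hv; have [Aw ww _ _ wN] := hw.
have Z (F : set U) : F 0 -> forall i j, F ((0 : 'M[U]_n) i j) by move=> F0 i j; rewrite mxE.
have sb : mxstar (block_mx v 0 0 w) = block_mx (mxstar v) 0 0 (mxstar w).
  by rewrite mxstar_block !star0_tr.
have sub (c : 'M[U]_(n + n)) : Mset C c -> [/\ Mset C (ulsubmx c), Mset C (ursubmx c),
    Mset C (dlsubmx c) & Mset C (drsubmx c)].
  by move=> hc; split=> i j; rewrite !mxE.
apply: NP_intro.
- by apply: Mset_block => //; apply: Z; exact: limA0.
- rewrite sb !mulmx_block !(mul0mx, mulmx0, addr0, add0r) vv ww. by [].
- rewrite sb mulmx_block !(mul0mx, mulmx0, addr0, add0r).
  apply: Mset_block; [exact: (NP_starC hv).1|exact: Z limC0|exact: Z limC0|exact: (NP_starC hw).1].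
- rewrite sb mulmx_block !(mul0mx, mulmx0, addr0, add0r).
  apply: Mset_block; [exact: (NP_starC hv).2|exact: Z limC0|exact: Z limC0|exact: (NP_starC hw).2].
- move=> c /sub[c1 c2 c3 c4]; rewrite sb -{1}(submxK c) !mulmx_block !(mul0mx, mulmx0, addr0, add0r).
  rewrite h1// h1'//; apply: Mset_block; [exact: (vN _ c1).1|exact: Z limC0|exact: Z limC0|exact: (wN _ c4).1].
- move=> c /sub[c1 c2 c3 c4]; rewrite sb -{1}(submxK c) !mulmx_block !(mul0mx, mulmx0, addr0, add0r).
  rewrite h2// h2'//; apply: Mset_block; [exact: (vN _ c1).2|exact: Z limC0|exact: Z limC0|exact: (wN _ c4).2].
Qed.

Lemma corner_id n (v : 'M[U]_n) : corner n v = v.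
Proof. by apply/matrixP => i j; rewrite mxE !valK. Qed.

Lemma corner_dbl n (v : 'M[U]_n) : corner (n + n) v = block_mx v 0 0 0.
Proof.
apply/matrixP => i j; rewrite mxE -(splitK i) -(splitK j).
case: (fintype.split i) => a; case: (fintype.split j) => b /=;
  rewrite ?block_mxEul ?block_mxEur ?block_mxEdl ?block_mxEdr ?mxE.
- by rewrite !valK.
- by rewrite valK insubF//= ltnNge leq_addr.
- by rewrite insubF//= ltnNge leq_addr.
- by rewrite insubF//= ltnNge leq_addr.
Qed.

Lemma corner0 n N : corner N (0 : 'M[U]_n) = 0.
Proof.
apply/matrixP => i j; rewrite !mxE.
by case: (insub _) => // a; case: (insub _) => // b; rewrite mxE.
Qed.

(** * Splitting classes by unitaries over the masa *)

Lemma unitary_Cu n (z : 'M[U]_n) : Mset Cu z -> z *m mxstar z = 1%:M -> mxstar z *m z = 1%:M ->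
  normalising_unitary A C z.
Proof.
move=> Cz zz sz; split=> //; first by move=> i j; exact: limCu_sub_Au.
have Csz := MsetCu_star Cz.
by move=> c cC; split; apply: MsetCCu => //; exact: MsetCuC.
Qed.

Lemma normalising_unitary1 n : normalising_unitary A C (1%:M : 'M[U]_n).
Proof. by apply: unitary_Cu; rewrite ?mxstar1 ?mulmx1//; exact: MsetCu1. Qed.

(** The direct sum of two zeros is a zero, and zeros of all sizes are equivalent, so this class is
    its own double. *)
Lemma dg_class0 n : dg_class (0 : 'M[U]_n) = 0.
Proof.
have eq0 m p : dg_class (0 : 'M[U]_m) = dg_class (0 : 'M[U]_p).
  apply: dg_class_equiv; [exact: NP0|exact: NP0|exists (m + p)%N].
  split; [exact: leq_addr|exact: leq_addl|].
  exists 1%:M, 1%:M; split; [exact: normalising_unitary1|exact: normalising_unitary1|].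
  by rewrite !corner0 mulmx0 mul0mx.
have b0 : block_mx 0 0 0 0 = 0 :> 'M[U]_(n + n) by rewrite -corner_dbl corner0.
have := @dg_class_dsum n n 0 0 (NP0 n) (NP0 n); rewrite b0 => /(_ (NP0 _)).
by rewrite (eq0 (n + n)%N n) -{1}[dg_class 0]addr0 => /addrI <-.
Qed.

(** The symmetry exchanging the two copies of the range of p and fixing both copies of its
    complement. *)
Lemma sym_unitary n (p : 'M[U]_n) : Mset Cu p -> p *m p = p -> mxstar p = p ->
  normalising_unitary A C (block_mx (1%:M - p) p p (1%:M - p)).
Proof.
move=> Cp pp sp; set z := block_mx _ _ _ _.
have C1p : Mset Cu (1%:M - p) by apply: MsetCuB => //; exact: MsetCu1.
have sz : mxstar z = z.
  by rewrite /z mxstar_block -/(mxstar p) mxstarB mxstar1 sp.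
have qq : (1%:M - p) *m (1%:M - p) = 1%:M - p.
  by rewrite mulmxBl mul1mx mulmxBr mulmx1 pp subrr subr0.
have pq : p *m (1%:M - p) = 0 by rewrite mulmxBr mulmx1 pp subrr.
have qp : (1%:M - p) *m p = 0 by rewrite mulmxBl mul1mx pp subrr.
have zz : z *m z = 1%:M.
  by rewrite mulmx_block qq pp pq qp addr0 subrK (addrC p) subrK -scalar_mx_block.
by apply: unitary_Cu; rewrite ?sz//; exact: Mset_block.
Qed.

(** Pad v by zeros to twice its size. The symmetries of q on the left and of p on the right then
    move the part v p = q v to the second diagonal block and leave v - v p in the first. *)
Lemma dg_class_split n (v p q : 'M[U]_n) : NP v -> Mset Cu p -> Mset Cu q ->
  p *m p = p -> mxstar p = p -> q *m q = q -> mxstar q = q -> q *m v = v *m p ->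
  NP (v - v *m p) -> NP (v *m p) -> NP (block_mx (v - v *m p) 0 0 (v *m p)) ->
  dg_class v = dg_class (v - v *m p) + dg_class (v *m p).
Proof.
move=> hv Cp Cq pp sp qq sq qv h1 h2 h3; rewrite -dg_class_dsum//.
apply: dg_class_equiv => //; exists (n + n)%N; split; rewrite ?leq_addr//.
exists (block_mx (1%:M - q) q q (1%:M - q)), (block_mx (1%:M - p) p p (1%:M - p)).
split; [exact: sym_unitary|exact: sym_unitary|].
rewrite corner_id corner_dbl !mulmx_block !(mulmx0, mul0mx, addr0).
have e1 : (1%:M - q) *m v = v - v *m p by rewrite mulmxBl mul1mx qv.
have e2 : (v - v *m p) *m p = 0 by rewrite mulmxBl -mulmxA pp subrr.
have e3 : v *m p *m p = v *m p by rewrite -mulmxA pp.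
by rewrite e1 qv !mulmxBr !mulmx1 e2 e3 subr0 subrr.
Qed.

Section CuProj.
Variable e : U.
Hypotheses (Ce : Cu e) (ee : e * e = e) (se : star e = e).

Lemma Cu_compl : [/\ Cu (1 - e), (1 - e) * (1 - e) = 1 - e & star (1 - e) = 1 - e].
Proof.
split; first by apply: limCuD; [exact: limCu1|exact: limCuN].
  by rewrite mulrBl mul1r mulrBr mulr1 ee subrr subr0.
by rewrite starB star1 se.
Qed.

Let C1e : Cu (1 - e). Proof. by case: Cu_compl. Qed.
Let e1e : (1 - e) * (1 - e) = 1 - e. Proof. by case: Cu_compl. Qed.
Let s1e : star (1 - e) = 1 - e. Proof. by case: Cu_compl. Qed.

Lemma NP_cutr n (v : 'M[U]_n) : NP v -> NP (v *m e%:S).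
Proof.
move=> hv; rewrite -(mul1mx (v *m _)) mulmxA.
by apply: NP_cut => //; rewrite ?mulr1 ?star1//; exact: limCu1.
Qed.

Lemma NP_cutl n (v : 'M[U]_n) : NP v -> NP (e%:S *m v).
Proof.
move=> hv; rewrite -(mulmx1 (_ *m v)).
by apply: NP_cut => //; rewrite ?mulr1 ?star1//; exact: limCu1.
Qed.
End CuProj.

(** The projection matching e on the range side is v e times the adjoint of v. The pieces are
    orthogonal because e commutes with [C] and, by normalisation, with the conjugates of [C] under
    v. *)
Lemma dg_class_splitr n (v : 'M[U]_n) e : NP v -> Cu e -> e * e = e -> star e = e ->
  dg_class v = dg_class (v *m (1 - e)%:S) + dg_class (v *m e%:S).
Proof.
move=> hv Ce ee se; have [C1e e1e s1e] := Cu_compl Ce ee se.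
have vE : v *m (1 - e)%:S = v - v *m e%:S by rewrite raddfB mulmxBr mulmx1.
have [cv cv'] := NP_starC hv; have [_ vv _ _ vN] := hv.
rewrite vE; apply: (@dg_class_split n v e%:S (v *m e%:S *m mxstar v)) => //.
- exact: Mset_scalarCu.
- by apply: MsetC_Cu; exact: NP_conjCu.
- by rewrite scalarMM ee.
- by rewrite mxstar_scalar se.
- rewrite !mulmxA -(mulmxA _ (mxstar v) v) -(mulmxA v e%:S) (scalar_comm Ce cv).
  by rewrite !mulmxA vv -(mulmxA v e%:S) scalarMM ee.
- by rewrite !mxstarM mxstarK mxstar_scalar se mulmxA.
- by rewrite -!mulmxA (scalar_comm Ce cv) !mulmxA vv.
- by rewrite -vE; exact: NP_cutr.
- exact: NP_cutr.
rewrite -vE; apply: NP_dsum; [exact: NP_cutr|exact: NP_cutr| |].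
- move=> c cC; rewrite !mxstarM mxstar_scalar se -!mulmxA (mulmxA c) -(scalar_comm Ce cC).
  rewrite !mulmxA -(mulmxA v _ e%:S) scalarMM mulrBl mul1r ee subrr raddf0.
  by rewrite mulmx0 !mul0mx.
- move=> c cC; rewrite !mxstarM mxstar_scalar s1e.
  have -> : (1 - e)%:S *m mxstar v *m c *m (v *m e%:S) = (1 - e)%:S *m (mxstar v *m c *m v *m e%:S).
    by rewrite !mulmxA.
  rewrite -(scalar_comm Ce (vN c cC).2) (mulmxA (1 - e)%:S) scalarMM mulrBl mul1r ee subrr raddf0.
  by rewrite mul0mx.
Qed.

(** As for the right cut, with the matching projection [mxstar v *m e%:S *m v] now on the domain
    side. *)
Lemma dg_class_splitl n (v : 'M[U]_n) e : NP v -> Cu e -> e * e = e -> star e = e ->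
  dg_class v = dg_class ((1 - e)%:S *m v) + dg_class (e%:S *m v).
Proof.
move=> hv Ce ee se; have [C1e e1e s1e] := Cu_compl Ce ee se.
have [cv cv'] := NP_starC hv; have [_ vv _ _ vN] := hv.
pose p := mxstar v *m e%:S *m v.
have vp : v *m p = e%:S *m v.
  by rewrite /p !mulmxA -(scalar_comm Ce cv') -!mulmxA (mulmxA v) vv.
have vE : (1 - e)%:S *m v = v - v *m p by rewrite raddfB mulmxBl mul1mx vp.
rewrite vE -vp; apply: (@dg_class_split n v p e%:S) => //.
- by apply: MsetC_Cu; exact: NP_conjCu'.
- exact: Mset_scalarCu.
- rewrite {1}/p -!mulmxA vp (mulmxA e%:S) scalarMM ee /p mulmxA//.
- by rewrite !mxstarM mxstarK mxstar_scalar se mulmxA.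
- by rewrite scalarMM ee.
- by rewrite mxstar_scalar se.
- by rewrite -vE; exact: NP_cutl.
- by rewrite vp; exact: NP_cutl.
rewrite -vE vp; apply: NP_dsum; [exact: NP_cutl|exact: NP_cutl| |].
- move=> c cC; rewrite !mxstarM mxstar_scalar se.
  have -> : (1 - e)%:S *m v *m c *m (mxstar v *m e%:S) = (1 - e)%:S *m (v *m c *m mxstar v *m e%:S).
    by rewrite !mulmxA.
  rewrite -(scalar_comm Ce (vN c cC).1) (mulmxA (1 - e)%:S) scalarMM mulrBl mul1r ee subrr raddf0.
  by rewrite mul0mx.
- move=> c cC; rewrite !mxstarM mxstar_scalar s1e.
  have -> : mxstar v *m (1 - e)%:S *m c *m (e%:S *m v) = mxstar v *m ((1 - e)%:S *m (c *m e%:S)) *m v.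
    by rewrite !mulmxA.
  rewrite -(scalar_comm Ce cC) (mulmxA (1 - e)%:S) scalarMM mulrBl mul1r ee subrr raddf0.
  by rewrite mul0mx mulmx0 mul0mx.
Qed.

(** * Constant multiples of matrix units *)

Lemma amp_mulr n (P : 'M[K]_n) (a : U) : amp P a = amp P 1 *m a%:S.
Proof. by rewrite -amp_scalar ampM mulmx1 mul1r. Qed.
Lemma amp_mull n (P : 'M[K]_n) (a : U) : amp P a = a%:S *m amp P 1.
Proof. by rewrite -amp_scalar ampM mul1mx mulr1. Qed.

Lemma Mset_amp_Cu n (P : 'M[K]_n) a : Cu a -> Mset Cu (amp P a).
Proof. by move=> Ca i j; rewrite mxE; exact: limCuZ. Qed.

Lemma MsetC_conj n k (i j : I k) (c : 'M[U]_n) : Mset C c -> Mset C ((E i j)%:S *m c *m (E j i)%:S).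
Proof. by move=> hc a b; rewrite scalarMr scalarMl; exact: limC_conj. Qed.

Lemma sesqui_pid n r : ((pid_mx r : 'M[K]_n) ^t*)%sesqui = pid_mx r.
Proof. by rewrite tr_pid_mx map_pid_mx. Qed.

Lemma NP_amp n (P : 'M[K]_n) k (i j : I k) : T i j -> P *m P = P -> (P ^t*)%sesqui = P ->
  NP (amp P (E i j)).
Proof.
move=> Tij PP sP; have [e0|e0] := eqVneq (E i j) 0.
  have -> : amp P (E i j) = 0 by apply/matrixP => a b; rewrite !mxE e0 scaler0.
  exact: NP0.
have sv : mxstar (amp P (E i j)) = amp P (E j i) by rewrite mxstar_amp sP munit_star.
have P1 : Mset Cu (amp P 1) by apply: Mset_amp_Cu; exact: limCu1.
apply: NP_intro; rewrite ?sv.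
- by move=> a b; rewrite mxE; apply: limAZ; exact: munitA.
- by rewrite !ampM !PP munit_starl// munit_idl.
- by rewrite ampM PP munit_starl 1?munit_sym//; apply: Mset_ampC; exact: munitC.
- by rewrite ampM PP munit_starl//; apply: Mset_ampC; exact: munitC.
- move=> c cC; rewrite (amp_mulr P (E i j)) (amp_mull P (E j i)).
  have -> : amp P 1 *m (E i j)%:S *m c *m ((E j i)%:S *m amp P 1) =
    amp P 1 *m ((E i j)%:S *m c *m (E j i)%:S) *m amp P 1 by rewrite !mulmxA.
  by apply: MsetCCu => //; apply: MsetCuC => //; exact: MsetC_conj.
- move=> c cC; rewrite (amp_mulr P (E j i)) (amp_mull P (E i j)).
  have -> : amp P 1 *m (E j i)%:S *m c *m ((E i j)%:S *m amp P 1) =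
    amp P 1 *m ((E j i)%:S *m c *m (E i j)%:S) *m amp P 1 by rewrite !mulmxA.
  by apply: MsetCCu => //; apply: MsetCuC => //; exact: MsetC_conj.
Qed.

Definition dg_unit k (i j : I k) : DG := dg_class ((E i j)%:S : 'M_1).

(** The constant projection of rank r + 1 is the direct sum of a 1 by 1 block and a projection of
    rank r, and the sum is again of this form, hence normalising. *)
Lemma dg_class_pid n r k (i j : I k) : T i j -> (r <= n)%N ->
  dg_class (amp (pid_mx r : 'M_n) (E i j)) = dg_unit i j *+ r.
Proof.
move=> Tij; elim: r n => [|r IH] n rn.
  have -> : amp (pid_mx 0 : 'M_n) (E i j) = 0.
    by rewrite pid_mx_0; apply/matrixP => a b; rewrite !mxE scale0r.
  by rewrite dg_class0 mulr0n.
case: n rn => [//|n rn]; rewrite mulrS -(IH n)//.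
have np m p : (p <= m)%N -> NP (amp (pid_mx p : 'M_m) (E i j)).
  by move=> pm; apply: NP_amp => //; [rewrite pid_mx_id|exact: sesqui_pid].
have h1 : NP ((E i j)%:S : 'M_1).
  by rewrite -amp_scalar -pid_mx_1; exact: np.
have bE : amp (pid_mx r.+1 : 'M_n.+1) (E i j) =
    block_mx ((E i j)%:S : 'M_1) 0 0 (amp (pid_mx r : 'M_n) (E i j)).
  apply/matrixP; rewrite -[n.+1]/(1 + n)%N => a b; rewrite -(splitK a) -(splitK b).
  case: (fintype.split a) => a'; case: (fintype.split b) => b' /=;
  rewrite ?block_mxEul ?block_mxEur ?block_mxEdl ?block_mxEdr !mxE /=.
  - by rewrite !ord1 /= scale1r.
  - by rewrite ord1 /= scale0r.
  - by rewrite ord1 /= scale0r.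
  - by rewrite !add1n eqSS ltnS.
have h3 := np n.+1 r.+1 rn; rewrite bE in h3 *.
by apply: (@dg_class_dsum 1 n (E i j)%:S (amp (pid_mx r) (E i j))) => //; exact: np.
Qed.

(** Halmos dilation: [D] turns a partial isometry over [C] into a unitary of twice the size. The
    defect blocks vanish against v, because v starts and ends inside the supports of t and s. *)
Lemma equiv_dilate n (v w s t : 'M[U]_n) : Mset C s -> Mset C t ->
  s *m mxstar s *m s = s -> t *m mxstar t *m t = t -> s *m v *m t = w ->
  mxstar s *m s *m v = v -> v *m t *m mxstar t = v -> pi_equiv A C v w.
Proof.
move=> Cs Ct ss tt swt sv vt; exists (n + n)%N; split; rewrite ?leq_addr//.
pose D (s : 'M[U]_n) := block_mx s (1%:M - s *m mxstar s) (1%:M - mxstar s *m s) (mxstar s).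
have Du (a : 'M[U]_n) : Mset C a -> a *m mxstar a *m a = a -> normalising_unitary A C (D a).
  move=> Ca aa; have sa := MsetC_star Ca; have aa' := pisom_star aa.
  have C1 : Mset Cu (1%:M : 'M[U]_n) by exact: MsetCu1.
  have Cl : Mset Cu (1%:M - a *m mxstar a) by apply: MsetCuB => //; apply: MsetC_Cu; exact: MsetCM.
  have Cr : Mset Cu (1%:M - mxstar a *m a) by apply: MsetCuB => //; apply: MsetC_Cu; exact: MsetCM.
  have idl : (1%:M - a *m mxstar a) *m (1%:M - a *m mxstar a) = 1%:M - a *m mxstar a.
    by rewrite mulmxBl mul1mx mulmxBr mulmx1 mulmxA aa subrr subr0.
  have idr : (1%:M - mxstar a *m a) *m (1%:M - mxstar a *m a) = 1%:M - mxstar a *m a.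
    by rewrite mulmxBl mul1mx mulmxBr mulmx1 mulmxA aa' subrr subr0.
  have sl : mxstar (1%:M - a *m mxstar a) = 1%:M - a *m mxstar a.
    by rewrite mxstarB mxstar1 mxstarM mxstarK.
  have sr : mxstar (1%:M - mxstar a *m a) = 1%:M - mxstar a *m a.
    by rewrite mxstarB mxstar1 mxstarM mxstarK.
  have z1 : a *m (1%:M - mxstar a *m a) = 0 by rewrite mulmxBr mulmx1 mulmxA aa subrr.
  have z2 : (1%:M - a *m mxstar a) *m a = 0 by rewrite mulmxBl mul1mx aa subrr.
  have z3 : mxstar a *m (1%:M - a *m mxstar a) = 0 by rewrite mulmxBr mulmx1 mulmxA aa' subrr.
  have z4 : (1%:M - mxstar a *m a) *m mxstar a = 0 by rewrite mulmxBl mul1mx aa' subrr.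
  have sD : mxstar (D a) = block_mx (mxstar a) (1%:M - mxstar a *m a) (1%:M - a *m mxstar a) a.
    by rewrite /D mxstar_block -!/(mxstar _) sl sr mxstarK.
  apply: unitary_Cu.
  - by apply: Mset_block => //; apply: MsetC_Cu.
  - rewrite sD mulmx_block idl idr z1 z2 z3 z4 addr0 (addrC _ (1%:M - _)) !subrK.
    by rewrite -scalar_mx_block.
  - rewrite sD mulmx_block idl idr z1 z2 z3 z4 addr0 (addrC _ (1%:M - _)) !subrK.
    by rewrite -scalar_mx_block.
exists (D s), (D t); split; [exact: Du|exact: Du|].
rewrite !corner_dbl !mulmx_block !(mulmx0, mul0mx, addr0, add0r) swt.
have -> : (1%:M - mxstar s *m s) *m v = 0 by rewrite mulmxBl mul1mx sv subrr.
rewrite !mul0mx; congr (block_mx _ _ _ _).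
by rewrite mulmxBr mulmx1 mulmxA -(mulmxA s v) -(mulmxA s) vt subrr.
Qed.

Lemma pcoef_star x c t : pcoef x x c t -> pcoef x x (star c) t^*.
Proof.
move=> h e e0; have [L hL] := h e e0; exists L => l i j Ll xi xj.
have := hL l j i Ll xj xi; rewrite -nrm_star starB starZ !starM !munit_star.
by rewrite mulrA.
Qed.

Lemma graph_diag x k (i : I k) : gelfand x -> x (E i i) = 1 -> graph k i i (x, x).
Proof.
move=> Gx xi; split=> //=; first by rewrite munit_star munit_idl.
move=> c Cc; have Ci : C (E i i) by exact: munitC.
by rewrite munit_star (charM Gx) ?(charM Gx) ?xi ?mul1r ?mulr1//; exact: limCM.
Qed.

(** The definition of a character does not mention the adjoint. Its values are coefficients at (x,
    x), and those respect adjoints and are unique. *)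
Lemma char_star x c : gelfand x -> C c -> x (star c) = (x c)^*.
Proof.
move=> Gx Cc; have [k [i xi]] := char_level Gx.
apply: (pcoef_uniq (graph_diag Gx xi) (a := star c)).
  by apply: char_coef => //; exact: limC_star.
by apply: pcoef_star; exact: char_coef.
Qed.

Lemma unit_step l (i j : I l) : E i j != 0 -> exists q : I l.+1 * I l.+1,
  [/\ E q.1 q.2 != 0, E i i * E q.1 q.1 = E q.1 q.1, E j j * E q.2 q.2 = E q.2 q.2 &
      E i j * E q.2 q.2 = E q.1 q.2].
Proof.
move=> eij; have kl := leqnSn l.
have [b hb] : exists b : I l.+1, E i j * E b b != 0.
  apply: contra_notP (negP eij) => hn; have [_ <-] := munit1_le kl i j.
  rewrite mulr_sumr big1// => b _; apply/eqP; apply: contra_notT hn => ?; by exists b.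
case: (munit_refine_le kl i j b) => [h|[a ab h]]; first by rewrite h eqxx in hb.
exists (a, b); split=> //=.
  case: (munit_diag_le kl i a) => // h0; move: ab.
  rewrite -(munit_idl a b) -h -(munit_idl i j) !mulrA (munit_diagC kl i a) in h0 * .
  by rewrite h0 !mul0r eqxx.
case: (munit_diag_le kl j b) => // h0; move: hb.
by rewrite -(munit_idr i j) -mulrA h0 mulr0 eqxx.
Qed.

Section PathExists.
Variables (k : nat) (i j : I k).
Hypothesis e0 : E i j != 0.

(** Dependent choice over the levels. The invariant [good] is trivial when only a point of a graph
    is wanted, and a filter condition in the compactness argument. *)
Lemma unit_path_exists (good : forall l, I l -> I l -> Prop) : good k i j ->
  (forall l (a b : I l), good l a b -> E a b != 0 -> exists q : I l.+1 * I l.+1, good l.+1 q.1 q.2 /\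
  [/\ E q.1 q.2 != 0, E a a * E q.1 q.1 = E q.1 q.1, E b b * E q.2 q.2 = E q.2 q.2 &
      E a b * E q.2 q.2 = E q.1 q.2]) ->
  exists r s : forall m, I (m + k), [/\ unit_path r s, r 0%N = i, s 0%N = j &
    forall m, good (m + k) (r m) (s m)].
Proof.
move=> g0 gS.
pose ok l (p : I l * I l) := good l p.1 p.2 /\ E p.1 p.2 != 0.
have step l (p : {p | @ok l p}) : exists q : {q | @ok l.+1 q},
    [/\ E (sval p).1 (sval p).1 * E (sval q).1 (sval q).1 = E (sval q).1 (sval q).1,
     E (sval p).2 (sval p).2 * E (sval q).2 (sval q).2 = E (sval q).2 (sval q).2 &
      E (sval p).1 (sval p).2 * E (sval q).2 (sval q).2 = E (sval q).1 (sval q).2].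
  case: p => p [gp ep]; have [q [gq [h1 h2 h3 h4]]] := gS _ _ _ gp ep.
  by exists (exist _ q (conj gq h1)).
pose f := fix f m : {p | @ok (m + k) p} := if m is m'.+1 then projT1 (cid (step _ (f m')))
  else exist _ (i, j) (conj g0 e0).
exists (fun m => (sval (f m)).1), (fun m => (sval (f m)).2); split=> //.
  move=> m; have [h1 h2 h3] := projT2 (cid (step _ (f m))).
  by split=> //; have [] := svalP (f m).
by move=> m; have [] := svalP (f m).
Qed.

Lemma char_exists : exists2 p : (U -> K) * (U -> K), graph k i j p & gelfand p.1 /\ p.1 (E i i) = 1.
Proof.
have [//|l a b _ eab|r [s [rs r0 s0 _]]] := @unit_path_exists (fun _ _ _ => True).
  by have [q hq] := unit_step eab; exists q.
exists (path_char r, path_char s); first by have := path_graph rs 0%N; rewrite r0 s0.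
have rr := unit_path_l rs; split; first exact: path_char_gelfand.
by have := path_char_unit rr 0%N; rewrite r0.
Qed.
End PathExists.

Lemma char_projection n x (q : 'M[U]_n) : gelfand x -> Mset C q -> q *m q = q -> mxstar q = q ->
  let b := \matrix_(i, j) x (q i j) in b *m b = b /\ (b ^t*)%sesqui = b.
Proof.
move=> Gx Cq qq sq b; split; apply/matrixP => i j.
  rewrite [RHS]mxE -[in RHS]qq [(q *m q) i j]mxE (char_sum Gx); last by move=> k _; exact: limCM.
  by rewrite [LHS]mxE; apply: eq_bigr => k _; rewrite !mxE (charM Gx).
by rewrite !mxE -(char_star Gx)// -mxstarE sq.
Qed.

(* v is a complex partial isometry times E_ij up to equivalence, because
   projections over C that are close to constant ones are equivalent to them. *)
Lemma NP_near_unit n (v : 'M[U]_n) k (i j : I k) (a : 'M[K]_n) (e N : R) :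
  NP v -> T i j -> (E i i)%:S *m v = v -> v *m (E j j)%:S = v ->
  mn (v - amp a (E i j)) <= e -> 0 <= e -> 1 + mn v ^+ 2 + (n * n)%:R <= N ->
  64 * N ^+ 7 * e <= 1 -> exists r : nat, dg_class v = dg_unit i j *+ r.
Proof.
move=> hv Tij eiv vej ve e0 hN he.
have v0 := mn_ge0 v; set M := mn v in hN v0.
have M2 : 0 <= M ^+ 2 by rewrite exprn_ge0.
have nn : 0 <= (n * n)%:R :> R by [].
have N1 : 1 <= N by lra.
have N0 : 0 <= N by lra.
have NN m p : (m <= p)%N -> N ^+ m <= N ^+ p by move=> mp; rewrite ler_weXn2l.
have Ne m : (m <= 7)%N -> 64 * (N ^+ m * e) <= 1.
  by move=> m7; apply: le_trans he; rewrite -mulrA ler_wpM2l// ler_wpM2r// NN.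
have e64 : 64 * e <= 1 by have := Ne 0%N isT; rewrite expr0 mul1r.
have [Eij|Eij] := eqVneq (E i j) 0.
  exists 0%N; rewrite mulr0n -(dg_class0 n); congr (dg_class _).
  have [_ vv _ _ _] := hv; apply: pisom_small => //.
  have a0 : amp a (E i j) = 0 by apply/matrixP => s t; rewrite !mxE Eij scaler0.
  by rewrite a0 subr0 in ve; apply: le_lt_trans ve _; lra.
have [Av vv _ _ vN] := hv; have [cv cv'] := NP_starC hv.
(* Multiplying by [E j i] moves v into the corner of [E i i], near a matrix over [C]; hence u itself
   has entries in [C]. *)
pose u := v *m (E j i)%:S; pose q := v *m mxstar v.
have su : mxstar u = (E i j)%:S *m mxstar v by rewrite mxstarM mxstar_scalar munit_star.
have uE : u *m (E i j)%:S = v by rewrite /u -mulmxA scalarMM munit_starl 1?munit_sym.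
have uu : u *m mxstar u = q.
  by rewrite su /u -mulmxA (mulmxA (E j i)%:S) scalarMM munit_starl 1?munit_sym// mulmxA vej.
have une : mn (u - amp a (E i i)) <= e.
  have -> : u - amp a (E i i) = (v - amp a (E i j)) *m (E j i)%:S.
    have aE : amp a (E i j) *m (E j i)%:S = amp a (E i i).
      by rewrite -amp_scalar ampM mulmx1 munit_starl.
    by rewrite mulmxBl aE.
  exact: le_trans (mn_scalarMr1 _ (nrm_munit j i)) ve.
have uC : Mset C u.
  apply: (@pisom_near n u _ _ _ (amp a (E i i))).
  - by rewrite uu /u mulmxA vv.
  - rewrite su mulmxA -(mulmxA (E i j)%:S); exact: MsetC_conj.
  - move=> c cC; rewrite su /u mulmxA -(mulmxA v) -(mulmxA v); apply: (vN _ _).1.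
    exact: MsetC_conj.
  - have vB : Mset B v by move=> s t; exact: limAB.
    by move=> s t; rewrite scalarMr; apply: limBM; [exact: vB|exact: munitB].
  - by apply: Mset_ampC; exact: munitC.
  - by apply: le_lt_trans une _; lra.
have qq : q *m q = q by rewrite /q mulmxA vv.
have sq : mxstar q = q by rewrite mxstarM mxstarK.
have eq' : (E i i)%:S *m q = q by rewrite /q mulmxA eiv.
have qv : q *m v = v by [].
(* The matrix a times its adjoint is only approximately a projection. Evaluating q at a character
   through [E i i] gives an exact one, b. *)
have [[x y] /graph_units[Gx _ xi _ _] _] := char_exists Eij.
pose b : 'M[K]_n := \matrix_(s, t) x (q s t).
have [bb sb] := @char_projection n x q Gx cv' qq sq; rewrite -/b in bb sb.
have [r [beta [bE br rb rn bn]]] := projection_factor bb sb.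
have nu : mn u <= M by exact: mn_scalarMr1 _ (nrm_munit j i).
pose d := u - amp a (E i i); pose aa := a *m (a ^t*)%sesqui.
have sa : mxstar (amp a (E i i)) = amp (a ^t*)%sesqui (E i i) by rewrite mxstar_amp munit_star.
have qd : q - amp aa (E i i) = d *m mxstar u + amp a (E i i) *m mxstar d.
  rewrite /d mulmxBl mxstarB mulmxBr sa ampM munit_idl -/aa uu addrA subrK.
  by [].
have na : mn (amp a (E i i)) <= M + e.
  have := mnB u d; rewrite /d subKr => h; apply: le_trans h _; by rewrite lerD.
have dn : mn d <= e by [].
have d0 := mn_ge0 d.
have tau1 : mn (q - amp aa (E i i)) <= e * (2 * M + 1).
  rewrite qd; have h1 := mnD (d *m mxstar u) (amp a (E i i) *m mxstar d).
  have h2 := mnM d (mxstar u); have h3 := mnM (amp a (E i i)) (mxstar d).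
  rewrite !mn_star in h2 h3.
  have h4 : mn d * mn u <= e * M by rewrite ler_pM// mn_ge0.
  have h5 : mn (amp a (E i i)) * mn d <= (M + e) * e by rewrite ler_pM// mn_ge0.
  nra.
(* Characters are contractive, so b is as close to [aa] as q is; this costs a factor 2. *)
have tau : mn (q - amp b (E i i)) <= 2 * (e * (2 * M + 1)).
  have h1 := mn_dist q (amp aa (E i i)) (amp b (E i i)).
  have h2 : mn (amp aa (E i i) - amp b (E i i)) <= mn (q - amp aa (E i i)).
    apply: ler_sum => s _; apply: ler_sum => t _.
    have -> : (amp aa (E i i) - amp b (E i i)) s t = (aa s t - x (q s t)) *: E i i.
      by rewrite mxE [X in _ + X]mxE !ampE [b s t]mxE scalerBl.
    have -> : (q - amp aa (E i i)) s t = q s t - aa s t *: E i i.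
      by rewrite mxE [X in _ + X]mxE ampE.
    rewrite nrmZ nrm_munit1 ?munit_diag// mulr1 nc_distC.
    have -> : x (q s t) - aa s t = x (q s t - aa s t *: E i i).
      rewrite (charB Gx) ?(charZ Gx) ?xi ?mulr1//; [exact: munitC|].
      by apply: limCZ; exact: munitC.
    apply: (char_le Gx); apply: limCD => //; apply: limCN; apply: limCZ; exact: munitC.
  lra.
have [|||s [Cs ss sg sss]] := projection_equiv (munitC i) (munit_idl i i) (munit_star i i) cv' qq sq eq' bE br rb rn N1.
- apply: le_trans (mnM _ _) _; rewrite mn_star -expr2 -/M; lra.
- apply: (@le_trans _ _ ((n * n)%:R * 1)); last by lra.
  apply: mn_leC => s t; rewrite mxE nrmZ nrm_munit1 ?munit_diag// mulr1; exact: bn.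
(* Origin of the constant: 16 * N^6 times 2 * e * (2 * M + 1), with 2 * M + 1 at most 2 * N, is at
   most 64 * N^7 * e. *)
- have h : 2 * M + 1 <= 2 * N by nra.
  have := Ne 7 isT; have e1 : e * (2 * M + 1) <= e * (2 * N) by rewrite ler_wpM2l.
  have N6 : 0 <= N ^+ 6 by rewrite exprn_ge0.
  have := ler_wpM2l N6 tau; have := ler_wpM2l N6 e1.
  have -> : N ^+ 7 = N ^+ 6 * N by rewrite exprSr.
  rewrite -!mulrA; lra.
have {}ss : mxstar s *m s = q by [].
exists r; rewrite -(dg_class_pid Tij rn).
pose w : 'M[U]_n := amp (pid_mx r) (E i j); pose g : 'M[U]_n := amp (pid_mx r) (E i i).
have pp : (pid_mx r : 'M[K]_n) *m (pid_mx r : 'M[K]_n) = pid_mx r.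
  by rewrite mul_pid_mx !minnn (minn_idPr rn).
have gw : g *m w = w by rewrite ampM pp munit_idl.
have sw : mxstar w = amp (pid_mx r) (E j i) by rewrite mxstar_amp sesqui_pid munit_star.
have ww : w *m mxstar w = g by rewrite sw ampM pp munit_starl.
have gs : g *m s = s by rewrite /g -sg.
(* Chosen so that s v t is s q times the adjoint of s, that is g, times w, which is w. *)
pose t := mxstar v *m mxstar s *m w.
have st : mxstar t = mxstar w *m s *m v by rewrite !mxstarM !mxstarK mulmxA.
have sqs : s *m q *m mxstar s = g by rewrite -ss mulmxA sss sg.
apply: dg_class_equiv => //; first by apply: NP_amp => //; exact: sesqui_pid.
apply: (@equiv_dilate n v w s t) => //.
- have -> : t = (E j i)%:S *m (mxstar u *m mxstar s *m g) *m (E i j)%:S.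
    rewrite /t -uE mxstarM mxstar_scalar munit_star /w amp_mulr.
    rewrite /g (amp_mulr _ (E i i)) -!mulmxA scalarMM munit_idl. by [].
  apply: MsetC_conj; apply: MsetCM; last by apply: Mset_ampC; exact: munitC.
  by apply: MsetCM; exact: MsetC_star.
- have -> : t *m mxstar t *m t = mxstar v *m mxstar s *m (w *m mxstar w) *m (s *m q *m mxstar s) *m w.
    by rewrite st /t /q !mulmxA.
  rewrite ww sqs -(mulmxA _ g g) ampM pp munit_idl -/g -mulmxA gw. by [].
- by rewrite /t !mulmxA -(mulmxA s v) -/q sqs gw.
- by rewrite ss qv.
- have -> : v *m t *m mxstar t = q *m mxstar s *m (w *m mxstar w) *m s *m v by rewrite st /t /q !mulmxA.
  by rewrite ww -(mulmxA _ g s) gs -(mulmxA q) ss qq qv.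
Qed.

(** * Decomposition of a class into classes of matrix units *)

Lemma dg_class_sumr n (v : 'M[U]_n) k (s : seq (I k)) : NP v -> uniq s ->
  dg_class v = dg_class (v *m (1 - \sum_(i <- s) E i i)%:S) + \sum_(i <- s) dg_class (v *m (E i i)%:S).
Proof.
move=> hv; elim: s => [_|i s IH /= /andP[is' us]].
  by rewrite !big_nil subr0 mulmx1 addr0.
have Cf : C (\sum_(a <- s) E a a).
  by elim: (s) => [|a s' h]; rewrite ?big_nil ?big_cons; [exact: limC0|apply: limCD => //; exact: munitC].
pose f := \sum_(a <- s) E a a; rewrite -/f in Cf.
have sf : star f = f by rewrite star_sum; apply: eq_bigr => a _; rewrite munit_star.
have fi : f * E i i = 0.
  rewrite mulr_suml big_seq big1// => a as'; rewrite munit_mul0//.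
  by apply: contraNneq is' => <-.
have fif : E i i * f = 0 by rewrite -(munit_star i i) -sf -starM fi star0.
have ff : f * f = f.
  rewrite {1}/f mulr_suml /f; apply: eq_big_seq => a as'.
  rewrite mulr_sumr (bigD1_seq a)//= munit_idl big1 ?addr0// => c ca.
  by rewrite munit_mul0// eq_sym.
have [C1 f1 s1] := Cu_compl (sub_with_unit Cf) ff sf.
rewrite (IH us) !big_cons -/f addrA; congr (_ + _).
have hv' : NP (v *m (1 - f)%:S) by exact: NP_cutr.
rewrite (@dg_class_splitr n _ (E i i) hv' (sub_with_unit (munitC i)) (munit_idl i i) (munit_star i i)).
rewrite -!mulmxA !scalarMM; congr (dg_class (v *m _%:S) + dg_class (v *m _%:S)).
  by rewrite mulrBr mulr1 mulrBl mul1r fi subr0 -addrA -opprD (addrC f).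
by rewrite mulrBl mul1r fi subr0.
Qed.

Lemma dg_class_suml n (v : 'M[U]_n) k (s : seq (I k)) : NP v -> uniq s ->
  dg_class v = dg_class ((1 - \sum_(i <- s) E i i)%:S *m v) + \sum_(i <- s) dg_class ((E i i)%:S *m v).
Proof.
move=> hv; elim: s => [_|i s IH /= /andP[is' us]].
  by rewrite !big_nil subr0 mul1mx addr0.
have Cf : C (\sum_(a <- s) E a a).
  by elim: (s) => [|a s' h]; rewrite ?big_nil ?big_cons; [exact: limC0|apply: limCD => //; exact: munitC].
pose f := \sum_(a <- s) E a a; rewrite -/f in Cf.
have sf : star f = f by rewrite star_sum; apply: eq_bigr => a _; rewrite munit_star.
have fi : f * E i i = 0.
  rewrite mulr_suml big_seq big1// => a as'; rewrite munit_mul0//.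
  by apply: contraNneq is' => <-.
have fif : E i i * f = 0 by rewrite -(munit_star i i) -sf -starM fi star0.
have ff : f * f = f.
  rewrite {1}/f mulr_suml /f; apply: eq_big_seq => a as'.
  rewrite mulr_sumr (bigD1_seq a)//= munit_idl big1 ?addr0// => c ca.
  by rewrite munit_mul0// eq_sym.
have [C1 f1 s1] := Cu_compl (sub_with_unit Cf) ff sf.
rewrite (IH us) !big_cons -/f addrA; congr (_ + _).
have hv' : NP ((1 - f)%:S *m v) by exact: NP_cutl.
rewrite (@dg_class_splitl n _ (E i i) hv' (sub_with_unit (munitC i)) (munit_idl i i) (munit_star i i)).
rewrite !mulmxA !scalarMM; congr (dg_class (_%:S *m v) + dg_class (_%:S *m v)).
  by rewrite mulrBl mul1r mulrBr mulr1 fif subr0 -addrA -opprD (addrC f).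
by rewrite mulrBr mulr1 fif subr0.
Qed.

Lemma munit1_proj k : [/\ munit1 k * munit1 k = munit1 k, star (munit1 k) = munit1 k & Cu (munit1 k)].
Proof.
split; [|exact: munit1_star|exact/sub_with_unit/munit1C].
have [] // := @munit1_span k (@full_rel k) (munit1 k).
by apply: mspan_sum => i _; exact: mspan_unit.
Qed.

(** Cut v by the units of a level at which an approximant w lives. The part outside the level, and
    the cuts at units not in A_L, have no contribution from w; they have norm less than 1 and
    vanish. Since w belongs to every later level too, the conclusion holds at all of them. *)
Lemma dg_class_decomp n (v : 'M[U]_n) : NP v -> exists L0, forall L, (L0 <= L)%N ->
  exists m : I L -> I L -> nat, (forall i j, ~~ T i j -> m i j = 0%N) /\
  dg_class v = \sum_i \sum_j dg_unit i j *+ m i j.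
Proof.
move=> hv; have [Av _ _ _ _] := hv.
(* Cuts do not increase [mn], so the bound N and the tolerance e obtained from v serve for all the
   pieces. *)
pose N := 1 + mn v ^+ 2 + (n * n)%:R.
have N1 : 1 <= N by rewrite /N -addrA lerDl addr_ge0// exprn_ge0// mn_ge0.
have N7 : 0 < 64 * N ^+ 7 by rewrite mulr_gt0// exprn_gt0//; lra.
pose e := (64 * N ^+ 7)^-1.
have e0 : 0 < e by rewrite invr_gt0.
have eN : 64 * N ^+ 7 * e = 1 by rewrite /e mulfV// gt_eqF.
have e1 : e < 1.
  have : 1 <= N ^+ 7 by rewrite exprn_ege1.
  move=> h; rewrite /e invf_lt1//; lra.
have Av' : Mset (mclos T) v by rewrite -limAE.
have [L0 [w [_ wT vw]]] := Mset_approx mspan_tri_le Av' e0 0%N.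
exists L0 => L LL.
have {}wT : Mset (mspan (@T L)) w by move=> a b; exact: (mspan_tri_le LL).
have [f1 fs fC] := munit1_proj L.
have [gC g1 gs] := Cu_compl fC f1 fs.
have fw : (1 - munit1 L)%:S *m w = 0.
  apply/matrixP => a b; rewrite scalarMl mxE mulrBl mul1r.
  by have [-> _] := munit1_span (wT a b); rewrite subrr.
have wf : w *m (1 - munit1 L)%:S = 0.
  apply/matrixP => a b; rewrite scalarMr mxE mulrBr mulr1.
  by have [_ ->] := munit1_span (wT a b); rewrite subrr.
have /choice[l hl] : forall q : 'I_n * 'I_n, exists l : I L -> I L -> K,
    (forall i j, ~~ T i j -> l i j = 0) /\ w q.1 q.2 = \sum_i \sum_j l i j *: E i j.
  by move=> q; exact: wT.
have piece (i j : I L) : exists r : nat, (~~ T i j -> r = 0%N) /\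
    dg_class ((E i i)%:S *m v *m (E j j)%:S) = dg_unit i j *+ r.
  pose vij := (E i i)%:S *m v *m (E j j)%:S.
  have hij : NP vij.
    by apply: NP_cut; rewrite ?munit_idl ?munit_star//; apply: sub_with_unit; exact: munitC.
  pose a : 'M[K]_n := \matrix_(s, t) l (s, t) i j.
  have near : mn (vij - amp a (E i j)) <= e.
    have -> : vij - amp a (E i j) = (E i i)%:S *m (v - w) *m (E j j)%:S.
      rewrite mulmxBr mulmxBl; congr (_ - _); apply/matrixP => s t.
      have [_ wE] := hl (s, t); rewrite [RHS]scalarMr scalarMl !mxE.
      by rewrite (mspan_coef i j wE).
    apply: le_trans (ltW vw); apply: le_trans (mn_scalarMr1 _ (nrm_munit j j)) _.
    exact: mn_scalarMl1 _ (nrm_munit i i).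
  have nv : mn vij <= mn v.
    apply: le_trans (mn_scalarMr1 _ (nrm_munit j j)) _.
    exact: mn_scalarMl1 _ (nrm_munit i i).
  have [Tij|nT] := boolP (T i j).
    have [||||r hr] := @NP_near_unit n vij L i j a e N hij Tij _ _ near (ltW e0).
    - by rewrite /vij !mulmxA scalarMM munit_idl.
    - by rewrite /vij -!mulmxA scalarMM munit_idl.
    - rewrite /N !lerD2r lerD2l ler_pXn2r ?nnegrE ?mn_ge0//.
    - by rewrite eN.
    by exists r.
  exists 0%N; split=> //; rewrite mulr0n -(dg_class0 n); congr (dg_class _).
  have a0 : amp a (E i j) = 0.
    apply/matrixP => s t; rewrite !mxE; have [-> // _] := hl (s, t).
    by rewrite scale0r.
  rewrite a0 subr0 in near; have [_ vv _ _ _] := hij.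
  by apply: pisom_small => //; exact: le_lt_trans near e1.
pose m (i j : I L) := projT1 (cid (piece i j)).
have hm (i j : I L) := projT2 (cid (piece i j)).
exists m; split=> [i j|]; first exact: (hm i j).1.
have zero z : NP z -> mn z < 1 -> dg_class z = 0.
  by move=> [_ zz _ _ _] z1; rewrite (pisom_small zz z1) dg_class0.
rewrite (dg_class_suml hv (index_enum_uniq (I L))) -/(munit1 L) zero ?add0r.
- apply: eq_bigr => i _.
  have hi : NP ((E i i)%:S *m v).
    by apply: NP_cutl; rewrite ?munit_idl ?munit_star//; apply: sub_with_unit; exact: munitC.
  rewrite (dg_class_sumr hi (index_enum_uniq (I L))) -/(munit1 L) zero ?add0r.
  + by apply: eq_bigr => j _; rewrite (hm i j).2.
  + exact: NP_cutr.
  + have -> : (E i i)%:S *m v *m (1 - munit1 L)%:S = (E i i)%:S *m (v - w) *m (1 - munit1 L)%:S.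
      by rewrite mulmxBr mulmxBl -(mulmxA _ w) wf mulmx0 subr0.
    apply: le_lt_trans e1; apply: le_trans (ltW vw).
    apply: le_trans (mn_scalarMr1 _ (nrm_proj g1 gs)) _.
    exact: mn_scalarMl1 _ (nrm_munit i i).
- exact: NP_cutl.
- have -> : (1 - munit1 L)%:S *m v = (1 - munit1 L)%:S *m (v - w) by rewrite mulmxBr fw subr0.
  apply: le_lt_trans e1; apply: le_trans (ltW vw).
  exact: mn_scalarMl1 _ (nrm_proj g1 gs).
Qed.

Local Notation sp := (spectrum iota).

(** * Topology of the spectrum *)

Definition sgraph k (i j : I k) : set sp := [set p | graph k i j (val p)].

Lemma sgraph_pair k (i j : I k) (p : sp) : sgraph i j p -> graph k i j ((val p).1, (val p).2).
Proof. by rewrite /sgraph /=; case: (val p). Qed.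

Lemma sp_graph (p : sp) : exists k (i j : I k), T i j /\ sgraph i j p.
Proof.
have /set_mem[G [k [i [j [Tij ->]]]] Gp] := valP p.
by exists k, i, j; split=> //; exact/asboolP.
Qed.

Lemma sp_point k (i j : I k) q : T i j -> graph k i j q -> exists p : sp, val p = q.
Proof.
move=> /asboolP Tij g; have h : q \in (\bigcup_(G in spectrum_graphs iota) G).
  by apply/mem_set; exists (graph k i j) => //; exists k, i, j.
by exists (Sub q h); rewrite SubK.
Qed.

Lemma sgraph_step k l (kl : (k <= l)%N) (i j : I k) (p : sp) : sgraph i j p -> T i j ->
  exists i' j' : I l, [/\ E i' j' != 0, E i j * E j' j' = E i' j', T i' j' & sgraph i' j' p].
Proof.
move=> /sgraph_pair g Tij; have [i' [j' [e' h _ _ g']]] := graph_step kl g.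
by exists i', j'; split=> //; exact: (munit_refine_tri kl Tij e' h).
Qed.

Lemma sgraph_up k l (kl : (k <= l)%N) (i j : I k) (i' j' : I l) : E i' j' != 0 ->
  E i j * E j' j' = E i' j' -> sgraph i' j' `<=` sgraph i j.
Proof.
by move=> e' h p /sgraph_pair g; exact: (graph_up kl e' h g).
Qed.

Lemma sgraph_uniq k (i j i' j' : I k) (p : sp) : sgraph i j p -> sgraph i' j' p -> i = i' /\ j = j'.
Proof. by move=> /sgraph_pair g /sgraph_pair; exact: graph_uniq. Qed.

Lemma sgraph_level (p : sp) : exists k, forall l, (k <= l)%N -> exists i j : I l,
  T i j /\ sgraph i j p.
Proof.
have [k [i [j [Tij g]]]] := sp_graph p; exists k => l kl.
by have [i' [j' [_ _ T' g']]] := sgraph_step kl g Tij; exists i', j'.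
Qed.

Lemma sgraph_sub k l (kl : (k <= l)%N) (i j : I k) (i' j' : I l) (p : sp) : T i j ->
  sgraph i j p -> sgraph i' j' p -> sgraph i' j' `<=` sgraph i j.
Proof.
move=> Tij g g'; have [a [b [e h _ g2]]] := sgraph_step kl g Tij.
have [<- <-] := sgraph_uniq g2 g'; exact: (sgraph_up kl).
Qed.

Lemma sgraph_disj k l (kl : (k <= l)%N) (i j : I k) (i' j' : I l) (p : sp) : T i j ->
  ~ sgraph i j p -> sgraph i' j' p -> sgraph i' j' `<=` ~` sgraph i j.
Proof.
move=> Tij g g' q gq gq2; apply: g.
by apply: (sgraph_sub kl Tij gq2 gq) g'.
Qed.

Lemma open_subbase (V : set sp) : spectrum_subbase V -> open V.
Proof.
move=> hV; exists [set V]; last by rewrite bigcup_set1.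
move=> _ ->; exists [fset V]%fset; first by move=> W /fset1P ->; exact: mem_set.
by rewrite set_fset1 bigcap_set1.
Qed.

Lemma sgraph_open k (i j : I k) : T i j -> open (sgraph i j).
Proof.
move=> /asboolP Tij; apply: open_subbase; exists (graph k i j); last by left.
by exists k, i, j.
Qed.

Lemma sgraphC_open k (i j : I k) : T i j -> open (~` sgraph i j).
Proof.
move=> /asboolP Tij; apply: open_subbase; exists (graph k i j); last by right.
by exists k, i, j.
Qed.

(** A graph through p at a later level lies inside each earlier graph containing p and outside each
    earlier graph missing p. A basic open set involves finitely many graphs, so the largest of their
    levels will do. *)
Lemma spectrum_base (p : sp) (V : set sp) : nbhs p V -> exists L, forall l (i j : I l),
  (L <= l)%N -> sgraph i j p -> sgraph i j `<=` V.
Proof.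
rewrite nbhsE => -[W [[D sD <-] [X DX Xp] WV]].
suff [L hL] : exists L, forall l (i j : I l), (L <= l)%N -> sgraph i j p -> sgraph i j `<=` X.
  by exists L => l i j Ll g q gq; apply: WV; exists X => //; exact: (hL l i j Ll g).
have [Fs sF XE] := sD _ DX; rewrite -XE in Xp *.
have each (Y : set sp) : exists L, Y \in Fs -> forall l (i j : I l), (L <= l)%N -> sgraph i j p ->
    sgraph i j `<=` Y.
  have [YF|] := boolP (Y \in Fs); last by exists 0%N.
  have Yp : Y p by exact: (Xp Y YF).
  have /set_mem[G [k [a [b [Tab ->]]]] [YE|YE]] := sF _ YF; exists k => _ l i j kl g.
    rewrite YE in Yp *; apply: (sgraph_sub kl _ Yp g); exact/asboolP.
  rewrite YE in Yp *; apply: (sgraph_disj kl _ Yp g); exact/asboolP.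
have [L hL] := choice each.
exists (\max_(Y <- enum_fset Fs) L Y) => l i j Ll g q gq Y YF.
apply: (hL Y YF l i j _ g) => //; apply: leq_trans Ll.
by rewrite (big_rem Y)//= leq_maxl.
Qed.

Lemma spectrum_nbhs (p : sp) k (i j : I k) : T i j -> sgraph i j p -> nbhs p (sgraph i j).
Proof. by move=> Tij g; apply: open_nbhs_nbhs; split=> //; exact: sgraph_open. Qed.

Lemma sgraph_neq0 k (i j : I k) : T i j -> E i j != 0 -> exists p, sgraph i j p.
Proof.
move=> Tij e0; have [q g _] := char_exists e0.
by have [p pq] := sp_point Tij g; exists p; rewrite /sgraph /= pq.
Qed.

(* Koenig: a filter containing the graph of E_ij meets the graphs along some
   path of matrix units, whose limit point is a cluster point. *)
Lemma sgraph_compact k (i j : I k) : T i j -> compact (sgraph i j).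
Proof.
move=> Tij F PF FA.
have [e0|e0] := eqVneq (E i j) 0.
  have [p /sgraph_pair/graph_units[_ _ _ _]] := filter_ex FA.
  by rewrite e0 eqxx.
pose good l (a b : I l) := T a b /\ forall V, F V -> V `&` sgraph a b !=set0.
have g0 : good k i j.
  by split=> // V FV; exact: filter_ex (filterI FV FA).
have gS l (a b : I l) : good l a b -> E a b != 0 -> exists q : I l.+1 * I l.+1, good l.+1 q.1 q.2 /\
  [/\ E q.1 q.2 != 0, E a a * E q.1 q.1 = E q.1 q.1, E b b * E q.2 q.2 = E q.2 q.2 &
      E a b * E q.2 q.2 = E q.1 q.2].
  move=> [Tab hg] eab; apply: contrapT => hn.
  (* If no refinement were good, each would be missed, inside the graph of [E a b], by some member
     of F. The intersection of these finitely many members would miss the graph of [E a b], which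
     the refinements cover. *)
  have bad (q : I l.+1 * I l.+1) : exists V, F V /\ forall p, V p -> sgraph a b p -> ~ sgraph q.1 q.2 p.
    have [[p0 [g1 g2]]|hne] := pselect (exists p0, sgraph a b p0 /\ sgraph q.1 q.2 p0); last first.
      by exists setT; split=> [|p _ ga gq]; [exact: filterT|apply: hne; exists p].
    have [i' [j' [h1 h2 h3 h4 h5]]] := graph_step (leqnSn l) (sgraph_pair g1).
    have [q1 q2] := graph_uniq h5 (sgraph_pair g2).
    apply: contrapT => hV; apply: hn; exists q; split; last by rewrite -q1 -q2.
    split; first by rewrite -q1 -q2; exact: (munit_refine_tri (leqnSn l) Tab h1 h2).
    move=> V FV; apply: contrapT => hne; apply: hV; exists V; split=> // p Vp _ gp.
    by apply: hne; exists p.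
  have [V hV] := choice bad.
  have FV : F (\bigcap_(q in [set: I l.+1 * I l.+1]) V q).
    have -> : [set: I l.+1 * I l.+1] = [set` [fset q | q in {: I l.+1 * I l.+1}]%fset].
      by apply/seteqP; split=> // q _ /=; rewrite !inE.
    by apply: filter_bigI => q _; exact: (hV q).1.
  have [p [Vp gp]] := hg _ FV.
  have [i' [j' [_ _ _ gp']]] := sgraph_step (leqnSn l) gp Tab.
  by apply: ((hV (i', j')).2 p _ gp gp'); exact: (Vp (i', j')).
have [r [s [rs r0 s0 hg]]] := unit_path_exists e0 g0 gS.
have [p pE] : exists p : sp, val p = (path_char r, path_char s).
  by apply: (@sp_point k i j) => //; have := path_graph rs 0%N; rewrite r0 s0.
have gp m : sgraph (r m) (s m) p by rewrite /sgraph /= pE; exact: path_graph.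
exists p; split; first by have := gp 0%N; rewrite r0 s0.
move=> V W FV /spectrum_base[L hL].
have [q [Vq gq]] := (hg L).2 V FV.
by exists q; split=> //; apply: (hL _ _ _ (leq_addr k L) (gp L)).
Qed.

Definition ind_graph k (i j : I k) : sp -> int := fun p => (`[< sgraph i j p >])%:R.

Lemma ind_graph_C0Z k (i j : I k) : T i j -> ind_graph i j \in C0Z_pred (X := sp).
Proof.
move=> Tij; apply/asboolP; split.
  move=> p V /nbhs_singleton Vp.
  have [g|g] := pselect (sgraph i j p).
    apply: filterS (spectrum_nbhs Tij g) => q gq; move: Vp; rewrite /= /ind_graph.
    by rewrite !asboolT.
  have : nbhs p (~` sgraph i j) by apply: open_nbhs_nbhs; split=> //; exact: sgraphC_open.
  apply: filterS => q gq; move: Vp; rewrite /= /ind_graph.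
  by rewrite !asboolF.
move=> e e0; exists (sgraph i j); first exact: sgraph_compact.
by move=> p g; rewrite /ind_graph asboolF// normr0.
Qed.

(** An integer of absolute value less than 1 is 0, so f vanishes off a compact set. Compactness then
    gives one level at which f is constant on every graph meeting that set. *)
Lemma C0Z_decomp (f : sp -> int) : f \in C0Z_pred (X := sp) -> exists L (m : I L -> I L -> int),
  (forall i j, ~~ T i j -> m i j = 0) /\ forall p, f p = \sum_i \sum_j m i j * ind_graph i j p.
Proof.
move=> /asboolP[fc f0]; have [Fs cF hF] := f0 1 ltr01.
have f1 p : ~ Fs p -> f p = 0.
  by move=> /hF; rewrite -[1]/(1%:~R) ltr_int; case: (f p) => [[|n]|n].
pose P L (x : sp) := exists i j : I L, [/\ T i j, sgraph i j x & forall y, sgraph i j y -> f y = f x].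
(* The near-covering form of compactness, with the filter of large levels, makes the level uniform
   over the compact set. *)
have /compact_near_coveringP/(_ nat \oo P _)[|N _ hN] := cF.
  move=> x Fx.
  have fx : nbhs x [set y | f y = f x].
    exact: (fc x [set f x] (discrete_set1 (f x : discrete_topology int))).
  have [L0 hL0] := spectrum_base fx; have [L1 hL1] := sgraph_level x.
  have [i [j [Tij g]]] := hL1 (maxn L0 L1) (leq_maxr _ _).
  have fE y : sgraph i j y -> f y = f x := hL0 _ i j (leq_maxl _ _) g y.
  exists (sgraph i j, [set l | (maxn L0 L1 <= l)%N]).
    by split; [exact: spectrum_nbhs|exists (maxn L0 L1)].
  move=> [y l] [/= gy Ll]; have [i' [j' [e' h T' g']]] := sgraph_step Ll gy Tij.
  exists i', j'; split=> // z gz; rewrite (fE y gy); apply: fE.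
  exact: (sgraph_up Ll e' h gz).
have {}hN x : Fs x -> P N x by move=> Fx; exact: (hN N (leqnn N) x Fx).
pose hit (i j : I N) x := Fs x /\ sgraph i j x.
(* The value of f at some point of the graph inside the compact set. The default 0 is correct for a
   graph missing that set, since f vanishes there. *)
pose m (i j : I N) : int := if pselect (exists x, hit i j x) is left h then f (projT1 (cid h)) else 0.
have mE i j : (exists2 x, hit i j x & m i j = f x) \/ ((forall x, ~ hit i j x) /\ m i j = 0).
  rewrite /m; case: pselect => [h|h]; last by right; split=> // x hx; apply: h; exists x.
  by left; exists (projT1 (cid h)) => //; exact: projT2 (cid h).
exists N, m; split.
  move=> i j nT; case: (mE i j) => [[x [Fx g] _]|[_ ->]//].
  have [i' [j' [T' g' _]]] := hN x Fx; have [ii jj] := sgraph_uniq g g'.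
  by rewrite ii jj T' in nT.
move=> p; have [[i [j g]]|ng] := pselect (exists i j : I N, sgraph i j p); last first.
  rewrite big1 => [|i _].
    by apply: f1 => Fp; have [i [j [_ g _]]] := hN p Fp; apply: ng; exists i, j.
  by rewrite big1// => j _; rewrite /ind_graph asboolF ?mulr0// => g; apply: ng; exists i, j.
rewrite (bigD1 i)//= [X in _ + X]big1 ?addr0; last first.
  move=> a ai; rewrite big1// => b _; rewrite /ind_graph asboolF ?mulr0// => g'.
  by have [ia _] := sgraph_uniq g g'; rewrite ia eqxx in ai.
rewrite (bigD1 j)//= [X in _ + X]big1 ?addr0; last first.
  move=> b bj; rewrite /ind_graph asboolF ?mulr0// => g'.
  by have [_ jb] := sgraph_uniq g g'; rewrite jb eqxx in bj.
rewrite /ind_graph asboolT// mulr1; case: (mE i j) => [[x [Fx gx] ->]|[no ->]].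
  have [i' [j' [_ g' h]]] := hN x Fx; have [ii jj] := sgraph_uniq gx g'.
  by apply: h; rewrite -ii -jj.
by apply: f1 => Fp; apply: (no p).
Qed.

(** * The rank function *)

Definition prank (p : sp) n (v : 'M[U]_n) : int :=
  Posz (\rank (xget 0 (@mcoef n (val p).1 (val p).2 v))).

Lemma sp_mcoef (p : sp) n (v : 'M[U]_n) : Mset A v -> exists V, mcoef (val p).1 (val p).2 v V.
Proof.
move=> Av; have [k [i [j [_ g]]]] := sp_graph p.
exact: (mcoef_ex (sgraph_pair g) Av).
Qed.

Lemma prankE (p : sp) n (v : 'M[U]_n) V : mcoef (val p).1 (val p).2 v V -> prank p v = Posz (\rank V).
Proof.
move=> hV; rewrite /prank; congr (Posz (\rank _)); apply: xget_unique => // W hW.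
have [k [i [j [_ g]]]] := sp_graph p.
exact: (mcoef_uniq (sgraph_pair g) hW hV).
Qed.

Definition ccorner n N (V : 'M[K]_n) : 'M[K]_N :=
  (pid_mx n : 'M_(N, n)) *m V *m (pid_mx n : 'M_(n, N)).

Lemma ccornerE n N (V : 'M[K]_n) i j : ccorner N V i j =
  if (insub (val i) : option 'I_n, insub (val j) : option 'I_n) is (Some i', Some j') then V i' j' else 0.
Proof.
rewrite /ccorner -mulmxA mxE.
case: insubP => [i' _ ii|ni]; last first.
  rewrite big1// => a _; rewrite mxE.
  have -> : (i == a :> nat) = false by apply: contraNF ni => /eqP /= ->.
  by rewrite mul0r.
rewrite (bigD1 i')//= big1 ?addr0; last first.
  move=> a ai; rewrite mxE.
  have -> : (i == a :> nat) = false by apply: contraNF ai => /eqP h; apply/eqP/val_inj; rewrite /= -h -ii.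
  by rewrite mul0r.
rewrite mxE -[nat_of_ord i]ii eqxx ltn_ord mul1r mxE.
case: insubP => [j' _ jj|nj]; last first.
  rewrite big1// => a _; rewrite mxE.
  have -> : (a == j :> nat) = false by apply: contraNF nj => /eqP /= <-.
  by rewrite mulr0.
rewrite (bigD1 j')//= big1 ?addr0; last first.
  move=> a aj; rewrite mxE.
  have -> : (a == j :> nat) = false by apply: contraNF aj => /eqP h; apply/eqP/val_inj; rewrite /= h -jj.
  by rewrite mulr0.
by rewrite mxE -[nat_of_ord j]jj eqxx ltn_ord mulr1.
Qed.

Lemma mcoef_corner x y n N (v : 'M[U]_n) V : mcoef x y v V -> mcoef x y (corner N v) (ccorner N V).
Proof.
move=> h i j; rewrite ccornerE mxE.
case: insubP => [i' _ _|_]; last exact: pcoef0.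
by case: insubP => [j' _ _|_]; [exact: h|exact: pcoef0].
Qed.

Lemma rank_ccorner n N (V : 'M[K]_n) : (n <= N)%N -> \rank (ccorner N V) = \rank V.
Proof.
move=> nN; apply/eqP; rewrite eqn_leq; apply/andP; split.
  by apply: leq_trans (mxrankM_maxl _ _) _; exact: mxrankM_maxr.
have {1}-> : V = (pid_mx n : 'M_(n, N)) *m ccorner N V *m (pid_mx n : 'M_(N, n)).
  rewrite /ccorner !mulmxA mul_pid_mx -!mulmxA mul_pid_mx minnn (minn_idPr nN).
  by rewrite pid_mx_1 mul1mx mulmx1.
by apply: leq_trans (mxrankM_maxl _ _) _; exact: mxrankM_maxr.
Qed.

Lemma prank_equiv (p : sp) n m (v : 'M[U]_n) (w : 'M[U]_m) : Mset A v -> Mset A w ->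
  pi_equiv A C v w -> prank p v = prank p w.
Proof.
move=> Av Aw [N [nN mN [z [y [hz hy zvy]]]]].
have [V hV] := sp_mcoef p Av; have [W hW] := sp_mcoef p Aw.
rewrite (prankE hV) (prankE hW) -(rank_ccorner V nN) -(rank_ccorner W mN).
have [k [i [j [_ /sgraph_pair g]]]] := sp_graph p.
have [Gx Gy _ _ _] := graph_units g.
(* The entries of u lie in [Cu], where coefficients at (x, x) are multiplicative; the coefficient
   matrix of the adjoint is therefore the inverse. *)
have inv x (u : 'M[U]_N) : gelfand x -> normalising_unitary A C u ->
    exists2 Z, mcoef x x u Z & Z \in unitmx.
  move=> G hu; have Cu' := normalising_unitaryC hu; have [_ uu su _] := hu.
  have [Z hZ] := mcoef_Cu G Cu'; have [Z' hZ'] := mcoef_Cu G (MsetCu_star Cu').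
  exists Z => //; have [k' [i' xi']] := char_level G.
  have := mcoefMl Cu' hZ hZ'; rewrite uu => h.
  have ZZ := mcoef_uniq (graph_diag G xi') h (@mcoef1 N _ G).
  by have [] := mulmx1_unit ZZ.
have [Z hZ Zu] := inv _ _ Gx hz; have [Y hY Yu] := inv _ _ Gy hy.
have h1 := mcoefMr (normalising_unitaryC hy) (mcoefMl (normalising_unitaryC hz) hZ (mcoef_corner (N := N) hV)) hY.
rewrite zvy in h1; rewrite -(mcoef_uniq g h1 (mcoef_corner (N := N) hW)).
have Zf : row_full Z by rewrite row_full_unit.
have Yf : row_free Y by rewrite row_free_unit.
by rewrite (mxrankMfree _ Yf) (eqmxMfull _ Zf).
Qed.

Lemma prank_dsum (p : sp) n m (v : 'M[U]_n) (w : 'M[U]_m) : Mset A v -> Mset A w ->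
  prank p (block_mx v 0 0 w) = prank p v + prank p w.
Proof.
move=> Av Aw; have [V hV] := sp_mcoef p Av; have [W hW] := sp_mcoef p Aw.
rewrite (prankE hV) (prankE hW).
have -> : prank p (block_mx v 0 0 w) = Posz (\rank (block_mx V 0 0 W)).
  apply: prankE => i j; rewrite -(splitK i) -(splitK j).
  case: (fintype.split i) => a; case: (fintype.split j) => b /=;
    rewrite ?block_mxEul ?block_mxEur ?block_mxEdl ?block_mxEdr; [exact: hV| | |exact: hW];
    by rewrite !mxE; exact: pcoef0.
by rewrite rank_diag_block_mx.
Qed.

(** On its graph [E i j] dominates the deep units through p and has coefficient 1; off it, its
    compressions by deep units through p vanish. *)
Lemma prank_unit (p : sp) k (i j : I k) : T i j -> prank p ((E i j)%:S : 'M_1) = ind_graph i j p.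
Proof.
move=> Tij; pose t : K := (`[< sgraph i j p >])%:R.
have tE : mcoef (val p).1 (val p).2 ((E i j)%:S : 'M_1) t%:S.
  move=> a b; rewrite !ord1 !mxE eqxx !mulr1n.
  have [k' [i' [j' [_ g']]]] := sp_graph p; pose L := maxn k k'.
  move=> e e0; exists L => l i1 j1; rewrite geq_max => /andP[kl kl'] xi yj.
  have [a' [b' [e1 _ _ _ g1]]] := graph_step kl' (sgraph_pair g').
  have [Gx Gy xa yb _] := graph_units g1.
  have ia := char_uniq Gx xi xa; have jb := char_uniq Gy yj yb; subst a' b'.
  suff -> : E i1 i1 * E i j * E j1 j1 = t *: E i1 j1 by rewrite subrr nrm0 ltW.
  rewrite /t; case: asboolP => g.
    have [a2 [b2 [e2 h2 _ _ g2]]] := graph_step kl (sgraph_pair g).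
    have [aa bb] := graph_uniq g2 g1; subst a2 b2.
    by rewrite -mulrA h2 munit_idl scale1r.
  rewrite scale0r -mulrA; case: (munit_refine_le kl i j j1) => [->|[a3 e3 h3]]; first by rewrite mulr0.
  rewrite h3; have [ia3|ia3] := eqVneq i1 a3; last by rewrite munit_mul0.
  by case: g; subst a3; apply: (sgraph_up kl e3 h3); exact: g1.
rewrite (prankE tE) /ind_graph /t; case: asboolP => _; first by rewrite mxrank1.
by rewrite raddf0 mxrank0.
Qed.

(** * Ranks on the Grothendieck group *)

Definition rank_at (p : sp) : {freeg (Pi A C) / int} -> int^o :=
  fglift (fun v : Pi A C => prank p (pi_mx v) : int^o).

Lemma rank_atB p x y : rank_at p (x - y) = rank_at p x - rank_at p y.
Proof. exact: lift_is_additive. Qed.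
Lemma rank_at0 p : rank_at p 0 = 0.
Proof. by rewrite -(subrr 0) rank_atB subrr. Qed.
Lemma rank_atD p x y : rank_at p (x + y) = rank_at p x + rank_at p y.
Proof. by rewrite -{1}[y]opprK -[- y]add0r !rank_atB rank_at0 sub0r opprK. Qed.

Lemma rank_atU p (v : Pi A C) : rank_at p <<v>> = prank p (pi_mx v).
Proof. by rewrite /rank_at liftU scale1r. Qed.

Lemma pi_NP (v : Pi A C) : NP (pi_mx v).
Proof. by case: v => w; exact: asboolW. Qed.

Lemma rank_at_rel p x : x \in @pi_relations _ U A C -> rank_at p x = 0.
Proof.
move=> /asboolP /(_ [set x | rank_at p x = 0]) h; apply: h; split.
  split; first by apply/asboolP; exact: rank_at0.
  move=> a b /asboolP /= ha /asboolP /= hb; apply/asboolP => /=.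
  by rewrite rank_atB ha hb subrr.
have Am (v : Pi A C) : Mset A (pi_mx v) by have [] := pi_NP v.
move=> y [[v [w [vw ->]]]|[v [w [s [vws ->]]]]] /=.
  by rewrite rank_atB !rank_atU (prank_equiv p _ _ vw) ?subrr.
rewrite rank_atB rank_atD !rank_atU.
have -> : prank p (pi_mx s) = prank p (block_mx (pi_mx v) 0 0 (pi_mx w)).
  by rewrite /pi_mx /pi_size vws.
by rewrite prank_dsum// subrr.
Qed.

(** Computed on a chosen representative; [dg_rank_pi] shows that any other gives the same value. *)
Definition dg_rank (g : DG) (p : sp) : int :=
  rank_at p (repr (g : Quotient.quot (@pi_relations _ U A C))).

Lemma dg_rank_pi x p : dg_rank (dg_pi x) p = rank_at p x.
Proof.
apply/eqP; rewrite -subr_eq0 /dg_rank -[_ - _]rank_atB rank_at_rel//.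
by apply: dg_pi_relE; rewrite /dg_pi reprK.
Qed.

Lemma dg_rankD g h p : dg_rank (g + h) p = dg_rank g p + dg_rank h p.
Proof.
have [x <-] := dg_pi_surj g; have [y <-] := dg_pi_surj h.
by rewrite -dg_piD !dg_rank_pi rank_atD.
Qed.

Lemma dg_rank_class n (v : 'M[U]_n) p : NP v -> dg_rank (dg_class v) p = prank p v.
Proof. by move=> hv; rewrite (dg_classE hv) dg_rank_pi rank_atU. Qed.

Lemma dg_rank0 p : dg_rank 0 p = 0.
Proof. by apply: (@addrI _ (dg_rank 0 p)); rewrite -dg_rankD !addr0. Qed.
Lemma dg_rankN g p : dg_rank (- g) p = - dg_rank g p.
Proof. by apply/eqP; rewrite -addr_eq0 -dg_rankD addNr dg_rank0. Qed.
Lemma dg_rankMz g (z : int) p : dg_rank (g *~ z) p = z * dg_rank g p.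
Proof.
have nat n : dg_rank (g *+ n) p = n%:Z * dg_rank g p.
  elim: n => [|n IH]; first by rewrite mulr0n dg_rank0 mul0r.
  by rewrite mulrS dg_rankD IH -addn1 PoszD mulrDl mul1r addrC.
case: z => n; first by rewrite -nat.
by rewrite NegzE mulrNz dg_rankN mulNr -nat.
Qed.
Lemma dg_rank_sum J (r : seq J) (F : J -> DG) p :
  dg_rank (\sum_(i <- r) F i) p = \sum_(i <- r) dg_rank (F i) p.
Proof. by elim: r => [|i r IH]; rewrite ?big_nil ?big_cons ?dg_rank0// dg_rankD IH. Qed.

Lemma dg_rank_unit k (i j : I k) p : T i j -> dg_rank (dg_unit i j) p = ind_graph i j p.
Proof.
move=> Tij; rewrite /dg_unit dg_rank_class ?prank_unit//.
by rewrite -amp_scalar; apply: NP_amp; rewrite ?mulmx1// trmx1 map_mx1.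
Qed.

(** * Bijectivity of the rank map *)

Definition unit_comb (g : DG) L (m : I L -> I L -> int) : Prop :=
  (forall i j, ~~ T i j -> m i j = 0) /\ g = \sum_i \sum_j dg_unit i j *~ m i j.

Lemma dg_rank_comb g L (m : I L -> I L -> int) p : unit_comb g m ->
  dg_rank g p = \sum_i \sum_j m i j * ind_graph i j p.
Proof.
move=> [mT ->]; rewrite dg_rank_sum; apply: eq_bigr => i _.
rewrite dg_rank_sum; apply: eq_bigr => j _; rewrite dg_rankMz.
by have [Tij|/mT ->] := boolP (T i j); [rewrite dg_rank_unit|rewrite !mul0r].
Qed.

(** All large levels are asked for, so that two group elements can be expanded at a common level and
    subtracted. *)
Definition comb_all (g : DG) : Prop := exists L0, forall L, (L0 <= L)%N -> exists m : I L -> I L -> int, unit_comb g m.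

Lemma comb_allB g h : comb_all g -> comb_all h -> comb_all (g - h).
Proof.
move=> [L0 h0] [L1 h1]; exists (maxn L0 L1) => L; rewrite geq_max => /andP[/h0[m [mT ->]] /h1[m' [mT' ->]]].
exists (fun i j => m i j - m' i j); split; first by move=> i j nT; rewrite mT// mT'// subrr.
rewrite -sumrB; apply: eq_bigr => i _; rewrite -sumrB; apply: eq_bigr => j _.
by rewrite mulrzBr.
Qed.

Lemma comb_all0 : comb_all 0.
Proof.
exists 0%N => L _; exists (fun _ _ => 0); split=> //.
by rewrite big1// => i _; rewrite big1// => j _; rewrite mulr0z.
Qed.

Lemma comb_allN g : comb_all g -> comb_all (- g).
Proof. by move=> h; rewrite -[- g]add0r; apply: comb_allB => //; exact: comb_all0. Qed.
Lemma comb_allD g h : comb_all g -> comb_all h -> comb_all (g + h).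
Proof. by move=> hg hh; rewrite -[h]opprK; apply: comb_allB => //; exact: comb_allN. Qed.

Lemma comb_all_class n (v : 'M[U]_n) : NP v -> comb_all (dg_class v).
Proof.
move=> hv; have [L0 h0] := dg_class_decomp hv; exists L0 => L /h0[m [mT ->]].
exists (fun i j => Posz (m i j)); split; first by move=> i j /mT ->.
by [].
Qed.

Lemma dg_pi0 : dg_pi 0 = 0.
Proof. by apply: (@addrI _ (dg_pi 0)); rewrite -dg_piD !addr0. Qed.

Lemma comb_allP g : comb_all g.
Proof.
have [x <-] := dg_pi_surj g; rewrite -(freeg_sumE x).
elim: (dom x) => [|v s IH].
  by rewrite big_nil dg_pi0; exact: comb_all0.
rewrite big_cons dg_piD; apply: comb_allD => //.
have nat (n : nat) : comb_all (dg_pi << n%:Z *g v >>).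
  have gen : comb_all (dg_pi << v >>).
    by rewrite dg_class_Pi; apply: comb_all_class; exact: pi_NP.
  rewrite -[n%:Z]natz -freegU_muln; elim: n => [|n IHn].
    by rewrite mulr0n dg_pi0; exact: comb_all0.
  by rewrite mulrS dg_piD; exact: comb_allD.
case: (coeff v x) => n; first exact: nat.
by rewrite NegzE -freegUN dg_piN; apply: comb_allN.
Qed.

Lemma dg_rank_C0Z g : dg_rank g \in C0Z_pred (X := sp).
Proof.
have [L0 h0] := comb_allP g; have [m hm] := h0 L0 (leqnn _).
have -> : dg_rank g = \sum_i \sum_j ind_graph i j *~ m i j.
  apply/funext => p; rewrite (dg_rank_comb p hm).
  have sumE J (r : seq J) (F : J -> sp -> int) : (\sum_(a <- r) F a) p = \sum_(a <- r) F a p.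
    by elim: r => [|a r IH]; rewrite ?big_nil ?big_cons//= -IH.
  rewrite sumE; apply: eq_bigr => i _; rewrite sumE; apply: eq_bigr => j _.
  have nat (f : sp -> int) n : (f *+ n) p = n%:Z * f p.
    elim: n => [|n IH]; first by rewrite mulr0n mul0r.
    by rewrite mulrS /= -addn1 PoszD mulrDl mul1r addrC -IH.
  case: (m i j) => n; first by rewrite -nat.
  by rewrite NegzE mulrNz /= mulNr -nat.
apply: rpred_sum => i _; apply: rpred_sum => j _.
have [Tij|nT] := boolP (T i j); first by apply: rpredMz; exact: ind_graph_C0Z.
by have [mT _] := hm; rewrite mT// mulr0z rpred0.
Qed.

(** Graphs of one level are disjoint, so at a point of the graph of [E i j] the rank function equals
    the multiplicity [m i j] alone. *)
Lemma dg_rank_inj g : (forall p, dg_rank g p = 0) -> g = 0.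
Proof.
move=> h; have [L0 h0] := comb_allP g; have [m hm] := h0 L0 (leqnn _).
have [mT ->] := hm; rewrite big1// => i _; rewrite big1// => j _.
have [Tij|nT] := boolP (T i j); last by rewrite mT// mulr0z.
(* A zero unit has an empty graph, so ranks do not determine its multiplicity; but its class is
   0. *)
have [e0|e0] := eqVneq (E i j) 0.
  by rewrite /dg_unit e0 raddf0 dg_class0 mul0rz.
have [p g'] := sgraph_neq0 Tij e0.
have := h p; rewrite (dg_rank_comb p hm) (bigD1 i)//= [X in _ + X]big1 ?addr0; last first.
  move=> a ai; rewrite big1// => b _; rewrite /ind_graph asboolF ?mulr0// => gb.
  by have [ia _] := sgraph_uniq g' gb; rewrite ia eqxx in ai.
rewrite (bigD1 j)//= [X in _ + X]big1 ?addr0; last first.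
  move=> b bj; rewrite /ind_graph asboolF ?mulr0// => gb.
  by have [_ jb] := sgraph_uniq g' gb; rewrite jb eqxx in bj.
by rewrite /ind_graph asboolT// mulr1 => ->; rewrite mulr0z.
Qed.

Lemma dg_rank_surj f : f \in C0Z_pred (X := sp) -> exists g, dg_rank g = f.
Proof.
move=> /C0Z_decomp[L [m [mT fE]]].
exists (\sum_i \sum_j dg_unit i j *~ m i j); apply/funext => p.
by rewrite fE; apply: dg_rank_comb.
Qed.

Definition dg_to_C0Z (g : DG) : C0Z sp := Sub (dg_rank g) (dg_rank_C0Z g).

Lemma val_dg_to_C0Z g : val (dg_to_C0Z g) = dg_rank g.
Proof. exact: SubK. Qed.

Lemma dg_to_C0Z_additive : additive dg_to_C0Z.
Proof.
move=> g h; apply: val_inj; rewrite raddfB; apply/funext => p.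
by rewrite /= dg_rankD dg_rankN.
Qed.

HB.instance Definition _ := GRing.isZmodMorphism.Build DG (C0Z sp) dg_to_C0Z dg_to_C0Z_additive.

Lemma dg_to_C0Z_iso : exists phi : {additive DG -> C0Z sp}, bijective phi.
Proof.
exists dg_to_C0Z.
have surj y : exists g, dg_to_C0Z g = y.
  have [g gy] := dg_rank_surj (valP y); exists g; apply: val_inj.
  by rewrite val_dg_to_C0Z.
have inj : injective dg_to_C0Z.
  move=> g h gh; apply/eqP; rewrite -subr_eq0; apply/eqP; apply: dg_rank_inj => p.
  by rewrite dg_rankD dg_rankN -!val_dg_to_C0Z gh subrr.
exists (fun y => projT1 (cid (surj y))) => [g|y]; last exact: projT2 (cid (surj y)).
by apply: inj; exact: projT2 (cid (surj (dg_to_C0Z g))).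
Qed.

End Units.

Theorem proposition2p2 (R : realType) (S : digraph_system R[i])
    (U : cstarAlgType R[i])
    (iota : forall k, 'M[R[i]]_((ddim S k).+1) -> U)
    (Sreg : regular_system S) (Sunits : adapted_units S)
    (Ulim : is_limit iota) (UTAF : TAF iota) :
  exists phi : {additive dim_group (limA iota) (limC iota)
                  -> C0Z (spectrum iota)},
    bijective phi.
Proof. exact: (dg_to_C0Z_iso Sreg Sunits Ulim UTAF). Qed.
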